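(* Let $T_0:S^1\to S^1$ satisfy (A0) and (A1), let $c\in L^\infty(S^1,\mathbb{R})$, and define $\mathcal{J}:H^4(S^1,\mathbb{R})\to\mathbb{R}$ by $\mathcal{J}(\dot T)=-\int_{S^1}c(x)\,R(\dot T)(x)\,dx$, where $R(\dot T)$ is the linear response of the invariant density to families $T_\delta$ satisfying (A0), (A1), (A2) with first-order perturbation $\dot T$. If $\mathcal{J}$ is not uniformly vanishing, then there is a unique solution $\dot T$ of the problem of minimising $\mathcal{J}(\dot T)$ over $\dot T\in H^4(S^1,\mathbb{R})$ subject to $\|\dot T\|_{H^4}\le1$.
   Context: $S^1=\mathbb{R}/\mathbb{Z}$. $W^{k,p}$ is the Sobolev space of functions with weak derivatives up to order $k$ in $L^p$; $H^k=W^{k,2}$, and $\|f\|_{H^4}^2=\sum_{k=0}^4\int_{S^1}|f^{(k)}|^2dx$ (so $H^4(S^1)\subset C^3(S^1)$). A family of $C^3$ maps $\{T_\delta:S^1\to S^1\}_{\delta\in[0,\bar\delta)}$ ($\bar\delta>0$) satisfies: (A0) if $T_0\in C^4(S^1)$; (A1) if there is $\alpha<1$ such that $|T_0'(x)|\ge\alpha^{-1}$ for all $x\in S^1$; (A2) if $T_\delta(x)=T_0(x)+\delta\dot T(x)+F_\delta(x)$ (mod 1) with $\dot T\in C^3(S^1,\mathbb{R})$ and $\sup_{\delta\in(0,\bar\delta)}\|F_\delta\|_{C^3}/\delta^2<\infty$. Conditions (A0) and (A1) concern only $T_0$. The transfer operator of $T_\delta$ is $L_\delta f(x)=\sum_{y\in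 T_\delta^{-1}(x)}f(y)/|T_\delta'(y)|$. For small $\delta$, $f_\delta$ denotes the unique absolutely continuous invariant probability density of $T_\delta$. The linear response is $R(\dot T)=\lim_{\delta\to0}(f_\delta-f_0)/\delta$ (limit in $L^1$); it depends only on $T_0$ and $\dot T$ and equals $-(I-L_0)^{-1}L_0\left(\left[f_0\dot T/T_0'\right]'\right)$, where $(I-L_0)^{-1}=\sum_{j\ge0}L_0^j$ is the bounded inverse of $I-L_0$ on the zero-mean functions in $W^{1,1}(S^1)$. *)

(* Defs.v *)
From HB Require Import structures.
From mathcomp Require Import all_boot all_order all_algebra.
From mathcomp Require Import all_classical all_reals all_analysis.

Set Implicit Arguments.
Unset Strict Implicit.
Unset Printing Implicit Defensive.
Import Order.TTheory GRing.Theory Num.Theory.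
Import numFieldNormedType.Exports.
Local Open Scope classical_set_scope.
Local Open Scope ring_scope.

(* Conventions for the circle S^1 = R/Z.  A function on S^1 is a 1-periodic
   function on the line, a map S^1 -> S^1 is given by a lift R -> R, a subset
   of S^1 is a 1-periodic subset of R, and integration over S^1 is Lebesgue
   integration over the fundamental domain [0, 1[. *)

Section regularity.
Context {R : realType}.
Implicit Types (f g T : R -> R) (A : set R).

Definition classC (k : nat) f : Prop :=
  (forall i x, (i < k)%N -> derivable (derive1n i f) x 1) /\ continuous (derive1n k f).

Definition circle_classC (k : nat) f : Prop := periodic f 1 /\ classC k f.

(* [d] is the degree of the circle map lifted by [T]. *)
Definition circle_map (k : nat) T : Prop :=
  classC k T /\ exists d : int, forall x, T (x + 1) = T x + d%:~R.

Definition normC (k : nat) f : \bar R :=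
  (\sum_(i < k.+1) ereal_sup [set `|derive1n i f x|%:E | x in [set: R]])%E.

Definition circle_set A : Prop :=
  measurable A /\ forall x, A (x + 1) <-> A x.

(* L^p(S^1), 1 <= p <= +oo, on the level of representatives. *)
Definition circle_L (p : \bar R) f : Prop :=
  periodic f 1 /\ (f \_ `[0, 1[) \in Lfun (@lebesgue_measure R) p.

Definition circle_int f : R := \int[lebesgue_measure]_(x in `[0, 1[) f x.

Definition circle_ae_eq f g : Prop := ae_eq (@lebesgue_measure R) [set` `[0, 1[%R] f g.

End regularity.

Section sobolev.
Context {R : realType}.
Implicit Types (f g phi : R -> R).

Definition is_weak_derivative (k : nat) f g : Prop :=
  circle_L 1 g /\
  forall phi, (forall n, circle_classC n phi) ->
    circle_int (fun x => f x * derive1n k phi x) =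
    (-1) ^+ k * circle_int (fun x => g x * phi x).

(* Weak derivatives are unique up to a null set, so every integral of
   [weak_derivative k f] is independent of the choice; the default value is
   only used when there is no weak derivative. *)
Definition weak_derivative (k : nat) f : R -> R :=
  xget (cst 0) [set g | is_weak_derivative k f g].

Definition sobolev (k : nat) (p : \bar R) f : Prop :=
  circle_L p f /\
  forall j, (j <= k)%N -> exists2 g, is_weak_derivative j f g & circle_L p g.

(* Each class in H^4(S^1) is represented by its unique continuous element;
   in particular equality in H^4 is equality of functions. *)
Definition H4 f : Prop := sobolev 4 2%:E f /\ continuous f.

Definition H4norm f : R :=
  Num.sqrt (\sum_(k < 5) circle_int (fun x => weak_derivative k f x ^+ 2)).

End sobolev.

Section linear_response.
Context {R : realType}.
Implicit Types (f g r c Tdot : R -> R) (T : R -> R).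

(* Absolutely continuous invariant probability densities: the measure [f dx]
   on the circle is invariant under [T]. *)
Definition invariant_density T f : Prop :=
  [/\ circle_L 1 f,
      forall x, 0 <= f x,
      circle_int f = 1
    & forall A, circle_set A ->
        \int[lebesgue_measure]_(x in `[0, 1[ `&` T @^-1` A) f x =
        \int[lebesgue_measure]_(x in `[0, 1[ `&` A) f x].

Definition unique_invariant_density T f : Prop :=
  invariant_density T f /\
  forall g, invariant_density T g -> circle_ae_eq f g.

(* [alpha] is required to be positive: otherwise the bound would be void. *)
Definition expanding T : Prop :=
  exists2 alpha : R, 0 < alpha < 1 & forall x, alpha^-1 <= `|derive1 T x|.

(* [T d] is (a lift of) the map T_delta for delta = d in [0, dbar[; the
   integer [m] expresses equality modulo 1. *)
Definition perturbation_family (T0 Tdot : R -> R) (dbar : R)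
    (T : R -> R -> R) : Prop :=
  [/\ 0 < dbar,
      T 0 = T0,
      forall d, 0 <= d < dbar -> circle_map 3 (T d),
      circle_classC 3 Tdot
    & exists F : R -> R -> R,
      [/\ forall d, 0 < d < dbar -> circle_classC 3 (F d),
          forall d x, 0 < d < dbar -> exists m : int,
            T d x = T0 x + d * Tdot x + F d x + m%:~R
        & (ereal_sup [set normC 3 (F d) * (d ^- 2)%:E | d in `]0%R, dbar[]
             < +oo)%E]].

(* [r] is the L^1 limit of (f_d - f_0) / d as d -> 0+, for every admissible
   family with first-order perturbation [Tdot]. *)
Definition is_linear_response (T0 Tdot r : R -> R) : Prop :=
  circle_L 1 r /\
  forall dbar (T : R -> R -> R),
    circle_map 4 (T 0) -> expanding (T 0) ->
    perturbation_family T0 Tdot dbar T ->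
    exists f : R -> R -> R,
      [/\ unique_invariant_density T0 (f 0),
          \forall d \near 0^'+, unique_invariant_density (T d) (f d)
        & (\int[lebesgue_measure]_(x in `[0%R, 1%R[)
             `|(f d x - f 0 x) / d - r x|%:E)%E @[d --> 0^'+] --> 0%E].

(* Determined up to a null set; the default value is only used when there is
   no linear response. *)
Definition linear_response (T0 Tdot : R -> R) : R -> R :=
  xget (cst 0) [set r | is_linear_response T0 Tdot r].

Definition responseJ c (T0 Tdot : R -> R) : R :=
  - circle_int (fun x => c x * linear_response T0 Tdot x).

End linear_response.

(* Main.v *)
From HB Require Import structures.
Require Import Defs.
From mathcomp Require Import all_boot all_order all_algebra.
From mathcomp Require Import all_classical all_reals all_analysis.
From mathcomp Require Import measurable_realfun ring lra.

(** The functional J is linear and bounded on the Hilbert space H^4 and is not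
    zero; such a functional attains its minimum on the closed unit ball at
    exactly one point.  If m > 0 is the supremum of - J on the ball, then
    - J f <= m ||f|| for all f, so the midpoint of two points of the ball where
    - J is close to m has norm close to 1, and the parallelogram law forces the
    two points to be close ([almost_minimisers]).  Hence maximising sequences
    of - J are Cauchy, and maximisers are unique ([unique_minimiser]).  What
    needs work is that J is linear and bounded and that H^4 is complete.

    Existence of the response.  Let L be the transfer operator of an expanding
    map T.  L contracts a cone of positive functions whose logarithm is
    Lipschitz ([cone_transfer]), and on densities of that cone it acts as a
    common constant part plus q < 1 times another density of the cone
    ([cone_step]).  Iterating, L ^ N decays exponentially on zero-mean Lipschitz
    functions, with constants that depend only on the expansion and distortion
    of T ([transfer_decay]) and are therefore common to all maps near T.  This
    gives the invariant density f0 ([acip]), its uniqueness among integrable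
    densities ([acip_unique]) and the resolvent (I - L)^-1 as a Neumann series
    ([resolvent]).  A cone condition on two derivatives makes f0 differentiable
    with Lipschitz derivative ([acip_C11]).

    For a family T_d = T + d P + O(d^2) with densities f_d, expanding the inverse
    branches gives (L_d f0 - f0) / d = L kappa + O(d) with
    kappa = - (f0 P / T')' ([O_source]).  The candidate for the response is
    (I - L)^-1 L kappa, and the error z = (f_d - f0) / d - (I - L)^-1 L kappa solves
    z = L_d z + e_d, where e_d is O(d) in sup norm and uniformly Lipschitz; the
    uniform decay of L_d makes z tend to 0 ([fixed_point_bound],
    [response_uniform]).  The formula is linear in P and is bounded by the sup
    norms of P, P' and P'' ([density_response_linear],
    [density_response_bound]).

    The space H^4.  An integrable function whose pairing with all smooth
    periodic functions vanishes is null ([pairing_zero_ae]).  From this and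
    primitives of integrable functions ([L1_primitive]) follows the embedding of
    H^4 into C^3 with sup |f^(k)| <= 2 ||f|| for k <= 3 ([H4_regular]); in
    particular J is bounded on H^4.  Completeness ([H4_complete]) follows from
    that of L^2 ([L2_complete]), and the squared norm is a quadratic form
    ([H4sq_comb]). *)

Set Implicit Arguments.
Unset Strict Implicit.
Unset Printing Implicit Defensive.
Import Order.TTheory GRing.Theory Num.Theory.
Import numFieldNormedType.Exports.
Local Open Scope classical_set_scope.
Local Open Scope ring_scope.

(** * Lipschitz, periodic and differentiable functions on the line *)

Section real_calculus.
Context {R : realType}.
Implicit Types (f g F : R -> R) (x y : R).
Local Notation mu := (@lebesgue_measure R).

Definition lip (K : R) f := forall x y, `|f x - f y| <= K * `|x - y|.

Lemma lip_ge0 K f : lip K f -> 0 <= K.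
Proof.
by move=> /(_ 1 0); rewrite subr0 normr1 mulr1; apply: le_trans.
Qed.

Lemma lip_continuous K f : lip K f -> continuous f.
Proof.
move=> fK x; have K0 := lip_ge0 fK.
apply/cvgrPdist_lt => e e0; near=> y.
apply: le_lt_trans (fK x y) _.
have : `|x - y| < e / (K + 1).
  by near: y; apply: cvgr_dist_lt => //; rewrite divr_gt0// ltr_wpDl.
rewrite ltr_pdivlMr ?ltr_wpDl// => xy.
by apply: le_lt_trans xy; rewrite mulrC ler_wpM2l// lerDl.
Unshelve. all: by end_near. Qed.

Lemma is_derive_continuous f (f' : R -> R) :
  (forall x, is_derive x 1 f (f' x)) -> continuous f.
Proof.
move=> df x; apply/differentiable_continuous/derivable1_diffP.
by have [] := df x.
Qed.

Lemma cont_comp f g : continuous f -> continuous g -> continuous (fun x => g (f x)).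
Proof. by move=> cf cg x; exact: (cvg_comp _ _ (cf x) (cg (f x))). Qed.

Lemma is_derive_ext f g x l : f =1 g -> is_derive x 1 f l -> is_derive x 1 g l.
Proof. by move=> /funext ->. Qed.

Lemma mean_value f (f' : R -> R) x y : (forall x, is_derive x 1 f (f' x)) ->
  exists c, f y - f x = f' c * (y - x).
Proof.
move=> df; wlog xy : x y / x <= y.
  move=> H; case/orP: (le_total x y) => [|yx]; first exact: H.
  have [c fc] := H _ _ yx; exists c.
  by rewrite -opprB fc -mulrN opprB.
have cf := is_derive_continuous df.
have [c _ fc] := MVT_segment xy (fun z _ => df z) (continuous_subspaceT cf).
by exists c.
Qed.

Lemma is_derive_lip f (f' : R -> R) K : (forall x, is_derive x 1 f (f' x)) ->
  (forall x, `|f' x| <= K) -> lip K f.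
Proof.
move=> df fK x y; have [c ->] := mean_value y x df.
by rewrite normrM ler_wpM2r.
Qed.

Lemma periodic_int f (d : R) (m : int) : periodic f d -> forall x, f (x + d *~ m) = f x.
Proof.
move=> pf x; case: m => n; first by rewrite -pmulrn periodicn.
by rewrite NegzE mulrNz -pmulrn -(periodicn pf n.+1) subrK.
Qed.

Lemma frac01 x : exists m : int, 0 <= x + m%:~R < 1.
Proof.
exists (- Num.floor x); rewrite intrN.
by rewrite subr_ge0 ltrBlDl -intrD1 floor_le floorD1_gt.
Qed.

Lemma periodic_all (P : R -> Prop) :
  (forall x m, P (x + (m%:~R : R)) -> P x) ->
  (forall x, 0 <= x < 1 -> P x) -> forall x, P x.
Proof. by move=> Pm P01 x; have [m /P01 /Pm] := frac01 x. Qed.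

Lemma periodic1_int f (m : int) : periodic f 1 -> forall x, f (x + m%:~R) = f x.
Proof. by move=> pf x; rewrite -[m%:~R]/(1 *~ m) (periodic_int m pf). Qed.

Lemma continuous_periodic_bounded f : continuous f -> periodic f 1 ->
  exists2 M, 0 <= M & forall x, `|f x| <= M.
Proof.
move=> cf pf.
have cnf : {within `[0, 1], continuous (fun x => `|f x|)}.
  by apply: continuous_subspaceT => x; apply: cvg_norm; exact: cf.
have [c _ Hc] := EVT_max (@ler01 R) cnf.
exists `|f c| => // ; apply: periodic_all => [x m|x /andP[x0 x1]].
  by rewrite periodic1_int.
by apply: Hc; rewrite in_itv /= x0 ltW.
Qed.

Lemma continuous_integrable f (a b : bool) (x y : R) : continuous f ->
  mu.-integrable [set` Interval (BSide a x) (BSide b y)] (EFin \o f).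
Proof.
move=> cf; apply: (@integrableS _ _ _ mu `[x, y]) => //.
  by move=> z /=; rewrite !in_itv/=; case: a; case: b => /= /andP[p q]; rewrite ?p ?q ?(ltW p) ?(ltW q).
by apply: continuous_compact_integrable; [exact: segment_compact|exact: continuous_subspaceT].
Qed.

Lemma Rintegral_FTC2 F f a b : a <= b -> continuous f ->
  (forall x, is_derive x 1 F (f x)) ->
  \int[mu]_(x in `[a, b]) f x = F b - F a.
Proof.
move=> ab cf dF; move: ab; rewrite le_eqVlt => /predU1P[->|ab].
  by rewrite set_itv1 Rintegral_set1 subrr.
have cF := is_derive_continuous dF.
rewrite /Rintegral (@continuous_FTC2 _ f F)//.
- exact: continuous_subspaceT.
- split.
  + by move=> x _; have [] := dF x.
  + by apply: cvg_at_right_filter; exact: cF.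
  + by apply: cvg_at_left_filter; exact: cF.
- by move=> x _; rewrite derive1E derive_val.
Qed.

Lemma Rintegral_cotocc f a b : continuous f ->
  \int[mu]_(x in `[a, b[) f x = \int[mu]_(x in `[a, b]) f x.
Proof. by move=> cf; rewrite Rintegral_itv_bndo_bndc//; exact: continuous_integrable. Qed.

End real_calculus.

(** * Change of variables and the transfer operator *)

Section density_measure.
Context {R : realType}.
Local Notation mu := (@lebesgue_measure R).
Variables (f : R -> R) (f0 : forall x, 0 <= f x) (mf : measurable_fun [set: R] f).

(** The measure f dx.  Nonnegativity and measurability are arguments so that
    the measure structure is inferred from the term; uniqueness of measures
    then extends identities between integrals from intervals to Borel sets. *)
Definition dens of (forall x, 0 <= f x) & measurable_fun [set: R] f :=
  fun A : set (measurableTypeR R) => (\int[mu]_(x in A) (f x)%:E)%E.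

Local Notation D := (dens f0 mf).

Let dens0 : D set0 = 0%E. Proof. by rewrite /dens integral_set0. Qed.

Let dens_ge0 A : (0 <= D A)%E.
Proof. by apply: integral_ge0 => x _; rewrite lee_fin. Qed.

Let dens_sigma_additive : semi_sigma_additive D.
Proof.
move=> F mF tF mUF; rewrite /dens ge0_integral_bigcup//.
- by apply: is_cvg_ereal_nneg_natsum_cond => k _ _; exact: dens_ge0.
- by apply: (measurable_funS measurableT) => //; exact/measurable_EFinP.
- by move=> x _; rewrite lee_fin.
Qed.

HB.instance Definition _ := isMeasure.Build _ _ _ D dens0 dens_ge0 dens_sigma_additive.

End density_measure.

Section change_of_variables.
Context {R : realType}.
Local Notation mu := (@lebesgue_measure R).
Variables (T T1 V : R -> R).
Hypothesis dT : forall x : R, is_derive x 1 T (T1 x).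
Hypothesis cT1 : continuous T1.
Hypothesis T1_neq0 : forall x, T1 x != 0.
Hypotheses (TK : cancel T V) (VK : cancel V T).

(** A continuous function without zeros has constant sign, so a lift with
    nonvanishing derivative is monotone and the two cases, increasing and
    decreasing, are exhaustive below. *)
Lemma cst_sign : (forall x, 0 < T1 x) \/ (forall x, T1 x < 0).
Proof.
have P x y : 0 < T1 x -> T1 y < 0 -> False.
  move=> x0 y0.
  have cw a b : {within `[a, b], continuous T1} by exact: continuous_subspaceT.
  have [xy|yx] := leP x y.
    have [|c _ c0] := IVT xy (cw x y) (v := 0).
      by rewrite ge_min le_max (ltW x0) (ltW y0) orbT.
    by have := T1_neq0 c; rewrite c0 eqxx.
  have [|c _ c0] := IVT (ltW yx) (cw y x) (v := 0).
    by rewrite ge_min le_max (ltW x0) (ltW y0) orbT.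
  by have := T1_neq0 c; rewrite c0 eqxx.
case: (ltgtP 0 (T1 0)) => [h|h|h].
- left => x; case: (ltgtP 0 (T1 x)) => // [/(P _ _ h)//|e].
  by have := T1_neq0 x; rewrite -e eqxx.
- right => x; case: (ltgtP 0 (T1 x)) => // [/P/(_ h)//|e].
  by have := T1_neq0 x; rewrite -e eqxx.
- by have := T1_neq0 0; rewrite -h eqxx.
Qed.

Lemma is_derive_inv (y : R) : is_derive y 1 V (T1 (V y))^-1.
Proof.
rewrite -{1}(VK y).
apply: is_derive_inverse; last exact: T1_neq0.
- by have : \forall x \near V y, V (T x) = x by near=> x; rewrite TK.
- by near=> x; exact: is_derive_continuous dT x.
Unshelve. all: by end_near. Qed.

Lemma continuous_inv : continuous V.
Proof. exact: is_derive_continuous is_derive_inv. Qed.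

Lemma homo_pos : (forall x, 0 < T1 x) -> {homo T : x y / x < y}.
Proof.
move=> T10 x y xy.
have [c _ E] := MVT xy (fun z _ => dT z) (continuous_subspaceT (is_derive_continuous dT)).
by rewrite -subr_gt0 E mulr_gt0// subr_gt0.
Qed.

Lemma homo_neg : (forall x, T1 x < 0) -> {homo T : x y /~ x < y}.
Proof.
move=> T10 x y xy.
have [c _ E] := MVT xy (fun z _ => dT z) (continuous_subspaceT (is_derive_continuous dT)).
by rewrite -subr_lt0 E pmulr_llt0// subr_gt0.
Qed.

Variable f : R -> R.
Hypotheses (f0 : forall x, 0 <= f x) (cf : continuous f).

Lemma continuous_transfer : continuous (fun y => f (V y) / `|T1 (V y)|).
Proof.
move=> y; have cV := @continuous_inv y.
apply: cvgM; first by apply: (@continuous_comp _ _ _ V f) => //; exact: cf.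
apply: cvgV; first by rewrite normr_eq0.
by apply: cvg_norm; apply: (@continuous_comp _ _ _ V T1) => //; exact: cT1.
Qed.

Lemma transfer_ge0 y : 0 <= f (V y) / `|T1 (V y)|.
Proof. by rewrite divr_ge0. Qed.

Lemma change_of_variables_itv a b : a < b ->
  (\int[mu]_(x in T @^-1` `]a, b]) (f x)%:E =
   \int[mu]_(y in `]a, b]) (f (V y) / `|T1 (V y)|)%:E)%E.
Proof.
move=> ab.
have cV := continuous_inv.
have dV : V^`()%classic = fun y => (T1 (V y))^-1.
  by apply/funext => y; rewrite derive1E; have dVy := is_derive_inv y; rewrite derive_val.
have cV' : continuous V^`()%classic.
  rewrite dV => y; apply: cvgV; first exact: T1_neq0.
  exact: cont_comp cV cT1 y.
have LR : derivable_oo_LRcontinuous V a b.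
  split.
  - by move=> x _; have [] := is_derive_inv x.
  - by apply: cvg_at_right_filter; exact: cV.
  - by apply: cvg_at_left_filter; exact: cV.
have cr x : cvg (V^`()%classic y @[y --> x^'+]).
  by apply/cvg_ex; exists (V^`()%classic x); apply: cvg_at_right_filter; exact: cV'.
have cl x : cvg (V^`()%classic y @[y --> x^'-]).
  by apply/cvg_ex; exists (V^`()%classic x); apply: cvg_at_left_filter; exact: cV'.
have mf (D : set R) : measurable D -> measurable_fun D (fun x => (f x)%:E).
  by move=> mD; apply/measurable_EFinP; apply: measurable_funTS; exact: continuous_measurable_fun.
have mg (D : set R) : measurable D -> measurable_fun D (fun y => (f (V y) / `|T1 (V y)|)%:E).
  move=> mD; apply/measurable_EFinP; apply: measurable_funTS.
  exact: continuous_measurable_fun continuous_transfer.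
rewrite [RHS]integral_itv_obnd_cbnd; last exact: mg.
have [T1p|T1n] := cst_sign.
- have hT := homo_pos T1p.
  have mT := leW_mono (le_mono hT).
  have mT' := le_mono hT.
  rewrite (_ : T @^-1` `]a, b] = `]V a, V b]%classic); last first.
    have E1 x : (a < T x) = (V a < x) by rewrite -[a in LHS]VK mT.
    have E2 x : (T x <= b) = (x <= V b) by rewrite -[b in LHS]VK mT'.
    by apply/seteqP; split => x /=; rewrite !in_itv/= E1 E2.
  rewrite integral_itv_obnd_cbnd; last exact: mf.
  rewrite (@integration_by_substitution_increasing R V f a b (ltW ab))//.
  + apply: eq_integral => x _; rewrite dV /= gtr0_norm//.
  + by move=> x y _ _ xy; rewrite -mT !VK.
  + exact: continuous_subspaceT.
- have hT := homo_neg T1n.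
  have mT := leW_nmono (le_nmono hT).
  have mT' := le_nmono hT.
  rewrite (_ : T @^-1` `]a, b] = `[V b, V a[%classic); last first.
    have E1 x : (a < T x) = (x < V a) by rewrite -[a in LHS]VK mT.
    have E2 x : (T x <= b) = (V b <= x) by rewrite -[b in LHS]VK mT'.
    by apply/seteqP; split => x /=; rewrite !in_itv/= E1 E2 andbC.
  rewrite integral_itv_bndo_bndc; last exact: mf.
  rewrite (@integration_by_substitution_decreasing R V f a b (ltW ab))//.
  + apply: eq_integral => x _; rewrite dV /= ltr0_norm//.
    by rewrite invrN.
  + by move=> x y _ _ xy; rewrite -mT !VK.
  + exact: continuous_subspaceT.
Qed.

(** Both sides are measures in B that agree on the half-open intervals, by the
    substitution rule on intervals; these generate the Borel sets, and they
    exhaust the line by sets of finite mass. *)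
Lemma change_of_variables (B : set R) : measurable B ->
  (\int[mu]_(x in T @^-1` B) (f x)%:E =
   \int[mu]_(y in B) (f (V y) / `|T1 (V y)|)%:E)%E.
Proof.
have mT : measurable_fun [set: R] (T : R -> measurableTypeR R).
  exact: continuous_measurable_fun (is_derive_continuous dT).
have mf := continuous_measurable_fun cf.
have mg := continuous_measurable_fun continuous_transfer.
move: B.
pose m1 : {measure set (measurableTypeR R) -> \bar R} :=
  pushforward (dens f0 mf) (T : measurableTypeR R -> measurableTypeR R).
pose m2 : {measure set (measurableTypeR R) -> \bar R} :=
  dens transfer_ge0 mg.
suff : forall B, measurable B -> m2 B = m1 mT B by move=> H B mB; apply/esym/H.
apply: (@measure_unique _ R (measurableTypeR R) (@ocitv R) (fun n => `](- n%:R), n%:R]%classic)).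
- by [].
- exact: ocitvI.
- by move=> n; exists (- n%:R, n%:R).
- exact: bigcup_itvT.
- move=> _ [[a b] _ <-] /=.
  have [ab|ba] := ltP a b; first by rewrite /m1 /m2 /dens /pushforward/= change_of_variables_itv.
  by rewrite set_itv_ge ?bnd_simp -?leNgt// !measure0.
- move=> k; rewrite /m2 /dens/=.
  have := @continuous_integrable R _ false false (- k%:R) k%:R continuous_transfer.
  by move/integrable_lty; apply.
Qed.

End change_of_variables.

Section circle_sets.
Context {R : realType}.
Local Notation mu := (@lebesgue_measure R).
Implicit Types (A B P : set R) (f : R -> R).

Let mE f (D : set R) : measurable D -> continuous f -> measurable_fun D (fun x => (f x)%:E).
Proof.
move=> mD cf; apply/measurable_EFinP; apply: measurable_funTS.
exact: continuous_measurable_fun.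
Qed.

Lemma circle_set_int A (m : int) x : circle_set A -> A (x + m%:~R) <-> A x.
Proof.
move=> [_ pA].
have H n y : A (y + n%:R) <-> A y.
  elim: n y => [|n IH] y; first by rewrite addr0.
  by rewrite -natr1 addrA pA.
case: m => n; first by rewrite -pmulrn.
by rewrite NegzE mulrNz -pmulrn -(H n.+1) subrK.
Qed.

Lemma integral_split f P a b c : continuous f -> (forall x, 0 <= f x) -> measurable P ->
  a <= b -> b <= c ->
  (\int[mu]_(x in P `&` `[a, c[) (f x)%:E =
   \int[mu]_(x in P `&` `[a, b[) (f x)%:E + \int[mu]_(x in P `&` `[b, c[) (f x)%:E)%E.
Proof.
move=> cf f0 mP ab bc.
rewrite -ge0_integral_setU.
- congr integral; rewrite -setIUr -itv_bndbnd_setU ?bnd_simp//.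
- exact: measurableI.
- exact: measurableI.
- by apply: mE => //; apply: measurableU; exact: measurableI.
- by move=> x _; rewrite lee_fin.
- apply/disj_setPS => x [[_ /=]]; rewrite !in_itv/= => /andP[_ xb] [_ /andP[]].
  by rewrite leNgt xb.
Qed.

Lemma integral_shift f (c : R) B : continuous f -> (forall x, 0 <= f x) -> measurable B ->
  (\int[mu]_(x in (fun x : R => (x - c)%R) @^-1` B) (f x)%:E =
   \int[mu]_(x in B) (f (x + c))%:E)%E.
Proof.
move=> cf f0 mB.
have d1 x : is_derive (x : R) 1 (fun x : R => x - c) 1 by apply: is_derive_eq; rewrite subr0.
have c1 : continuous (fun _ : R => 1 : R) by move=> x; exact: cvg_cst.
have n1 (x : R) : (1 : R) != 0 by rewrite oner_eq0.
rewrite (@change_of_variables R (fun x => x - c) (fun=> 1) (fun x => x + c) d1 c1 n1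
  (subrK c) (addrK c) f f0 cf B mB).
by apply: eq_integral => x _; rewrite normr1 divr1.
Qed.

Lemma integral_shift_int f P a b (m : int) : continuous f -> (forall x, 0 <= f x) ->
  circle_set P ->
  (\int[mu]_(x in P `&` `[(a + m%:~R)%R, (b + m%:~R)%R[) (f x)%:E =
   \int[mu]_(x in P `&` `[a, b[) (f (x + m%:~R))%:E)%E.
Proof.
move=> cf f0 cP; rewrite -integral_shift//; last by apply: measurableI => //; case: cP.
congr integral; apply/seteqP; split => x /=; rewrite !in_itv/= lerBrDr ltrBlDr -mulrNz;
 by move=> -[Px ->]; split => //; apply/(circle_set_int (- m) x cP).
Qed.

(** After a translation by an integer, a lies in [0, 1[; the window is then
    cut at 1 and its right part moved back by one period. *)
Lemma integral_period f P a : continuous f -> periodic f 1 -> (forall x, 0 <= f x) ->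
  circle_set P ->
  (\int[mu]_(x in P `&` `[a, (a + 1)%R[) (f x)%:E =
   \int[mu]_(x in P `&` `[0%R, 1%R[) (f x)%:E)%E.
Proof.
move=> cf pf f0 cP; have [m] := frac01 a; set t := a + m%:~R => /andP[t0 t1].
have mP : measurable P by case: cP.
have sh u v (k : int) : (\int[mu]_(x in P `&` `[(u + k%:~R)%R, (v + k%:~R)%R[) (f x)%:E =
   \int[mu]_(x in P `&` `[u, v[) (f x)%:E)%E.
  by rewrite integral_shift_int//; apply: eq_integral => x _; rewrite periodic1_int.
rewrite -(sh _ _ m) addrAC -/t (@integral_split f P t 1) ?(ltW t1) ?lerDr//.
have := sh 0 t 1; rewrite add0r => ->.
by rewrite addeC -integral_split// ltW.
Qed.

Lemma integral_oc_co f P a b : continuous f -> (forall x, 0 <= f x) -> measurable P ->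
  (\int[mu]_(x in P `&` `]a, b]) (f x)%:E = \int[mu]_(x in P `&` `[a, b[) (f x)%:E)%E.
Proof.
move=> cf f0 mP; rewrite !integral_mkcondl.
have mg (D : set R) : measurable D -> measurable_fun D (((EFin \o f) \_ P)%E).
  move=> mD; apply: measurable_funTS; apply/(measurable_restrictT _ _).1 => //.
  exact: mE.
by rewrite integral_itv_bndo_bndc ?integral_itv_obnd_cbnd//; exact: mg.
Qed.

(** Folding n periods onto one is what produces the sum over the n inverse
    branches of the transfer operator. *)
Lemma integral_periods f P (n : nat) : continuous f -> (forall x, 0 <= f x) -> circle_set P ->
  (\int[mu]_(x in P `&` `[0%R, n%:R[) (f x)%:E =
   \int[mu]_(x in P `&` `[0%R, 1%R[) (\sum_(k < n) f (x + k%:R))%R%:E)%E.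
Proof.
move=> cf f0 cP; have mP : measurable P by case: cP.
under [RHS]eq_integral do rewrite -sumEFin.
rewrite ge0_integral_sum//=; last 3 first.
- exact: measurableI.
- move=> k; apply: (mE (f := fun x => f (x + k%:R))); first exact: measurableI.
  by apply: (cont_comp (f := fun x => x + k%:R)) => // x; apply: cvgD; [exact: cvg_id|exact: cvg_cst].
- by move=> k x _; rewrite lee_fin.
elim: n => [|n IH]; first by rewrite big_ord0 set_itv_ge ?setI0 ?integral_set0// bnd_simp ltxx.
rewrite big_ord_recr /= -IH (@integral_split f P 0 n%:R)//; last by rewrite ler_nat.
congr (_ + _)%E.
have := @integral_shift_int f P 0 1 n cf f0 cP.
by rewrite add0r -natr1 addrC -pmulrn => <-.
Qed.

End circle_sets.

Section transfer.
Context {R : realType}.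
Local Notation mu := (@lebesgue_measure R).

Implicit Types (f : R -> R) (A : set R).

Lemma cont_sum m (F : 'I_m -> R -> R) : (forall k, continuous (F k)) ->
  continuous (fun x => \sum_(k < m) F k x).
Proof.
elim: m F => [|m IH] F cF.
  rewrite (_ : (fun x => _) = cst 0); first by move=> x; exact: cvg_cst.
  by apply/funext => x; rewrite big_ord0.
rewrite (_ : (fun x => _) = fun x => \sum_(k < m) F (widen_ord (leqnSn m) k) x + F ord_max x).
  by move=> x; apply: cvgD; [apply: IH|exact: cF].
by apply/funext => x; rewrite big_ord_recr.
Qed.

(** T is a diffeomorphism of the line with derivative T1 and inverse V that
    lifts a circle map of degree s n.  The orientation s lets increasing and
    decreasing lifts share the equation T (x + s) = T x + n, with n > 0. *)
Record circle_lift (n : nat) (s : R) (T T1 V : R -> R) : Prop := CircleLift {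
  cl_derive : forall x : R, is_derive x 1 T (T1 x);
  cl_continuous : continuous T1;
  cl_neq0 : forall x, T1 x != 0;
  cl_TK : cancel T V;
  cl_VK : cancel V T;
  cl_period : forall x, T (x + s) = T x + n%:R;
  cl_s : s = 1 \/ s = - 1;
  cl_periodic : periodic T1 1;
  cl_n : (0 < n)%N }.

(** The points V (x + k), k < n, represent the n preimages of x modulo 1, so
    this is the transfer operator of the circle map lifted by T. *)
Definition transfer n (T1 V f : R -> R) x : R :=
  \sum_(k < n) f (V (x + k%:R)) / `|T1 (V (x + k%:R))|.

(** The derivative has the sign of s, because T s - T 0 = n > 0. *)
Lemma lift_sign n s (T T1 V : R -> R) : circle_lift n s T T1 V ->
  forall x, `|T1 x|^-1 = s / T1 x.
Proof.
move=> HT x; have n0 : (0 : R) < n%:R by rewrite ltr0n (cl_n HT).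
have E := cl_period HT 0; rewrite add0r in E.
have [Tp|Tn] := cst_sign (cl_continuous HT) (cl_neq0 HT).
  have hT := homo_pos (cl_derive HT) Tp.
  case: (cl_s HT) => sE; first by rewrite sE gtr0_norm// mul1r.
  have : T s < T 0 by apply: hT; rewrite sE ltrN10.
  by rewrite E => ?; exfalso; lra.
have hT := homo_neg (cl_derive HT) Tn.
case: (cl_s HT) => sE; last by rewrite sE ltr0_norm// invrN mulN1r.
have : T s < T 0 by apply: hT; rewrite sE ltr01.
by rewrite E => ?; exfalso; lra.
Qed.

Variables (n : nat) (s : R) (T T1 V : R -> R).
Hypothesis HT : circle_lift n s T T1 V.
Local Notation L := (transfer n T1 V).

Lemma lift_inv_period y : V (y + n%:R) = V y + s.
Proof. by rewrite -{1}(cl_VK HT y) -(cl_period HT) (cl_TK HT). Qed.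

Lemma periodic_s f x : periodic f 1 -> f (x + s) = f x.
Proof.
move=> pf; case: (cl_s HT) => ->; first exact: pf.
by rewrite -(pf (x - 1)) subrK.
Qed.

(** Translation by 1 permutes the branches: branch k becomes branch k + 1, and
    branch n is branch 0 moved by s. *)
Lemma transfer_periodic f : periodic f 1 -> periodic (L f) 1.
Proof.
move=> pf x; rewrite /transfer.
pose F y := f (V y) / `|T1 (V y)|.
have Fn y : F (y + n%:R) = F y.
  by rewrite /F lift_inv_period !periodic_s//; exact: cl_periodic HT.
rewrite (eq_bigr (fun k : 'I_n => F (x + (k.+1)%:R))); last first.
  by move=> k _; rewrite /F -addrA nat1r.
rewrite [RHS](eq_bigr (fun k : 'I_n => F (x + k%:R)))//.
have := Fn x; case: (n) (cl_n HT) => // m _ Fm.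
by rewrite big_ord_recr big_ord_recl /= Fm addr0 addrC.
Qed.

Lemma transfer_continuous f : continuous f -> continuous (L f).
Proof.
move=> cf x; rewrite /transfer.
have cF := continuous_transfer (cl_derive HT) (cl_continuous HT) (cl_neq0 HT) (cl_TK HT) (cl_VK HT) cf.
move: x; apply: (cont_sum (F := fun k x => f (V (x + k%:R)) / `|T1 (V (x + k%:R))|)) => k.
apply: (cont_comp (f := fun x => x + k%:R) _ cF) => z.
by apply: cvgD; [exact: cvg_id|exact: cvg_cst].
Qed.

Lemma circle_set_preimage A : circle_set A -> circle_set (T @^-1` A).
Proof.
move=> cA; split.
  rewrite -[X in measurable X]setTI.
  apply: (continuous_measurable_fun (is_derive_continuous (cl_derive HT))) => //.
  by case: cA.
have H x : A (T (x + s)) <-> A (T x).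
  by rewrite (cl_period HT); have := circle_set_int n (T x) cA; rewrite -pmulrn.
by move=> x /=; case: (cl_s HT) H => -> H; [exact: H|rewrite -(H (x + 1)) addrK].
Qed.

(** The substitution y = T x maps one period onto an interval of length n,
    which integral_periods folds onto [0, 1[.  When T decreases, the half-open
    intervals change side, which does not affect the integrals. *)
Lemma transfer_duality_ge0 f A : continuous f -> periodic f 1 -> (forall x, 0 <= f x) ->
  circle_set A ->
  (\int[mu]_(x in `[0%R, 1%R[ `&` T @^-1` A) (f x)%:E =
   \int[mu]_(x in `[0%R, 1%R[ `&` A) (L f x)%:E)%E.
Proof.
move=> cf pf f0 cA; rewrite setIC [in RHS]setIC.
have [dT cT1 T1n TK VK _ _ _ _] := HT.
have cTA := circle_set_preimage cA.
have mA : measurable A by case: cA.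
have cw := continuous_transfer dT cT1 T1n TK VK cf.
have w0 := transfer_ge0 T1 V f0.
rewrite -(@integral_periods R (fun y => f (V y) / `|T1 (V y)|) A n)//.
have VE := lift_inv_period 0; rewrite add0r in VE.
have n0 : (0 : R) < n%:R by rewrite ltr0n (cl_n HT).
have [T1p|T1m] := cst_sign cT1 T1n.
- have hT := homo_pos dT T1p.
  have mT := leW_mono (le_mono hT); have mT' := le_mono hT.
  have s1 : s = 1.
    case: (cl_s HT) => // sE.
    have : T s < T 0 by apply: hT; rewrite sE ltrN10.
    by have := cl_period HT 0; rewrite add0r => -> ?; exfalso; lra.
  rewrite s1 in VE; rewrite -(@integral_period _ f _ (V 0))// -VE.
  have mB : measurable (A `&` `[0%R, n%:R[) by exact: measurableI.
  rewrite -(change_of_variables dT cT1 T1n TK VK f0 cf mB).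
  have E1 x : (0 <= T x) = (V 0 <= x) by rewrite -[0 in LHS]VK mT'.
  have E2 x : (T x < n%:R) = (x < V n%:R) by rewrite -[n%:R in LHS]VK mT.
  congr integral; apply/seteqP; split => x /=; rewrite !in_itv/= E1 E2//.
- have hT := homo_neg dT T1m.
  have mT := leW_nmono (le_nmono hT); have mT' := le_nmono hT.
  have s1 : s = -1.
    case: (cl_s HT) => // sE.
    have : T s < T 0 by apply: hT; rewrite sE ltr01.
    by have := cl_period HT 0; rewrite add0r => -> ?; exfalso; lra.
  have VE' : V n%:R + 1 = V 0 by rewrite VE s1 subrK.
  rewrite -(@integral_period _ f _ (V n%:R))// VE'.
  rewrite -[RHS](@integral_oc_co _ (fun y => f (V y) / `|T1 (V y)|))//.
  have mB : measurable (A `&` `]0%R, n%:R]) by exact: measurableI.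
  rewrite -(change_of_variables dT cT1 T1n TK VK f0 cf mB).
  have E1 x : (0 < T x) = (x < V 0) by rewrite -[0 in LHS]VK mT.
  have E2 x : (T x <= n%:R) = (V n%:R <= x) by rewrite -[n%:R in LHS]VK mT'.
  congr integral; apply/seteqP; split => x /=; rewrite !in_itv/= E1 E2 andbC//.
Qed.

End transfer.

(** * Contraction of cones and exponential decay *)

Section circle_integral.
Context {R : realType}.
Local Notation mu := (@lebesgue_measure R).
Implicit Types (f g : R -> R) (A : set R).

Lemma circle_integrable f A : continuous f -> measurable A ->
  mu.-integrable (`[0, 1[ `&` A) (EFin \o f).
Proof.
move=> cf mA; apply: (@integrableS _ _ _ mu `[0, 1[) => //.
- exact: measurableI.
- exact: continuous_integrable.
Qed.

Lemma circle_intD f g : continuous f -> continuous g ->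
  circle_int (fun x => f x + g x) = circle_int f + circle_int g.
Proof. by move=> cf cg; rewrite /circle_int RintegralD//; exact: continuous_integrable. Qed.

Lemma circle_intB f g : continuous f -> continuous g ->
  circle_int (fun x => f x - g x) = circle_int f - circle_int g.
Proof. by move=> cf cg; rewrite /circle_int RintegralB//; exact: continuous_integrable. Qed.

Lemma circle_intZ (a : R) f : continuous f ->
  circle_int (fun x => a * f x) = a * circle_int f.
Proof. by move=> cf; rewrite /circle_int RintegralZl//; exact: continuous_integrable. Qed.

Lemma circle_int_cst (a : R) : circle_int (fun=> a) = a.
Proof.
rewrite /circle_int Rintegral_cst//= lebesgue_measure_itv/= lte_fin ltr01.
by rewrite -EFinD subr0 mulr1.
Qed.

Lemma le_circle_int f g : continuous f -> continuous g ->
  (forall x, 0 <= x < 1 -> f x <= g x) -> circle_int f <= circle_int g.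
Proof.
move=> cf cg fg; rewrite /circle_int le_Rintegral//; exact: continuous_integrable.
Qed.

Lemma circle_int_norm f K : continuous f -> (forall x, `|f x| <= K) -> `|circle_int f| <= K.
Proof.
move=> cf fK; have ccst : continuous (fun _ : R => K : R) by move=> x; exact: cvg_cst.
have ccstN : continuous (fun _ : R => - K : R) by move=> x; exact: cvg_cst.
rewrite ler_norml -{2}(circle_int_cst K) -(circle_int_cst (-K)).
by rewrite !le_circle_int// => x _; have := fK x; rewrite ler_norml => /andP[].
Qed.

Variables (n : nat) (s : R) (T T1 V : R -> R).
Hypothesis HT : circle_lift n s T T1 V.
Local Notation L := (transfer n T1 V).

Lemma transferD f g x : L (fun x => f x + g x) x = L f x + L g x.
Proof. by rewrite /transfer -big_split; apply: eq_bigr => k _; rewrite /= mulrDl. Qed.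

Lemma transferZ (a : R) f x : L (fun x => a * f x) x = a * L f x.
Proof. by rewrite /transfer mulr_sumr; apply: eq_bigr => k _; rewrite mulrA. Qed.

Lemma transferB f g x : L (fun x => f x - g x) x = L f x - L g x.
Proof. by rewrite /transfer -sumrB; apply: eq_bigr => k _; rewrite /= mulrBl. Qed.

Lemma le_transfer f g x : (forall x, f x <= g x) -> L f x <= L g x.
Proof.
by move=> fg; apply: ler_sum => k _; rewrite ler_wpM2r// invr_ge0.
Qed.

(** Adding a constant to f reduces the identity to nonnegative functions. *)
Lemma transfer_duality f A : continuous f -> periodic f 1 -> circle_set A ->
  \int[mu]_(x in `[0, 1[ `&` T @^-1` A) f x =
  \int[mu]_(x in `[0, 1[ `&` A) L f x.
Proof.
move=> cf pf cA; have [M M0 fM] := continuous_periodic_bounded cf pf.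
have mA : measurable A by case: cA.
have mTA : measurable (T @^-1` A) by case: (circle_set_preimage HT cA).
have cM : continuous (fun _ : R => M : R) by move=> x; exact: cvg_cst.
have pM : periodic (fun _ : R => M : R) 1 by [].
pose g x := f x + M.
have cg : continuous g by move=> x; apply: cvgD; [exact: cf|exact: cvg_cst].
have pg : periodic g 1 by move=> x; rewrite /g pf.
have g0 x : 0 <= g x by rewrite /g; have := fM x; rewrite ler_norml => /andP[+ _]; lra.
have E1 := congr1 fine (transfer_duality_ge0 HT cg pg g0 cA).
have E2 := congr1 fine (transfer_duality_ge0 HT cM pM (fun _ => M0) cA).
have cL := transfer_continuous HT.
rewrite -!/(Rintegral _ _ _) in E1 E2.
have -> : \int[mu]_(x in `[0, 1[ `&` T @^-1` A) f x =
   \int[mu]_(x in `[0, 1[ `&` T @^-1` A) g x - \int[mu]_(x in `[0, 1[ `&` T @^-1` A) M.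
  rewrite -RintegralB//; [|exact: measurableI|exact: circle_integrable..].
  by apply: eq_Rintegral => x _; rewrite /g addrK.
rewrite E1 E2 -RintegralB//; [|exact: measurableI|apply: circle_integrable; [exact: cL|]..]; last 2 first.
- by [].
- by [].
by apply: eq_Rintegral => x _; rewrite -transferB; congr (L _ x); apply/funext => z; rewrite /g addrK.
Qed.

Lemma circle_int_transfer f : continuous f -> periodic f 1 ->
  circle_int (L f) = circle_int f.
Proof.
move=> cf pf; have sT : circle_set [set: R] by split.
by have := transfer_duality cf pf sT; rewrite preimage_setT !setIT.
Qed.

End circle_integral.

Section exponential_facts.
Context {R : realType}.

(** Limits are mostly taken in this form: an inequality proved up to an error
    C q ^ N for all N holds without the error. *)
Lemma geometric_le0 (x C q : R) : 0 <= q < 1 -> (forall N, x <= C * q ^+ N) -> x <= 0.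
Proof.
move=> /andP[q0 q1] H.
have -> : 0 = lim (C * q ^+ N @[N --> \oo]).
  apply/esym/cvg_lim => //; rewrite -(mulr0 C); apply: cvgMr.
  by apply: cvg_expr; rewrite ger0_norm.
apply: limr_ge; last by near=> N; exact: H.
by apply: is_cvgMr; apply/cvg_ex; exists 0; apply: cvg_expr; rewrite ger0_norm.
Unshelve. all: by end_near. Qed.

Lemma geometric_small (C q e : R) : 0 <= q < 1 -> 0 < e -> exists N, C * q ^+ N < e.
Proof.
move=> q01 e0; apply: contrapT => /forallNP nC.
have : e <= 0 by apply: (geometric_le0 (C := C) q01) => N; have /negP := nC N; rewrite -leNgt.
by rewrite leNgt e0.
Qed.

Lemma geometric_cvg (u : nat -> R) (C q : R) : 0 <= q < 1 ->
  (forall N k, `|u (N + k)%N - u N| <= C * q ^+ N) ->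
  exists2 l, u N @[N --> \oo] --> l & forall N, `|u N - l| <= C * q ^+ N.
Proof.
move=> /andP[q0 q1] H.
have C0 : C * q ^+ N @[N --> \oo] --> (0 : R).
  by rewrite -(mulr0 C); apply: cvgMr; apply: cvg_expr; rewrite ger0_norm.
have cu : cvg (u N @[N --> \oo]).
  apply/cauchy_cvgP/cauchy_exP => e e0.
  have : \forall N \near \oo, `|0 - C * q ^+ N| < e by apply: cvgr_dist_lt.
  move=> [N _ HN]; exists (u N); exists N => // k /= Nk.
  have := HN N (leqnn N); rewrite sub0r normrN; apply: le_lt_trans.
  apply: le_trans (ler_norm _).
  by rewrite distrC -(subnKC Nk); exact: H.
exists (lim (u N @[N --> \oo])) => // N; rewrite distrC.
have cl2 : `|u (k + N)%N - u N| @[k --> \oo] --> `|lim (u N @[N --> \oo]) - u N|.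
  by apply: cvg_norm; apply: cvgB; [rewrite (cvg_shiftn N u)|exact: cvg_cst].
rewrite -(cvg_lim _ cl2)//; apply: limr_le; first by apply/cvg_ex; eexists; exact: cl2.
by near=> k; rewrite addnC; exact: H.
Unshelve. all: by end_near. Qed.

(** Convexity between 0 and u, read off the tangent line at b u. *)
Lemma expR_convex (b u : R) : 0 <= b <= 1 -> expR (b * u) <= b * expR u + (1 - b).
Proof.
move=> /andP[b0 b1]; set c := expR (b * u).
have c0 : 0 <= c by exact: expR_ge0.
have E1 : c * (1 + (1 - b) * u) <= expR u.
  rewrite [leRHS](_ : _ = c * expR ((1 - b) * u)); first by rewrite ler_wpM2l// expR_ge1Dx.
  by rewrite /c -expRD; congr expR; ring.
have E2 : c * (1 + - b * u) <= 1.
  rewrite [leRHS](_ : _ = c * expR (- b * u)); first by rewrite ler_wpM2l// expR_ge1Dx.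
  by rewrite /c -expRD -mulrDl subrr mul0r expR0.
have := ler_wpM2l b0 E1; have := @ler_wpM2l _ (1 - b) _ _ _ E2.
rewrite subr_ge0 => /(_ b1); set p := (X in X <= _); set q := (X in _ -> X <= _ -> _) => H1 H2.
have -> : c = q + p by rewrite /p /q; ring.
by lra.
Qed.

Lemma expR_sub1 (u : R) : expR u - 1 <= u * expR u.
Proof.
have := expR_ge1Dx (- u); rewrite -(ler_pM2r (expR_gt0 u)) -expRD addNr expR0.
by rewrite mulrDl mul1r mulNr; lra.
Qed.

End exponential_facts.

Section cone.
Context {R : realType}.
Implicit Types (f g w : R -> R) (a : R).

(** Any two points of the circle have representatives at distance at most 1. *)
Lemma periodic_osc (P : R -> R -> Prop) : (forall x (m : int) y, P (x + m%:~R) y -> P x y) ->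
  (forall x y, `|x - y| <= 1 -> P x y) -> forall x y, P x y.
Proof.
move=> Pm P1 x y; have [m /andP[m0 m1]] := frac01 (x - y).
by apply: (Pm _ m); apply: P1; rewrite addrAC ger0_norm// ltW.
Qed.

(** Periodic densities whose logarithm is Lipschitz with constant a.  In this
    multiplicative form the condition passes to the summands of the transfer
    operator, where weights multiply, and then to their sum. *)
Definition cone a f := [/\ periodic f 1, forall x, 0 < f x &
  forall x y, f x <= expR (a * `|x - y|) * f y].

Lemma cone_osc a f : 0 <= a -> cone a f -> forall x y, f x <= expR a * f y.
Proof.
move=> a0 [pf f0 fa]; apply: periodic_osc => [x m y|x y xy]; first by rewrite periodic1_int.
apply: le_trans (fa x y) _; rewrite ler_pM2r// ler_expR.
by rewrite ler_piMr.
Qed.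

Lemma lip_osc M f : periodic f 1 -> lip M f -> forall x y, `|f x - f y| <= M.
Proof.
move=> pf fM; apply: periodic_osc => [x m y|x y xy]; first by rewrite periodic1_int.
by apply: le_trans (fM x y) _; rewrite ler_piMr// (lip_ge0 fM).
Qed.

Lemma cone_weaken a b f : a <= b -> cone a f -> cone b f.
Proof.
move=> ab [pf f0 fa]; split => // x y; apply: le_trans (fa x y) _.
by rewrite ler_pM2r// ler_expR ler_wpM2r.
Qed.

(** For |x - y| <= 1 the increment of f is controlled by exp t - 1 <= t exp t;
    otherwise by the bound B itself. *)
Lemma cone_lip a f B : 0 <= a -> cone a f -> (forall x, f x <= B) ->
  lip ((a * expR a + 1) * B) f.
Proof.
move=> a0 [pf f0 fa] fB.
have B0 : 0 <= B by apply: le_trans (fB 0); exact: ltW.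
have H x y : f x - f y <= (a * expR a + 1) * B * `|x - y|.
  set t := `|x - y|; have t0 : 0 <= t by rewrite /t.
  have [t1|t1] := leP t 1.
    have H1 : f x - f y <= a * t * expR (a * t) * f y.
      have := fa x y; rewrite -/t; have := expR_sub1 (a * t).
      rewrite -(ler_pM2r (f0 y)) mulrBl mul1r; lra.
    apply: le_trans H1 _.
    have H2 : expR (a * t) <= expR a by rewrite ler_expR ler_piMr.
    have : a * t * expR (a * t) * f y <= a * t * expR a * B.
      apply: ler_pM => //; [|exact: ltW|].
        by rewrite mulr_ge0 ?expR_ge0// mulr_ge0.
      by rewrite ler_wpM2l// mulr_ge0.
    have : 0 <= B * t by rewrite mulr_ge0.
    lra.
  have : f x - f y <= B by have := fB x; have := f0 y; lra.
  have : B * 1 <= B * t by rewrite ler_wpM2l// ltW.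
  have : 0 <= a * expR a * B * t by rewrite !mulr_ge0// expR_ge0.
  lra.
move=> x y; rewrite ler_norml H andbT lerNl opprB.
by rewrite distrC H.
Qed.

Lemma cone_continuous a f : 0 <= a -> cone a f -> continuous f.
Proof.
move=> a0 fa; apply: (lip_continuous (cone_lip (B := expR a * f 0) a0 fa _)).
by move=> x; exact: cone_osc.
Qed.

Lemma cone_bounds a f : 0 <= a -> cone a f -> circle_int f = 1 ->
  forall y, expR (- a) <= f y <= expR a.
Proof.
move=> a0 fa f1 y; have cf := cone_continuous a0 fa.
have cc (b : R) : continuous (fun _ : R => b : R) by move=> x; exact: cvg_cst.
apply/andP; split.
  rewrite expRN -(ler_pM2l (expR_gt0 a)) mulfV ?gt_eqF ?expR_gt0//.
  rewrite -f1 -(circle_int_cst (expR a * f y)); apply: le_circle_int => // x _.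
  exact: cone_osc.
have : circle_int (fun _ : R => f y) <= circle_int (fun x => expR a * f x).
  apply: le_circle_int => // [x|x _]; last exact: cone_osc.
  by apply: cvgM; [exact: cvg_cst|exact: cf].
by rewrite circle_int_cst circle_intZ// f1 mulr1.
Qed.

(** A density of slope b a is at least exp (- a).  Removing the fraction 1 - b
    of that minimum spoils the logarithmic slope, but by convexity of exp no
    more than from b a to a. *)
Lemma cone_sub a b f : 0 < a -> 0 <= b <= 1 -> cone (b * a) f -> circle_int f = 1 -> 0 < b ->
  cone a (fun x => f x - (1 - b) * expR (- a)).
Proof.
move=> a0 b01 fc f1 b0; have /andP[_ b1] := b01.
have ba : b * a <= a by rewrite ger_pMl.
have fca := cone_weaken ba fc; have [pf f0 fa] := fc.
have fm y : expR (- a) <= f y by have /andP[] := cone_bounds (ltW a0) fca f1 y.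
split.
- by move=> x; rewrite pf.
- move=> x; rewrite subr_gt0; apply: lt_le_trans (fm x).
  by rewrite mulrBl mul1r ltrBlDr ltrDl mulr_gt0// expR_gt0.
- move=> x y; have := fa x y; set t := `|x - y|.
  have := expR_convex (a * t) b01; rewrite mulrA.
  set E := expR (a * t); set e := expR (b * a * t) => He Hf.
  have E1 : 1 <= E.
    by rewrite -expR0 ler_expR; apply: mulr_ge0; [exact: ltW|exact: normr_ge0].
  have : (1 - b) * (E - 1) * expR (-a) <= (E - e) * f y.
    apply: ler_pM => //; [|lra].
    by rewrite mulr_ge0// ?subr_ge0//.
  by move: Hf; set m := expR (- a); lra.
Qed.

End cone.

Section decay.
Context {R : realType}.
Implicit Types (f g w : R -> R).
Variables (lam D : R).
Hypotheses (lam1 : 1 < lam) (D0 : 0 < D).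

(** The transfer operator sends slope a to (a + D) / lam: expansion divides by
    lam and distortion adds D.  For this a the result is b a, where
    b = cone_shrink < 1 since lam > 1. *)
Definition cone_slope : R := 2 * D / (lam - 1).
Definition cone_shrink : R := (lam + 1) / (2 * lam).
(** What is left of a mass 1 after the constant (1 - b) exp (- a) of cone_sub
    is removed. *)
Definition decay_rate : R := 1 - (1 - cone_shrink) * expR (- cone_slope).
Definition cone_max : R := expR cone_slope.
Definition cone_lip_cst : R := (cone_slope * expR cone_slope + 1) * expR cone_slope.
Definition decay_cst : R := (1 + cone_slope^-1) * (2 * cone_lip_cst).

Local Notation a := cone_slope.
Local Notation b := cone_shrink.
Local Notation q := decay_rate.

Let a_gt0 : 0 < a. Proof. by rewrite /a divr_gt0 ?mulr_gt0// subr_gt0. Qed.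
Let a_ge0 : 0 <= a. Proof. exact: ltW. Qed.

Let b01 : 0 < b < 1.
Proof.
have l1 := lam1; have lam0 : 0 < 2 * lam by lra.
by rewrite /b divr_gt0//=; [rewrite ltr_pdivrMr//; lra|lra].
Qed.

Let slopeE : (a + D) / lam = b * a.
Proof. by have l1 := lam1; rewrite /a /b; field; apply/andP; split; rewrite gt_eqF//; lra. Qed.

Let q01 : 0 < q < 1.
Proof.
rewrite /q; have /andP[b0 b1] := b01.
have : expR (- a) <= 1 by rewrite -[X in _ <= X]expR0 ler_expR oppr_le0.
have : 0 < expR (- a) by exact: expR_gt0.
move: (expR _) => e e0 e1.
have : 0 < (1 - b) * e by rewrite mulr_gt0// subr_gt0.
have : (1 - b) * e <= (1 - b) * 1 by rewrite ler_wpM2l// subr_ge0 ltW.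
by move=> ? ?; apply/andP; split; lra.
Qed.

Lemma decay_rate_gt0 : 0 < q. Proof. by case/andP: q01. Qed.

Lemma decay_rate01 : 0 <= q < 1. Proof. by case/andP: q01 => /ltW -> ->. Qed.

Lemma cone_lip_cst_ge : cone_max <= cone_lip_cst.
Proof.
rewrite /cone_lip_cst /cone_max mulrDl mul1r lerDr.
by apply: mulr_ge0; [apply: mulr_ge0; [exact: a_ge0|exact: expR_ge0]|exact: expR_ge0].
Qed.

Lemma decay_cst_gt0 : 0 < decay_cst.
Proof.
have := cone_lip_cst_ge; have : 0 < cone_max by exact: expR_gt0.
move=> m0 mc; rewrite /decay_cst mulr_gt0//; last by rewrite mulr_gt0// (lt_le_trans m0).
by rewrite addr_gt0// invr_gt0.
Qed.

Variables (n : nat) (s : R) (T T1 V : R -> R).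

(** D is a Lipschitz constant of log |T'|. *)
Record expanding_lift : Prop := ExpandingLift {
  el_lift :> circle_lift n s T T1 V;
  el_expand : forall x, lam <= `|T1 x|;
  el_distortion : forall x y, `|T1 y| <= expR (D * `|x - y|) * `|T1 x| }.

Hypothesis HT : expanding_lift.
Local Notation L := (transfer n T1 V).

Lemma inv_contraction x y : `|V x - V y| <= `|x - y| / lam.
Proof.
have lam0 : 0 < lam by have l1 := lam1; lra.
rewrite ler_pdivlMr// -{2}(cl_VK HT x) -{2}(cl_VK HT y).
have [c ->] := mean_value (V y) (V x) (cl_derive HT).
by rewrite normrM mulrC ler_wpM2r// (el_expand HT).
Qed.

(** Preimages of x and y along a branch are lam times closer than x and y,
    while the weights 1 / |T'| contribute the factor exp (D |u - v|). *)
Lemma cone_transfer f : cone a f -> cone (b * a) (L f).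
Proof.
move=> fc; have [pf f0 fa] := fc.
have lam0 : 0 < lam by have l1 := lam1; lra.
have T0 x : 0 < `|T1 x| by rewrite normr_gt0 (cl_neq0 HT).
split.
- exact: transfer_periodic HT _ pf.
- move=> x; rewrite /transfer; have := cl_n HT; case: (n) => // m _.
  rewrite big_ord_recl ltr_wpDr//; last by rewrite divr_gt0.
  by apply: sumr_ge0 => k _; rewrite divr_ge0// ltW.
- move=> x y; rewrite /transfer mulr_sumr; apply: ler_sum => k _.
  set u := V (x + k%:R); set v := V (y + k%:R).
  have uv : `|u - v| <= `|x - y| / lam.
    apply: le_trans (inv_contraction _ _) _.
    by rewrite opprD addrACA subrr addr0.
  have H1 : f u / `|T1 u| <= expR ((a + D) * `|u - v|) * (f v / `|T1 v|).
    rewrite ler_pdivrMr// mulrA mulrAC ler_pdivlMr//.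
    have := ler_pM (ltW (f0 u)) (ltW (T0 v)) (fa u v) (el_distortion HT u v).
    rewrite mulrDl expRD; lra.
  apply: le_trans H1 _; rewrite ler_pM2r ?divr_gt0// ler_expR -slopeE.
  by rewrite -mulrA [_^-1 * _]mulrC ler_pM2l// addr_gt0.
Qed.

(** One step of a coupling: the images of all densities of the cone share the
    constant 1 - q, and what remains is q times a density of the same cone. *)
Lemma cone_step f : cone a f -> circle_int f = 1 ->
  exists g, [/\ cone a g, circle_int g = 1 &
    forall x, L f x = (1 - q) + q * g x].
Proof.
move=> fc f1; have /andP[b0 b1] := b01; have /andP[q0 q1] := q01.
have [pf _ _] := fc; have cf := cone_continuous a_ge0 fc.
have L1 : circle_int (L f) = 1 by rewrite (circle_int_transfer HT).
have b01' : 0 <= b <= 1 by rewrite !ltW.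
have [p1 p2 p3] := cone_sub a_gt0 b01' (cone_transfer fc) L1 b0.
have qE : (1 - b) * expR (- a) = 1 - q by rewrite /decay_rate; ring.
rewrite qE in p1 p2 p3.
have cL := transfer_continuous HT cf.
exists (fun x => q^-1 * (L f x - (1 - q))); split.
- split.
  + by move=> x; rewrite p1.
  + by move=> x; rewrite mulr_gt0// invr_gt0.
  + move=> x y; rewrite mulrCA ler_pM2l ?invr_gt0//.
- rewrite circle_intZ; last by move=> x; apply: cvgB; [exact: cL|exact: cvg_cst].
  rewrite circle_intB//; last by move=> x; exact: cvg_cst.
  rewrite L1 circle_int_cst; field; lra.
- by move=> x; field; lra.
Qed.

(** The shared constants cancel in the difference at each step. *)
Lemma cone_iter N f1 f2 : cone a f1 -> circle_int f1 = 1 -> cone a f2 -> circle_int f2 = 1 ->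
  exists g1 g2, [/\ cone a g1 /\ circle_int g1 = 1, cone a g2 /\ circle_int g2 = 1 &
    forall x, iter N L f1 x - iter N L f2 x = q ^+ N * (g1 x - g2 x)].
Proof.
move=> c1 i1 c2 i2; elim: N => [|N [g1 [g2 [[k1 j1] [k2 j2] E]]]].
  by exists f1, f2; split => // x; rewrite expr0 mul1r.
have [h1 [d1 l1 H1]] := cone_step k1 j1; have [h2 [d2 l2 H2]] := cone_step k2 j2.
exists h1, h2; split => // x.
rewrite !iterS -transferB.
have -> : (fun x => iter N L f1 x - iter N L f2 x) = fun x => q ^+ N * (g1 x - g2 x).
  exact/funext.
by rewrite transferZ transferB H1 H2 exprSr; ring.
Qed.

Lemma cone_iter_in N f : cone a f -> circle_int f = 1 ->
  cone a (iter N L f) /\ circle_int (iter N L f) = 1.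
Proof.
move=> fc f1; elim: N => [//|N [IH1 IH2]]; rewrite iterS; split.
  by apply: cone_weaken (cone_transfer IH1); rewrite ger_pMl//; case/andP: b01 => _ /ltW.
have [pf _ _] := IH1.
by rewrite (circle_int_transfer HT) ?IH2//; exact: cone_continuous a_ge0 IH1.
Qed.

Lemma cone_one : cone a (fun=> 1) /\ circle_int (fun=> 1 : R) = 1.
Proof.
split; last exact: circle_int_cst.
split => // x y; rewrite mulr1 -expR0 ler_expR.
by apply: mulr_ge0; [exact: ltW|exact: normr_ge0].
Qed.

Lemma iter_transferZ N (c : R) f x : iter N L (fun x => c * f x) x = c * iter N L f x.
Proof.
elim: N x => [//|N IH] x; rewrite !iterS -transferZ; congr (L _ x); exact/funext.
Qed.

Lemma iter_transferB N f g x : iter N L (fun x => f x - g x) x = iter N L f x - iter N L g x.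
Proof.
elim: N x => [//|N IH] x; rewrite !iterS -transferB; congr (L _ x); exact/funext.
Qed.

Lemma le_iter_transfer N f g x : (forall x, f x <= g x) -> iter N L f x <= iter N L g x.
Proof.
by move=> fg; elim: N x => [//|N IH] x; rewrite !iterS; exact: le_transfer.
Qed.

Lemma iter_transfer_bound N f B : (forall x, `|f x| <= B) ->
  forall x, `|iter N L f x| <= cone_max * B.
Proof.
move=> fB x; have [c1 i1] := cone_one.
have B0 : 0 <= B by apply: le_trans (fB 0).
have [cN iN] := cone_iter_in N c1 i1.
have /andP[_ mN] := cone_bounds a_ge0 cN iN x.
have H g : (forall x, g x <= B) -> iter N L g x <= cone_max * B.
  move=> gB; apply: le_trans (le_iter_transfer N x (g := fun x => B * 1) _) _.
    by move=> z; rewrite mulr1.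
  by rewrite iter_transferZ mulrC ler_wpM2r.
rewrite ler_norml H ?andbT; last by move=> z; have := fB z; rewrite ler_norml => /andP[].
rewrite lerNl -mulN1r -iter_transferZ H// => z; rewrite mulN1r.
by have := fB z; rewrite ler_norml lerNl => /andP[].
Qed.

Lemma zero_mean_bound w M : periodic w 1 -> lip M w -> circle_int w = 0 ->
  forall x, `|w x| <= M.
Proof.
move=> pw wM w0 x; have cw := lip_continuous wM.
have cc : continuous (fun _ : R => w x : R) by move=> z; exact: cvg_cst.
rewrite -[w x]subr0 -w0 -(circle_int_cst (w x)) -circle_intB//.
apply: circle_int_norm; last by move=> y; exact: lip_osc.
by move=> y; apply: cvgB; [exact: cvg_cst|exact: cw].
Qed.

(** Write w = c (f1 - 1) with f1 = 1 + w / c, where c is a multiple of M large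
    enough for f1 to be in the cone, and apply cone_iter to f1 and 1.  The
    constants depend only on lam and D, which makes the decay uniform over
    families of maps. *)
Lemma transfer_decay N w M : 0 < M -> periodic w 1 -> lip M w -> circle_int w = 0 ->
  (forall x, `|iter N L w x| <= decay_cst * M * q ^+ N) /\
  lip (decay_cst * M * q ^+ N) (iter N L w).
Proof.
move=> M0 pw wM w0.
have cw := lip_continuous wM; have wB := zero_mean_bound pw wM w0.
pose c := M * (1 + a^-1).
have c0 : 0 < c by rewrite /c mulr_gt0// addr_gt0// invr_gt0.
have cM : c - M = M / a by rewrite /c; ring.
have Ma : 0 < M / a by rewrite divr_gt0.
pose f1 x := 1 + c^-1 * w x.
have [k1 i1] := cone_one.
have cf1 : cone a f1.
  have E x : f1 x = c^-1 * (c + w x) by rewrite /f1; field; rewrite gt_eqF.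
  split.
  - by move=> x; rewrite /f1 pw.
  - move=> x; rewrite E mulr_gt0 ?invr_gt0//.
    by have := wB x; rewrite ler_norml => /andP[h _]; lra.
  - move=> x y; rewrite !E mulrCA ler_pM2l ?invr_gt0//.
    have h1 : w x <= w y + M * `|x - y|.
      by have := wM x y; rewrite ler_norml => /andP[_]; lra.
    have h2 : M / a <= c + w y.
      by have := wB y; rewrite ler_norml => /andP[h _]; lra.
    have at0 : 0 <= a * `|x - y| by apply: mulr_ge0.
    have h3 : (1 + a * `|x - y|) * (c + w y) <= expR (a * `|x - y|) * (c + w y).
      by rewrite ler_wpM2r ?expR_ge1Dx//; lra.
    have h4 : a * `|x - y| * (M / a) <= a * `|x - y| * (c + w y) by rewrite ler_wpM2l.
    have h5 : a * `|x - y| * (M / a) = M * `|x - y| by field; rewrite gt_eqF.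
    by apply: le_trans h3; lra.
have if1 : circle_int f1 = 1.
  rewrite /f1 circle_intD; last 2 first.
  - by move=> x; exact: cvg_cst.
  - by move=> x; apply: cvgM; [exact: cvg_cst|exact: cw].
  by rewrite circle_intZ// w0 mulr0 addr0 circle_int_cst.
have [g1 [g2 [[l1 j1] [l2 j2] E]]] := cone_iter N cf1 if1 k1 i1.
have wE x : iter N L w x = c * q ^+ N * (g1 x - g2 x).
  rewrite -mulrA -E -iter_transferB -iter_transferZ; congr (iter N L _ x).
  by apply/funext => z; rewrite /f1; field; rewrite gt_eqF.
have qN : 0 <= c * q ^+ N by rewrite mulr_ge0 ?ltW// exprn_gt0//; case/andP: q01.
have CE : decay_cst * M * q ^+ N = c * q ^+ N * (2 * cone_lip_cst).
  by rewrite /decay_cst /c; ring.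
have B1 x := cone_bounds a_ge0 l1 j1 x; have B2 x := cone_bounds a_ge0 l2 j2 x.
have e0 := expR_gt0 (- a).
have Kc := cone_lip_cst_ge; have m0 : 0 < cone_max by exact: expR_gt0.
rewrite CE; split.
  move=> x; rewrite wE normrM (ger0_norm qN) ler_wpM2l//.
  have /andP[u1 u2] := B1 x; have /andP[v1 v2] := B2 x.
  by rewrite ler_norml; rewrite /cone_max in Kc m0; apply/andP; split; lra.
have P1 := cone_lip a_ge0 l1 (fun x => proj2 (andP (B1 x))).
have P2 := cone_lip a_ge0 l2 (fun x => proj2 (andP (B2 x))).
move=> x y; rewrite !wE -mulrBr normrM (ger0_norm qN) -[leRHS]mulrA ler_wpM2l//.
have -> : g1 x - g2 x - (g1 y - g2 y) = (g1 x - g1 y) - (g2 x - g2 y) by ring.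
apply: le_trans (ler_normB _ _) _.
by have := P1 x y; have := P2 x y; rewrite -/cone_lip_cst; lra.
Qed.

(** The density of the absolutely continuous invariant probability measure, as
    the limit of the images of Lebesgue measure. *)
Definition acip : R -> R := fun x => lim (iter N L (fun=> 1) x @[N --> \oo]).

Lemma iter_one_cauchy N k x :
  `|iter (N + k) L (fun=> 1) x - iter N L (fun=> 1) x| <= cone_max * q ^+ N.
Proof.
have [k1 i1] := cone_one; have [c j] := cone_iter_in k k1 i1.
have [g1 [g2 [[l1 j1] [l2 j2] E]]] := cone_iter N c j k1 i1.
have q0 : 0 <= q ^+ N by rewrite exprn_ge0//; case/andP: q01 => /ltW.
rewrite iterD E normrM (ger0_norm q0) mulrC ler_wpM2r//.
have /andP[] := cone_bounds a_ge0 l1 j1 x; have /andP[] := cone_bounds a_ge0 l2 j2 x.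
have : 0 < expR (- a) by exact: expR_gt0.
by rewrite /cone_max ler_norml => *; apply/andP; split; lra.
Qed.

Lemma acip_cvg x : iter N L (fun=> 1) x @[N --> \oo] --> acip x.
Proof.
have [l + _] := geometric_cvg decay_rate01 (fun N k => @iter_one_cauchy N k x).
by move=> cl; rewrite /acip (cvg_lim _ cl).
Qed.

Lemma acip_approx N x : `|iter N L (fun=> 1) x - acip x| <= cone_max * q ^+ N.
Proof.
have [l cl +] := geometric_cvg decay_rate01 (fun N k => @iter_one_cauchy N k x).
by rewrite /acip (cvg_lim _ cl).
Qed.

Lemma acip_cone : cone a acip.
Proof.
have [k1 i1] := cone_one.
split.
- move=> x; rewrite /acip; 
  have -> // : (fun N => iter N L (fun=> 1) (x + 1)) = fun N => iter N L (fun=> 1) x.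
  by apply/funext => N; have [[p _ _] _] := cone_iter_in N k1 i1; exact: p.
- move=> x; apply: lt_le_trans (expR_gt0 (- a)) _.
  apply: limr_ge; first by apply/cvg_ex; eexists; exact: acip_cvg.
  near=> N; have [c i] := cone_iter_in N k1 i1.
  by have /andP[] := cone_bounds a_ge0 c i x.
- move=> x y; rewrite -subr_ge0.
  have : expR (a * `|x - y|) * iter N L (fun=> 1) y - iter N L (fun=> 1) x @[N --> \oo] -->
     expR (a * `|x - y|) * acip y - acip x.
    by apply: cvgB; [apply: cvgM; [exact: cvg_cst|]|]; exact: acip_cvg.
  move=> cv; rewrite -(cvg_lim _ cv)//; apply: limr_ge; first by apply/cvg_ex; eexists; exact: cv.
  near=> N; rewrite subr_ge0.
  by have [[_ _ h] _] := cone_iter_in N k1 i1; exact: h.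
Unshelve. all: by end_near. Qed.

Lemma acip_continuous : continuous acip.
Proof. exact: cone_continuous a_ge0 acip_cone. Qed.

Lemma acip_int : circle_int acip = 1.
Proof.
have [k1 i1] := cone_one.
apply/eqP; rewrite -subr_eq0 -normr_le0; apply: (geometric_le0 (C := cone_max) decay_rate01) => N.
have [c i] := cone_iter_in N k1 i1; rewrite -i distrC -circle_intB.
- apply: circle_int_norm => [x|x]; last exact: acip_approx.
  by apply: cvgB; [exact: cone_continuous a_ge0 c x|exact: acip_continuous].
- exact: cone_continuous a_ge0 c.
- exact: acip_continuous.
Qed.

Lemma acip_invariant x : L acip x = acip x.
Proof.
apply/eqP; rewrite -subr_eq0 -normr_le0.
apply: (geometric_le0 (C := (cone_max + 1) * cone_max) decay_rate01) => N.
have q0 : 0 <= q ^+ N by rewrite exprn_ge0//; case/andP: q01 => /ltW.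
have h1 : `|L (fun x => iter N L (fun=> 1) x - acip x) x| <= cone_max * (cone_max * q ^+ N).
  exact: (iter_transfer_bound 1 (acip_approx N)).
have h2 := acip_approx N.+1 x.
rewrite transferB -iterS in h1.
have h3 : cone_max * q ^+ N.+1 <= cone_max * q ^+ N.
  rewrite ler_wpM2l ?expR_ge0// exprS ler_piMl//; by case/andP: q01 => _ /ltW.
have -> : L acip x - acip x =
  (iter N.+1 L (fun=> 1) x - acip x) - (iter N.+1 L (fun=> 1) x - L acip x) by ring.
apply: le_trans (ler_normB _ _) _; lra.
Qed.

End decay.

(** * Density of Lipschitz functions and uniqueness of the invariant density *)

Lemma cvge0_lt {R : realType} (u : nat -> \bar R) (e : R) : u n @[n --> \oo] --> 0%E -> 0 < e ->
  \forall n \near \oo, (u n < e%:E)%E.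
Proof.
move=> h e0; apply: (h [set x | (x < e%:E)%E]).
by apply: open_nbhs_nbhs; split; [exact: open_ereal_lt_ereal|rewrite /= lte_fin].
Qed.

Section lipschitz_density.
Context {R : realType}.
Local Notation mu := (@lebesgue_measure R).
Implicit Types (f g u p : R -> R).

Definition frac (x : R) : R := x - (Num.floor x)%:~R.

Lemma frac_itv x : 0 <= frac x < 1.
Proof. by rewrite /frac subr_ge0 ltrBlDl -intrD1 floor_le floorD1_gt. Qed.

Lemma fracD1 x : frac (x + 1) = frac x.
Proof. by rewrite /frac -[1]/(1%:~R) floorDrz ?intr_int// intrKfloor intrD; ring. Qed.

Lemma frac_id x : 0 <= x < 1 -> frac x = x.
Proof. by move=> x01; rewrite /frac (@floor_def _ x 0) ?subr0// add0r. Qed.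

(** An increment that crosses integers splits into one from x up to the next
    integer and one from an integer up to y, since u takes the same value at 0
    and 1. *)
Lemma lip_frac M u : u 0 = u 1 -> 0 <= M ->
  (forall x y, 0 <= x <= 1 -> 0 <= y <= 1 -> `|u x - u y| <= M * `|x - y|) ->
  lip M (fun x => u (frac x)).
Proof.
move=> u01 M0 uM x y; wlog xy : x y / x <= y.
  move=> H; case/orP: (le_total x y) => [|yx]; first exact: H.
  by rewrite distrC [`|x - y|]distrC; exact: H.
have /andP[x0 x1] := frac_itv x; have /andP[y0 y1] := frac_itv y.
have fxy : (Num.floor x <= Num.floor y)%R by exact: le_floor.
have [E|ne] := eqVneq (Num.floor x) (Num.floor y).
  have -> : x - y = frac x - frac y by rewrite /frac E; ring.
  by apply: uM; apply/andP; split => //; exact: ltW.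
have lt1 : (Num.floor x)%:~R + 1 <= (Num.floor y)%:~R :> R.
  by rewrite -[X in _ + X]/(1%:~R) -intrD ler_int lezD1 lt_neqAle ne.
have h1 := uM (frac x) 1; have h2 := uM 0 (frac y).
have {}h1 : `|u (frac x) - u 1| <= M * (1 - frac x).
  have <- : `|frac x - 1| = 1 - frac x by rewrite distrC ger0_norm// subr_ge0 ltW.
  by apply: h1; rewrite ?x0 ?ler01 ?lexx ?ltW.
have {}h2 : `|u 0 - u (frac y)| <= M * frac y.
  by move: h2; rewrite sub0r normrN (ger0_norm y0); apply; rewrite ?y0 ?ler01 ?lexx ?ltW.
have -> : u (frac x) - u (frac y) = (u (frac x) - u 1) + (u 0 - u (frac y)) by rewrite u01; ring.
apply: le_trans (ler_normD _ _) _; apply: le_trans (lerD h1 h2) _.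
rewrite -mulrDr ler_wpM2l// distrC ger0_norm ?subr_ge0//.
by move: lt1; rewrite /frac; lra.
Qed.

(** The difference quotients of a primitive of G are Lipschitz and bounded,
    and converge to G almost everywhere by Lebesgue differentiation, hence in
    L^1 by dominated convergence.  As G vanishes near 0 and 1, so do the
    quotients with small step, which therefore extend to periodic Lipschitz
    functions. *)
Lemma steklov_approx (G : R -> R) (B d : R) : measurable_fun [set: R] G -> 0 < d < 1 ->
  (forall x, `|G x| <= B) -> (forall x, ~~ (d <= x <= 1 - d) -> G x = 0) ->
  forall e, 0 < e -> exists M p, [/\ periodic p 1, lip M p &
    (\int[mu]_(x in `]0%R, 1%R[) `|(G x - p x)%:E| < e%:E)%E].
Proof.
move=> mG /andP[d0 d1] GB G0 e e0.
have B0 : 0 <= B by apply: le_trans (GB 0).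
have iG : mu.-integrable setT (EFin \o G).
  have : mu.-integrable `[0, 1]%classic (EFin \o G).
    apply: measurable_bounded_integrable => //.
    - by rewrite /= lebesgue_measure_itv/= lte_fin ltr01 -EFinD ltry.
    - exact: measurable_funTS.
    - by exists B; split; [exact: num_real|move=> x Bx y _; apply: le_trans (GB y) (ltW Bx)].
  rewrite integrable_mkcond//; congr (mu.-integrable _ _).
  apply/funext => x /=; rewrite patchE; case: ifPn => // xn; rewrite /= G0//.
  by apply: contraNN xn => /andP[h1 h2]; rewrite inE/= in_itv/=; apply/andP; split; lra.
have iGD (D : set R) : measurable D -> mu.-integrable D (EFin \o G).
  by move=> mD; apply: integrableS iG.
pose F x := \int[mu]_(t in `]-oo, x]) G t.
have Fxy x y : x <= y -> F y - F x = \int[mu]_(t in `]x, y]) G t.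
  by move=> xy; rewrite /F Rintegral_itvB//; [exact: iGD].
have Flip : lip B F.
  move=> x y; wlog xy : x y / x <= y.
    move=> H; case/orP: (le_total x y) => [|yx]; first exact: H.
    by rewrite distrC [`|x - y|]distrC; exact: H.
  rewrite distrC Fxy// [`|x - y|]distrC (ger0_norm (_ : 0 <= y - x)) ?subr_ge0//.
  apply: le_trans (le_normr_Rintegral _ _) _ => //; first exact: iGD.
  apply: (@le_trans _ _ (\int[mu]_(t in `]x, y]) B)).
    apply: le_Rintegral => //; [|exact: continuous_integrable (fun _ => cvg_cst _)].
    by have := iGD `]x, y]%classic; move=> /(_ (measurable_itv _))/integrable_norm.
  rewrite Rintegral_cst//= lebesgue_measure_itv/= lte_fin.
  by case: ltP => h /=; rewrite ?mulr0 ?mulr_ge0// subr_ge0.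
have dF : {ae mu, forall x, derivable F x 1 /\ F^`()%classic x = G x}.
  apply: FTC1Ny => [y|]; first exact: iGD.
  have := integrable_locally measurableT iG.
  by rewrite patch_setT.
pose u m x := (F (x + m.+1%:R^-1) - F x) / m.+1%:R^-1.
have uB m x : `|u m x| <= B.
  have m0 : 0 < m.+1%:R^-1 :> R by rewrite invr_gt0.
  rewrite /u normrM [`|_^-1^-1|]gtr0_norm ?invr_gt0// ler_pdivrMr//.
  apply: le_trans (Flip _ _) _; rewrite addrAC subrr add0r gtr0_norm//.
have cF := lip_continuous Flip.
have cu m : continuous (u m).
  move=> x; apply: cvgM; last exact: cvg_cst.
  apply: cvgB; last exact: cF.
  apply: (cont_comp (f := fun x => x + m.+1%:R^-1) _ cF) => z.
  by apply: cvgD; [exact: cvg_id|exact: cvg_cst].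
have mu0 m (D : set R) : measurable D -> measurable_fun D (fun x => (u m x)%:E).
  by move=> mD; apply/measurable_EFinP; apply: measurable_funTS; exact: continuous_measurable_fun.
have hm : measurable_fun (`]0%R, 1%R[%classic : set R) (EFin \o G).
  by apply/measurable_EFinP; exact: measurable_funTS.
have inv0 : (fun m => m.+1%:R^-1 : R) @ \oo --> (0 : R)^'.
  move=> P [k k0 kP]; have [N _ HN] : \forall m \near \oo, `|0 - m.+1%:R^-1 : R| < k.
    by apply: cvgr_dist_lt => //; exact: cvg_harmonic.
  exists N => // m /= Nm; apply: kP; first exact: HN.
  by rewrite invr_eq0 pnatr_eq0.
have hc : {ae mu, forall x, `]0%R, 1%R[%classic x -> (u m x)%:E @[m --> \oo] --> (EFin \o G) x}.
  have Fae := ae_filter_ringOfSetsType mu.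
  apply: filterS dF => x [dFx Gx] _; apply: cvg_EFin; first by near=> m.
  rewrite -Gx derive1E.
  have := cvg_comp _ _ inv0 dFx.
  apply: cvg_trans; apply: near_eq_cvg; near=> m.
  by rewrite /u /= /shift /= -[_ *: 1]/(_ * 1) mulr1 [_ + x]addrC -[_ *: _]/(_ * _) mulrC.
have hi : mu.-integrable (`]0%R, 1%R[%classic : set R) (fun _ => B%:E).
  exact: (@continuous_integrable R (fun _ => B) false true 0 1 (fun _ => cvg_cst _)).
have hb : {ae mu, forall x m, (`]0%R, 1%R[%classic : set R) x -> (`|(u m x)%:E| <= B%:E)%E}.
  by apply: aeW => x m _; rewrite lee_fin.
have [_ + _] := @dominated_convergence _ _ _ mu `]0%R, 1%R[%classic (measurable_itv _)
   (fun m x => (u m x)%:E) (EFin \o G) (fun _ => B%:E) (fun m => mu0 m _ (measurable_itv _))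
   hm hc hi hb.
move=> /cvge0_lt /(_ e0) H; near \oo => m.
have m0 : 0 < m.+1%:R^-1 :> R by rewrite invr_gt0.
pose K := (B + B) / m.+1%:R^-1.
have uK : lip K (u m).
  move=> x y; rewrite /u -mulrBl normrM [`|_^-1^-1|]gtr0_norm ?invr_gt0// /K mulrAC ler_pM2r ?invr_gt0//.
  have := Flip (x + m.+1%:R^-1) (y + m.+1%:R^-1); have := Flip x y.
  set h := m.+1%:R^-1; have -> : x + h - (y + h) = x - y by ring.
  have -> : F (x + h) - F x - (F (y + h) - F y) = (F (x + h) - F (y + h)) - (F x - F y) by ring.
  by move=> h1 h2; apply: le_trans (ler_normB _ _) _; lra.
have Fcst x y : x <= y -> (y < d \/ 1 - d < x) -> F y = F x.
  move=> xy h; apply/eqP; rewrite -subr_eq0 Fxy//.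
  rewrite (@eq_Rintegral _ _ _ mu _ (fun=> 0)) ?Rintegral_cst//= ?mul0r//.
  move=> t; rewrite inE/= in_itv/= => /andP[xt ty]; rewrite G0//.
  by apply/negP => /andP[]; case: h; lra.
have md : m.+1%:R^-1 < d.
  near: m; have [N _ HN] : \forall m \near \oo, `|0 - m.+1%:R^-1 : R| < d.
    by apply: cvgr_dist_lt => //; exact: cvg_harmonic.
  by exists N => // m /= /HN; rewrite sub0r normrN; apply: le_lt_trans; exact: ler_norm.
have u0 : u m 0 = 0.
  by rewrite /u add0r (Fcst 0 m.+1%:R^-1) ?subrr ?mul0r// ?ltW//; left.
have u1 : u m 1 = 0.
  by rewrite /u (Fcst 1 (1 + m.+1%:R^-1)) ?subrr ?mul0r// ?lerDl ?ltW//; right; lra.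
exists K, (fun x => u m (frac x)); split.
- by move=> x; rewrite fracD1.
- by apply: lip_frac; [rewrite u0 u1|exact: lip_ge0 uK|move=> x y _ _; exact: uK].
- have -> : (\int[mu]_(x in `]0%R, 1%R[) `|(G x - u m (frac x))%:E| =
    \int[mu]_(x in `]0%R, 1%R[) `|(u m x)%:E - (G x)%:E|)%E.
    apply: eq_integral => x; rewrite inE/= in_itv/= => /andP[x0 x1].
    by rewrite frac_id ?(ltW x0) ?x1//= distrC.
  by near: m.
Unshelve. all: by end_near. Qed.

(** Truncating g in height and near the ends of the interval, with small L^1
    error, gives functions to which steklov_approx applies. *)
Lemma lip_dense g : mu.-integrable `[0, 1[ (EFin \o g) -> forall e, 0 < e ->
  exists M p, [/\ periodic p 1, lip M p &
    (\int[mu]_(x in `[0%R, 1%R[) `|(g x - p x)%:E| < e%:E)%E].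
Proof.
move=> ig e e0.
have mg : measurable_fun (`[0%R, 1%R[%classic : set R) g.
  by case/integrableP : ig => /measurable_EFinP.
pose g0 := g \_ `[0, 1[.
have mg0 : measurable_fun [set: R] g0 by apply/(measurable_restrictT _ _).1.
pose E m : set R := `[m.+2%:R^-1, 1 - m.+2%:R^-1]%classic `&` [set x | `|g0 x| <= m%:R].
have mE m : measurable (E m).
  apply: measurableI => //; rewrite -[X in measurable X]setTI.
  have mn : measurable_fun [set: R] (fun x => `|g0 x|) by apply: measurableT_comp mg0.
  have := mn measurableT `]-oo, m%:R]%classic (measurable_itv _).
  by congr (measurable (_ `&` _)); apply/seteqP; split => x /=; rewrite in_itv.
pose G m := g0 \_ (E m).
have mG m : measurable_fun [set: R] (G m).
  by apply/(measurable_restrictT _ _).1 => //; exact: measurable_funTS.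
have Gle m x : `|G m x| <= `|g0 x|.
  by rewrite /G patchE; case: ifPn => // _; rewrite normr0.
have mGE m : measurable_fun (`]0%R, 1%R[%classic : set R) (EFin \o G m).
  by apply/measurable_EFinP; exact: measurable_funTS.
have hm : measurable_fun (`]0%R, 1%R[%classic : set R) (EFin \o g0).
  by apply/measurable_EFinP; exact: measurable_funTS.
have subo : (`]0%R, 1%R[%classic : set R) `<=` `[0%R, 1%R[%classic.
  by move=> x /=; rewrite !in_itv/= => /andP[/ltW -> ->].
have hi : mu.-integrable (`]0%R, 1%R[%classic : set R) (fun x => `|g0 x|%:E).
  have : mu.-integrable (`]0%R, 1%R[%classic : set R) (EFin \o g0).
    have ig0 : mu.-integrable setT (EFin \o g0).
      by move: ig; rewrite integrable_mkcond// restrict_EFin.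
    exact: integrableS ig0.
  by move/integrable_norm.
have hb : {ae mu, forall x m, (`]0%R, 1%R[%classic : set R) x -> (`|(EFin \o G m) x| <= `|g0 x|%:E)%E}.
  by apply: aeW => x m _; rewrite lee_fin.
have hc : {ae mu, forall x, (`]0%R, 1%R[%classic : set R) x -> (EFin \o G m) x @[m --> \oo] --> (EFin \o g0) x}.
  apply: aeW => x /=; rewrite in_itv/= => /andP[x0 x1].
  apply: cvg_near_cst; near=> m; rewrite /= /G patchE ifT// inE; split => /=; last first.
    near: m; exists (Num.truncn `|g0 x|).+1 => // m /= hm'.
    by apply: le_trans (ltW (truncnS_gt _)) _; rewrite ler_nat.
  have : m.+1%:R^-1 < Num.min x (1 - x).
    near: m; have [N _ HN] : \forall m \near \oo, `|0 - m.+1%:R^-1 : R| < Num.min x (1 - x).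
      by apply: cvgr_dist_lt; [exact: cvg_harmonic|rewrite lt_min x0 subr_gt0].
    by exists N => // m /= /HN; rewrite sub0r normrN; apply: le_lt_trans; exact: ler_norm.
  have : m.+2%:R^-1 <= m.+1%:R^-1 :> R by rewrite lef_pV2 ?posrE// ler_nat.
  rewrite lt_min in_itv/= => h /andP[/(le_lt_trans h)/ltW -> /(le_lt_trans h)/ltW /=].
  by rewrite lerBrDr addrC -lerBrDr.
have [_ + _] := @dominated_convergence _ _ _ mu `]0%R, 1%R[%classic (measurable_itv _)
   (fun m => EFin \o G m) (EFin \o g0) (fun x => `|g0 x|%:E) mGE hm hc hi hb.
have e20 : 0 < e / 2 by rewrite divr_gt0.
move=> /cvge0_lt /(_ e20) H; near \oo => m.
have hd : 0 < (m.+2%:R^-1 : R) < 1.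
  by rewrite invr_gt0 ltr0n/= invf_lt1 ?ltr0n// ltr1n.
have GB x : `|G m x| <= m%:R.
  by rewrite /G patchE; case: ifPn => [|_]; rewrite ?normr0// inE => -[].
have G0 x : ~~ (m.+2%:R^-1 <= x <= 1 - m.+2%:R^-1) -> G m x = 0.
  move=> nx; rewrite /G patchE; case: ifPn => //; rewrite inE => -[+ _].
  by rewrite /= in_itv/= => h; rewrite h in nx.
have [M [p [pp lp Hp]]] := steklov_approx (mG m) hd GB G0 e20.
exists M, p; split => //.
have cp := lip_continuous lp.
have mp (D : set R) : measurable D -> measurable_fun D p.
  by move=> mD; apply: measurable_funTS; exact: continuous_measurable_fun.
rewrite -integral_itv_obnd_cbnd; last first.
  apply/measurable_EFinP; apply: measurableT_comp => //; apply: measurable_funB; last exact: mp.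
  exact: measurable_funS mg.
rewrite (splitr e) EFinD.
have : (\int[mu]_(x in `]0%R, 1%R[) `|(EFin \o G m) x - (EFin \o g0) x| < (e / 2)%:E)%E by near: m.
move=> HG; apply: le_lt_trans (lteD HG Hp).
rewrite -ge0_integralD//; last 2 first.
- apply: measurableT_comp => //; apply: emeasurable_funB; [exact: mGE|exact: hm].
- apply: measurableT_comp => //; apply/measurable_EFinP; apply: measurable_funB; last exact: mp.
  by apply: measurable_funTS; exact: mG.
apply: ge0_le_integral => //.
- apply/measurable_EFinP; apply: measurableT_comp => //; apply: measurable_funB; last exact: mp.
  exact: measurable_funS mg.
- apply: emeasurable_funD.
    by apply: measurableT_comp => //; apply: emeasurable_funB; [exact: mGE|exact: hm].
  apply: measurableT_comp => //; apply/measurable_EFinP; apply: measurable_funB; last exact: mp.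
  by apply: measurable_funTS; exact: mG.
- move=> x xi; have -> : g x = g0 x by rewrite /g0 patchE ifT// inE; exact: subo.
  rewrite /= -EFinD lee_fin.
  have -> : g0 x - p x = - (G m x - g0 x) + (G m x - p x) by ring.
  by apply: le_trans (ler_normD _ _) _; rewrite normrN.
Unshelve. all: by end_near. Qed.

End lipschitz_density.

Section circle_L1.
Context {R : realType}.
Local Notation mu := (@lebesgue_measure R).
Implicit Types (f g p : R -> R) (A E : set R).

Lemma circle_L1P f : periodic f 1 -> circle_L 1 f <-> mu.-integrable `[0, 1[ (EFin \o f).
Proof.
move=> pf; have E : mu.-integrable setT (EFin \o (f \_ `[0, 1[)) <-> mu.-integrable `[0, 1[ (EFin \o f).
  by rewrite [X in _ <-> X]integrable_mkcond// restrict_EFin.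
split => [[_ /Lfun1_integrable]|H]; first by rewrite E.
by split => //; apply/Lfun1_integrable; rewrite E.
Qed.

Lemma circle_L1_continuous f : continuous f -> periodic f 1 -> circle_L 1 f.
Proof. by move=> cf pf; apply/circle_L1P => //; exact: continuous_integrable. Qed.

Lemma lip_dense_sets g e : circle_L 1 g -> 0 < e -> exists M p, [/\ periodic p 1, lip M p &
  forall A, measurable A ->
  `|\int[mu]_(x in `[0, 1[ `&` A) g x - \int[mu]_(x in `[0, 1[ `&` A) p x| <= e].
Proof.
move=> Lg e0; have [pg _] := Lg; have ig := (circle_L1P pg).1 Lg.
have [M [p [pp lp H]]] := lip_dense ig e0; exists M, p; split => // A mA.
have cp := lip_continuous lp.
have ip : mu.-integrable `[0, 1[ (EFin \o p) by exact: continuous_integrable.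
have mD : measurable (`[0, 1[ `&` A) by exact: measurableI.
have iA h : mu.-integrable `[0, 1[ (EFin \o h) -> mu.-integrable (`[0, 1[ `&` A) (EFin \o h).
  by move=> ih; apply: integrableS ih.
have igp : mu.-integrable `[0, 1[ (EFin \o (fun x => g x - p x)) by exact: integrableB ig ip.
rewrite -RintegralB//; [|exact: iA..].
rewrite -lee_fin EFin_normr_Rintegral//; last exact: (iA (fun x => g x - p x)).
have [mgp _] := integrableP _ _ _ igp.
apply: le_trans (le_abse_integral _ _ _) _ => //.
  by case/integrableP: (iA _ igp).
apply: le_trans _ (ltW H).
apply: ge0_subset_integral => //.
exact: measurableT_comp.
Qed.

(** The periodisation of E is a countable union of translates of E, so it is
    measurable. *)
Lemma periodic_extension E : measurable E -> E `<=` `[0, 1[ ->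
  exists2 A, circle_set A & `[0, 1[ `&` A = E.
Proof.
move=> mE sE; exists [set x | E (frac x)]; last first.
  apply/seteqP; split => x /=; first by move=> [/[!in_itv]/= x01]; rewrite frac_id.
  by move=> Ex; have /= := sE _ Ex; rewrite in_itv/= => x01; rewrite frac_id.
split; last by move=> x /=; rewrite fracD1.
have pfr : periodic frac (1 : R) by exact: fracD1.
have sh (c : R) : measurable [set x | E (x + c)].
  rewrite -[X in measurable X]setTI.
  have cs : continuous (fun x : R => x + c).
    by move=> x; apply: cvgD; [exact: cvg_id|exact: cvg_cst].
  exact: (continuous_measurable_fun cs).
have -> : [set x | E (frac x)] = (\bigcup_k [set x | E (x + k%:R)]) `|`
    (\bigcup_k [set x | E (x + - k%:R)]).
  apply/seteqP; split => x /=.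
    rewrite /frac; case: (Num.floor x) => k.
      by rewrite -pmulrn => Ek; right; exists k.
    by rewrite NegzE mulrNz opprK -pmulrn => Ek; left; exists k.+1.
  have key (m : int) : E (x + m%:~R) -> E (frac x).
    move=> Em; rewrite -(periodic1_int m pfr) frac_id//.
    by have /= := sE _ Em; rewrite in_itv.
  by move=> [[k _]|[k _]] /= h; [apply: (key k%:Z); rewrite -pmulrn|apply: (key (- k%:Z)); rewrite mulrNz -pmulrn].
by apply: measurableU; apply: bigcup_measurable => k _; exact: sh.
Qed.

Lemma circle_ae_eqP f g : circle_L 1 f -> circle_L 1 g ->
  (forall A, circle_set A -> \int[mu]_(x in `[0, 1[ `&` A) f x = \int[mu]_(x in `[0, 1[ `&` A) g x) ->
  circle_ae_eq f g.
Proof.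
move=> Lf Lg H; have [pf _] := Lf; have [pg _] := Lg.
have jf := (circle_L1P pf).1 Lf; have jg := (circle_L1P pg).1 Lg.
have : ae_eq mu (`[0%R, 1%R[%classic : set R) (EFin \o f) (EFin \o g).
  apply: (@integral_ae_eq _ _ R mu `[0%R, 1%R[%classic _ (EFin \o g) (EFin \o f)) => //; first by case/integrableP: jg.
  move=> E sE mE; have [A cA AE] := periodic_extension mE sE.
  have fin h : mu.-integrable `[0, 1[ (EFin \o h) ->
      (\int[mu]_(x in E) (EFin \o h) x)%E = (\int[mu]_(x in E) h x)%:E.
    move=> ih; rewrite /Rintegral fineK//; apply: integrable_fin_num => //.
    by apply: integrableS ih.
  by rewrite !fin// -AE H.
have Fae := ae_filter_ringOfSetsType mu.
by apply: filterS => x h xi; have := h xi => -[].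
Qed.

End circle_L1.

Section invariant_density.
Context {R : realType}.
Local Notation mu := (@lebesgue_measure R).
Implicit Types (f g p : R -> R) (A E : set R).
Variables (lam D : R).
Hypotheses (lam1 : 1 < lam) (D0 : 0 < D).
Variables (n : nat) (s : R) (T T1 V : R -> R).
Hypothesis HT : expanding_lift lam D n s T T1 V.
Local Notation L := (transfer n T1 V).
Local Notation f0 := (acip n T1 V).

Lemma acip_bounds x : expR (- cone_slope lam D) <= f0 x <= cone_max lam D.
Proof.
have a0 : 0 <= cone_slope lam D by rewrite /cone_slope divr_ge0 ?mulr_ge0 ?ltW// subr_gt0.
exact: (cone_bounds a0 (acip_cone lam1 D0 HT) (acip_int lam1 D0 HT)).
Qed.

Lemma acip_lip : lip (cone_lip_cst lam D) f0.
Proof.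
have a0 : 0 <= cone_slope lam D by rewrite /cone_slope divr_ge0 ?mulr_ge0 ?ltW// subr_gt0.
apply: (cone_lip a0 (acip_cone lam1 D0 HT)) => x.
by have /andP[_] := acip_bounds x.
Qed.

Lemma iter_transfer_periodic N p : periodic p 1 -> periodic (iter N L p) 1.
Proof. by move=> pp; elim: N => [//|N IH]; rewrite iterS; exact: transfer_periodic HT _ IH. Qed.

Lemma iter_transfer_continuous N p : continuous p -> continuous (iter N L p).
Proof. by move=> pp; elim: N => [//|N IH]; rewrite iterS; exact: transfer_continuous HT _ IH. Qed.

Lemma circle_set_iter N A : circle_set A -> circle_set (iter N (preimage T) A).
Proof. by move=> cA; elim: N => [//|N IH]; rewrite iterS; exact: circle_set_preimage HT _ IH. Qed.

Lemma iter_duality N p A : continuous p -> periodic p 1 -> circle_set A ->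
  \int[mu]_(x in `[0, 1[ `&` iter N (preimage T) A) p x =
  \int[mu]_(x in `[0, 1[ `&` A) iter N L p x.
Proof.
move=> cp pp; elim: N A => [//|N IH] A cA.
rewrite iterSr IH; last exact: circle_set_preimage HT _ cA.
rewrite (transfer_duality HT)//; first exact: iter_transfer_continuous.
exact: iter_transfer_periodic.
Qed.

Lemma acip_invariant_density : invariant_density T f0.
Proof.
have cf := acip_continuous lam1 D0 HT; have [pf fpos _] := acip_cone lam1 D0 HT.
split.
- exact: circle_L1_continuous.
- by move=> x; exact: ltW.
- exact: (acip_int lam1 D0 HT).
- move=> A cA; rewrite (transfer_duality HT)//.
  by apply: eq_Rintegral => x _; exact: (acip_invariant lam1 D0 HT).
Qed.

(** Approximate an invariant density g by a Lipschitz p in L^1 and let w =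
    p - (int p) f0, which has zero mean.  The masses of A under g and f0 equal
    those of T^-N A, and on T^-N A the mass of w is the integral over A of
    L ^ N w, which tends to 0.  So the two masses of A differ at most by
    multiples of the approximation error. *)
Lemma acip_unique g : invariant_density T g -> circle_ae_eq f0 g.
Proof.
move=> [Lg g0 g1 gT]; have [Lf _ f1 fT] := acip_invariant_density.
apply: circle_ae_eqP => // A cA; apply/esym/eqP; rewrite -subr_eq0 -normr_le0.
apply/ler_addgt0Pl => e e0; rewrite addr0.
have e30 : 0 < e / 3 by rewrite divr_gt0.
have [M [p [pp lp H]]] := lip_dense_sets Lg e30.
have cp := lip_continuous lp; have cf := acip_continuous lam1 D0 HT.
have [pf fpos _] := acip_cone lam1 D0 HT.
have mA : measurable A by case: cA.
set I := circle_int p.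
have I1 : `|1 - I| <= e / 3.
  by rewrite -[X in `|X - _|]g1 /I /circle_int; have := H setT measurableT; rewrite !setIT.
pose w x := p x - I * f0 x.
pose Mf := cone_lip_cst lam D; have lf : lip Mf f0 := acip_lip.
have cIf : continuous (fun x => I * f0 x) by move=> x; apply: cvgM; [exact: cvg_cst|exact: cf].
have lw : lip (M + `|I| * Mf + 1) w.
  move=> x y; rewrite /w; have -> : p x - I * f0 x - (p y - I * f0 y) =
    (p x - p y) - I * (f0 x - f0 y) by ring.
  apply: le_trans (ler_normB _ _) _; rewrite normrM.
  have := lp x y; have := ler_wpM2l (normr_ge0 I) (lf x y).
  have := normr_ge0 (x - y); lra.
have M0 : 0 < M + `|I| * Mf + 1.
  by have := lip_ge0 lp; have := mulr_ge0 (normr_ge0 I) (lip_ge0 lf); lra.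
have pw : periodic w 1 by move=> x; rewrite /w pp pf.
have w0 : circle_int w = 0 by rewrite /w circle_intB// circle_intZ// f1 mulr1 subrr.
have cw := lip_continuous lw.
set C := decay_cst lam D * (M + `|I| * Mf + 1).
have decay N x : `|iter N L w x| <= C * decay_rate lam D ^+ N.
  by have [h _] := transfer_decay lam1 D0 HT N M0 pw lw w0; exact: h.
have [N /ltW CN] := geometric_small C (decay_rate01 lam1 D0) e30.
set B := iter N (preimage T) A.
have cB : circle_set B by exact: circle_set_iter.
have mB : measurable B by case: cB.
have inv h : (forall A, circle_set A ->
    \int[mu]_(x in `[0, 1[ `&` T @^-1` A) h x = \int[mu]_(x in `[0, 1[ `&` A) h x) ->
    \int[mu]_(x in `[0, 1[ `&` B) h x = \int[mu]_(x in `[0, 1[ `&` A) h x.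
  move=> hT; rewrite /B; elim: (N) => [//|k IH]; rewrite iterS hT ?IH//.
  exact: circle_set_iter.
have gB := inv g gT; have fB := inv f0 fT.
have wB := iter_duality N cw pw cA; rewrite -/B in wB.
have mIA : measurable (`[0, 1[ `&` A) by exact: measurableI.
have mIB : measurable (`[0, 1[ `&` B) by exact: measurableI.
have wBE : \int[mu]_(x in `[0, 1[ `&` B) w x =
   \int[mu]_(x in `[0, 1[ `&` B) p x - I * \int[mu]_(x in `[0, 1[ `&` A) f0 x.
  rewrite RintegralB//; [|exact: circle_integrable|exact: (circle_integrable cIf)].
  by rewrite RintegralZl ?fB//; exact: circle_integrable.
have fA : `|\int[mu]_(x in `[0, 1[ `&` A) f0 x| <= 1.
  rewrite -[leRHS]f1 ger0_norm; last by apply: Rintegral_ge0 => x _; exact: ltW.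
  rewrite -lee_fin /circle_int /Rintegral !fineK.
  - apply: ge0_subset_integral => //.
    + by apply/measurable_EFinP; apply: measurable_funTS; exact: continuous_measurable_fun.
    + by move=> x _; rewrite lee_fin ltW.
  - by apply: integrable_fin_num => //; exact: continuous_integrable.
  - by apply: integrable_fin_num => //; exact: circle_integrable.
have wA : `|\int[mu]_(x in `[0, 1[ `&` A) iter N L w x| <= e / 3.
  have ciw := iter_transfer_continuous (N := N) cw.
  apply: le_trans (le_normr_Rintegral _ _) _ => //; first exact: circle_integrable.
  apply: (@le_trans _ _ (\int[mu]_(x in `[0, 1[ `&` A) (e / 3))).
    apply: le_Rintegral => //.
    - by have := circle_integrable ciw mA => /integrable_norm.
    - exact: (circle_integrable (fun x => cvg_cst _)).
    - by move=> x _; apply: le_trans (decay N x) CN.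
  rewrite Rintegral_cst//; apply: ler_piMr; first exact: ltW.
  have : (mu (`[0%R, 1%R[ `&` A) <= 1)%E.
    rewrite [leRHS](_ : _ = mu `[0%R, 1%R[).
      by apply: le_measure; rewrite ?inE.
    by rewrite /= lebesgue_measure_itv/= lte_fin ltr01 -EFinB subr0.
  by move=> h; rewrite -lee_fin fineK// ge0_fin_numE// (le_lt_trans h)// ltry.
have HB := H B mB; rewrite gB in HB; rewrite wB in wBE.
set a := \int[mu]_(x in `[0, 1[ `&` A) g x in HB *.
set b := \int[mu]_(x in `[0, 1[ `&` A) f0 x in fA wBE *.
set c := \int[mu]_(x in `[0, 1[ `&` B) p x in HB wBE *.
rewrite wBE in wA.
have -> : a - b = (a - c) + (c - I * b) - (1 - I) * b by ring.
apply: le_trans (ler_normB _ _) _; apply: le_trans (lerD (ler_normD _ _) (lexx _)) _.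
have : `|(1 - I) * b| <= e / 3 by rewrite normrM -[leRHS]mulr1 ler_pM.
lra.
Qed.

End invariant_density.

(** * Differentiability of the invariant density *)

Section derivative_facts.
Context {R : realType}.
Implicit Types f g : R -> R.

Lemma is_derive_quadratic f (x l B : R) :
  (forall y, `|f y - f x - l * (y - x)| <= B * (y - x) ^+ 2) -> is_derive x 1 f l.
Proof.
move=> H.
have B0 : 0 <= B by have := le_trans (normr_ge0 _) (H (x + 1)); rewrite addrAC subrr add0r expr1n mulr1.
suff c : h^-1 *: ((f \o shift x) (h *: 1) - f x) @[h --> 0^'] --> l.
  by apply: DeriveDef; [apply/cvg_ex; exists l|apply/cvg_lim].
apply/cvgrPdist_le => e e0.
have d0 : 0 < e / (B + 1) by rewrite divr_gt0// ltr_wpDl.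
exists (e / (B + 1)) => //= h /=; rewrite sub0r normrN => hd h0.
have h0' : 0 < `|h| by rewrite normr_gt0.
have := H (h + x); rewrite addrK.
rewrite -[h *: 1]/(h * 1) mulr1 /shift -[h^-1 *: _]/(h^-1 * _) => H1.
have -> : l - h^-1 * (f (h + x) - f x) = - (h^-1 * (f (h + x) - f x - l * h)).
  by field.
rewrite normrN normrM normfV ler_pdivrMl//; apply: le_trans H1 _.
have -> : h ^+ 2 = `|h| * `|h| by rewrite -normrM -expr2 ger0_norm// sqr_ge0.
rewrite mulrCA ler_pM2l//.
move: hd; rewrite ltr_pdivlMr ?ltr_wpDl// => hd; apply: le_trans (ltW hd).
by rewrite mulrC ler_wpM2l// lerDl.
Qed.

Lemma mean_value_near f (f' : R -> R) x y : (forall x : R, is_derive x 1 f (f' x)) ->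
  exists2 c, `|c - x| <= `|y - x| & f y - f x = f' c * (y - x).
Proof.
move=> df; have cf := is_derive_continuous df.
case/orP: (le_total x y) => xy.
  have [c] := MVT_segment xy (fun z _ => df z) (continuous_subspaceT cf).
  rewrite in_itv/= => /andP[c1 c2] E; exists c => //.
  by rewrite !ger0_norm ?subr_ge0// lerD2r.
have [c] := MVT_segment xy (fun z _ => df z) (continuous_subspaceT cf).
rewrite in_itv/= => /andP[c1 c2] E; exists c.
  by rewrite !ler0_norm ?subr_le0// lerN2 lerD2r.
by rewrite -opprB E -mulrN opprB.
Qed.

Lemma taylor1 f (f' : R -> R) B x y : (forall x : R, is_derive x 1 f (f' x)) ->
  lip B f' -> `|f y - f x - f' x * (y - x)| <= B * (y - x) ^+ 2.
Proof.
move=> df lf; have [c cx ->] := mean_value_near x y df.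
rewrite -mulrBl normrM.
have -> : (y - x) ^+ 2 = `|y - x| * `|y - x| by rewrite -normrM -expr2 ger0_norm// sqr_ge0.
rewrite mulrA ler_wpM2r//; apply: le_trans (lf _ _) _.
by rewrite ler_wpM2l// (lip_ge0 lf).
Qed.

(** Interpolation: a small function with Lipschitz derivative has small
    derivative, by Taylor's formula with a step h to be chosen according to
    eta. *)
Lemma landau_ineq f (f' : R -> R) B eta x h : (forall x : R, is_derive x 1 f (f' x)) ->
  lip B f' -> (forall x, `|f x| <= eta) -> 0 < h -> `|f' x| * h <= 2 * eta + B * h ^+ 2.
Proof.
move=> df lf fe h0.
have xh : x + h - x = h by ring.
have := taylor1 x (x + h) df lf; rewrite xh => H.
rewrite -[X in _ * X](gtr0_norm h0) -normrM.
have -> : f' x * h = (f (x + h) - f x) - (f (x + h) - f x - f' x * h) by ring.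
apply: le_trans (ler_normB _ _) _; apply: lerD => //.
apply: le_trans (ler_normB _ _) _.
by have := fe x; have := fe (x + h); lra.
Qed.

Lemma is_derive_unique f (x a b : R) : is_derive x 1 f a -> is_derive x 1 f b -> a = b.
Proof.
by move=> [_ <-] [_ <-].
Qed.

Lemma is_derive_comp f (f' : R -> R) g (x b : R) : (forall x : R, is_derive x 1 f (f' x)) ->
  is_derive x 1 g b -> is_derive x 1 (fun y => f (g y)) (f' (g x) * b).
Proof. by move=> df dg; apply: is_derive1_comp. Qed.

Lemma is_derive_shift1 f (f' : R -> R) (x c : R) : (forall x : R, is_derive x 1 f (f' x)) ->
  is_derive x 1 (fun y => f (y + c)) (f' (x + c)).
Proof.
move=> df; have ds : is_derive x 1 (fun y : R => y + c) 1.
  by apply: is_derive_eq; rewrite addr0.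
by have := is_derive_comp df ds; rewrite mulr1.
Qed.

Lemma derive_periodic f (f' : R -> R) : (forall x : R, is_derive x 1 f (f' x)) ->
  periodic f 1 -> periodic f' 1.
Proof.
move=> df pf x; apply: (is_derive_unique _ (df x)).
by apply: is_derive_ext (is_derive_shift1 x 1 df) => y; exact: pf.
Qed.

Lemma is_derive_sum m (F F' : 'I_m -> R -> R) (x : R) : (forall k, is_derive x 1 (F k) (F' k x)) ->
  is_derive x 1 (fun y => \sum_(k < m) F k y) (\sum_(k < m) F' k x).
Proof.
elim: m F F' => [|m IH] F F' dF.
  rewrite big_ord0; apply: (@is_derive_ext _ (cst 0)); first by move=> y; rewrite big_ord0.
rewrite big_ord_recr /=.
apply: (@is_derive_ext _ (fun y => \sum_(k < m) F (widen_ord (leqnSn m) k) y + F ord_max y)).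
  by move=> y; rewrite big_ord_recr.
have H1 := IH (fun k => F (widen_ord (leqnSn m) k)) (fun k => F' (widen_ord (leqnSn m) k)) (fun k => dF _).
have H2 := dF ord_max.
exact: is_deriveD.
Qed.

Lemma is_deriveM1 f g (x a b : R) : is_derive x 1 f a -> is_derive x 1 g b ->
  is_derive x 1 (fun y => f y * g y) (a * g x + f x * b).
Proof.
move=> df dg; apply: is_derive_eq (is_deriveM df dg) _.
by rewrite -![_ *: _]/(_ * _) addrC mulrC.
Qed.

Lemma is_deriveD1 f g (x a b : R) : is_derive x 1 f a -> is_derive x 1 g b ->
  is_derive x 1 (fun y => f y + g y) (a + b).
Proof. by move=> df dg; exact: is_deriveD. Qed.

Lemma is_deriveB1 f g (x a b : R) : is_derive x 1 f a -> is_derive x 1 g b ->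
  is_derive x 1 (fun y => f y - g y) (a - b).
Proof. by move=> df dg; exact: is_deriveB. Qed.

Lemma is_deriveZ1 f (c x a : R) : is_derive x 1 f a -> is_derive x 1 (fun y => c * f y) (c * a).
Proof. by move=> df; exact: is_deriveZ. Qed.

Lemma is_deriveV1 f (x a : R) : f x != 0 -> is_derive x 1 f a ->
  is_derive x 1 (fun y => (f y)^-1) (- a / f x ^+ 2).
Proof.
move=> fx df; apply: is_derive_eq (is_deriveV fx df) _.
by rewrite -[_ *: _]/(_ * _) mulNr mulrC mulNr.
Qed.

Lemma is_deriveX1 f (x a : R) m : is_derive x 1 f a ->
  is_derive x 1 (fun y => f y ^+ m.+1) (m.+1%:R * a * f x ^+ m).
Proof.
move=> df; elim: m => [|m IH].
  by apply: is_derive_eq df _; rewrite expr0 mulr1 mul1r.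
apply: (@is_derive_ext _ (fun y => f y * f y ^+ m.+1)); first by move=> y; rewrite [in RHS]exprS.
apply: is_derive_eq (is_deriveM1 df IH) _.
by rewrite -[m.+2%:R]natr1 !exprS; ring.
Qed.

End derivative_facts.

Section acip_regularity.
Context {R : realType}.
Implicit Types (f g u : R -> R).
Variables (lam D : R).
Hypotheses (lam1 : 1 < lam) (D0 : 0 < D).
Variables (n : nat) (s : R) (T T1 V : R -> R).
Hypothesis HT : expanding_lift lam D n s T T1 V.
Local Notation L := (transfer n T1 V).
Local Notation f0 := (acip n T1 V).

(** Without the absolute value of the transfer operator, sums over branches
    are stable under differentiation: the derivative of the sum of g is the
    sum of g' / T'. *)
Definition branch_sum m (W g : R -> R) x : R := \sum_(k < m) g (W (x + k%:R)).
Local Notation S := (branch_sum n V).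

Lemma transfer_branch_sum sg f x : (forall x, `|T1 x|^-1 = sg / T1 x) ->
  L f x = S (fun y => sg * f y / T1 y) x.
Proof.
by move=> sgE; apply: eq_bigr => k _; rewrite sgE mulrA [f _ * _]mulrC.
Qed.

Lemma is_derive_branch_sum g (g' : R -> R) (x : R) : (forall x : R, is_derive x 1 g (g' x)) ->
  is_derive x 1 (S g) (S (fun y => g' y / T1 y) x).
Proof.
move=> dg.
have dV := is_derive_inv (cl_derive HT) (cl_neq0 HT) (cl_TK HT) (cl_VK HT).
apply: (is_derive_sum (F' := fun k x => g' (V (x + k%:R)) / T1 (V (x + k%:R)))) => k.
have dgV (y : R) : is_derive y 1 (fun z => g (V z)) (g' (V y) / T1 (V y)).
  exact: is_derive_comp dg (dV y).
exact: (is_derive_shift1 x k%:R dgV).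
Qed.

Variables (T2 T3 : R -> R) (M2 M3 : R).
Hypotheses (dT1 : forall x : R, is_derive x 1 T1 (T2 x)) (dT2 : forall x : R, is_derive x 1 T2 (T3 x)).
Hypotheses (T2M : forall x, `|T2 x| <= M2) (T3M : forall x, `|T3 x| <= M3).

(** The fixed points of a |-> (a + M2) / lam and b |-> (b + 3 a M2 + M3 + 3
    M2 ^ 2) / lam, the maps by which the bounds of smooth_cone evolve under
    the transfer operator. *)
Definition log_slope : R := M2 / (lam - 1).
Definition log_curv : R := (3 * log_slope * M2 + M3 + 3 * M2 ^+ 2) / (lam - 1).
Local Notation a := log_slope.
Local Notation b := log_curv.

Let M20 : 0 <= M2. Proof. by apply: le_trans (T2M 0). Qed.
Let M30 : 0 <= M3. Proof. by apply: le_trans (T3M 0). Qed.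
Let l0 : 0 < lam - 1. Proof. by rewrite subr_gt0. Qed.
Let a0 : 0 <= a. Proof. by rewrite /a divr_ge0// ltW. Qed.
Let b0 : 0 <= b.
Proof.
rewrite /b divr_ge0//; last exact: ltW.
have h0 := M30; have h2 := sqr_ge0 M2; have h1 := mulr_ge0 a0 M20; lra.
Qed.

(** The derivatives are bounded relative to f, so that a bound proved on each
    branch adds up to one by the transfer of f itself. *)
Definition smooth_cone f := exists f' f'', [/\ forall x : R, is_derive x 1 f (f' x),
  forall x : R, is_derive x 1 f' (f'' x), forall x, `|f' x| <= a * f x &
  forall x, `|f'' x| <= b * f x].

(** On each branch, with w = 1 / |T'| <= 1 / lam, the derivative is at most
    (a + M2) w ^ 2 f <= a w f; the second derivative is treated in the same
    way. *)
Lemma smooth_cone_transfer f : (forall x, 0 <= f x) -> smooth_cone f -> smooth_cone (L f).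
Proof.
move=> fp [f' [f'' [df df' fa fb]]].
have sgE := lift_sign HT; set sg := s in sgE.
have sg1 : `|sg| = 1 by rewrite /sg; case: (cl_s HT) => ->; rewrite ?normrN1 ?normr1.
have T1n := cl_neq0 HT.
pose g y := sg * f y / T1 y.
(* k1 = g' / T1 and k2 = k1' / T1, the summands of the first two derivatives *)
pose k1 y := sg * (f' y / T1 y ^+ 2 - f y * T2 y / T1 y ^+ 3).
pose k2 y := sg * (f'' y / T1 y ^+ 3 - 3 * f' y * T2 y / T1 y ^+ 4
   - f y * T3 y / T1 y ^+ 4 + 3 * f y * T2 y ^+ 2 / T1 y ^+ 5).
have dg (y : R) : is_derive y 1 g (k1 y * T1 y).
  have Ty := T1n y.
  apply: is_derive_eq (is_deriveM1 (is_deriveZ1 sg (df y)) (is_deriveV1 Ty (dT1 y))) _.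
  by rewrite /k1; field.
have dk (y : R) : is_derive y 1 k1 (k2 y * T1 y).
  have Ty := T1n y; have T2n := expf_neq0 2 Ty; have T3n := expf_neq0 3 Ty.
  have d1 := is_deriveM1 (df' y) (is_deriveV1 (f := fun y => T1 y ^+ 2) T2n (is_deriveX1 1 (dT1 y))).
  have d2 := is_deriveM1 (is_deriveM1 (df y) (dT2 y)) (is_deriveV1 (f := fun y => T1 y ^+ 3) T3n (is_deriveX1 2 (dT1 y))).
  apply: is_derive_eq (is_deriveZ1 sg (is_deriveB1 d1 d2)) _.
  by rewrite /k2; field.
have E1 : L f = S g by apply/funext => x; rewrite (transfer_branch_sum f x sgE).
have lam0 : 0 < lam by have l1 := lam1; lra.
have bE : b * (lam - 1) = 3 * a * M2 + M3 + 3 * M2 ^+ 2.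
  by rewrite /b mulfVK// subr_eq0 gt_eqF.
have aE : a * (lam - 1) = M2 by rewrite /a mulfVK// subr_eq0 gt_eqF.
have pw y : [/\ 0 < `|T1 y|^-1, lam * `|T1 y|^-1 <= 1 & `|T1 y|^-1 <= 1].
  have Ty : 0 < `|T1 y| by rewrite normr_gt0.
  have h := el_expand HT y; split; first by rewrite invr_gt0.
    by rewrite ler_pdivrMr// mul1r.
  by rewrite invf_le1//; have l1 := lam1; lra.
exists (S k1), (S k2); rewrite E1; split.
- move=> x; apply: is_derive_eq (is_derive_branch_sum x dg) _.
  by apply: eq_bigr => k _; rewrite mulfK.
- move=> x; apply: is_derive_eq (is_derive_branch_sum x dk) _.
  by apply: eq_bigr => k _; rewrite mulfK.
- move=> x; rewrite -E1 /transfer /branch_sum mulr_sumr.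
  apply: le_trans (ler_norm_sum _ _ _) _; apply: ler_sum => k _.
  move: (V _) => y; have [w0 w1 w2] := pw y.
  rewrite /k1 normrM sg1 mul1r; apply: le_trans (ler_normB _ _) _.
  rewrite !normrM !normfV !normrX (ger0_norm (fp y)) -!exprVn.
  have := fa y; have := fp y; have := T2M y.
  move: (`|T1 y|^-1) w0 w1 w2 (`|f' y|) (normr_ge0 (f' y)) (f y) (`|T2 y|) (normr_ge0 (T2 y)) => w w0 w1 w2 p p0 F q q0 qM F0 pF.
  have h1 : p * w ^+ 2 <= a * F * w ^+ 2 by rewrite ler_wpM2r ?sqr_ge0.
  have h2 : F * q * w ^+ 3 <= F * M2 * w ^+ 2.
    have : w ^+ 3 <= w ^+ 2 by rewrite [leLHS]exprS ler_piMl// sqr_ge0.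
    have := sqr_ge0 w; rewrite -[w ^+ 3]/(w ^+ 3).
    move=> ww0 ww; apply: ler_pM; [by rewrite mulr_ge0|by rewrite exprn_ge0// ltW| |exact: ww].
    by rewrite ler_wpM2l.
  have -> : a * (F * w) = a * F * w by ring.
  have h3 : (a + M2) * F * w ^+ 2 <= a * F * w.
    have -> : (a + M2) * F * w ^+ 2 = a * F * w * (lam * w) by rewrite -aE; ring.
    by apply: ler_piMr; [apply: mulr_ge0; [exact: mulr_ge0|exact: ltW]|exact: w1].
  by apply: le_trans h3; lra.
- move=> x; rewrite -E1 /transfer /branch_sum mulr_sumr.
  apply: le_trans (ler_norm_sum _ _ _) _; apply: ler_sum => k _.
  move: (V _) => y; have [w0 w1 w2] := pw y.
  rewrite /k2 normrM sg1 mul1r.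
  apply: (@le_trans _ _ (`|f'' y| * `|T1 y|^-1 ^+ 3 + 3 * `|f' y| * `|T2 y| * `|T1 y|^-1 ^+ 4
     + f y * `|T3 y| * `|T1 y|^-1 ^+ 4 + 3 * f y * `|T2 y| ^+ 2 * `|T1 y|^-1 ^+ 5)).
    apply: le_trans (ler_normD _ _) _; rewrite lerD//; last first.
      by rewrite !normrM !normfV !normrX (ger0_norm (fp y)) -!exprVn gtr0_norm.
    apply: le_trans (ler_normB _ _) _; rewrite lerD//; last first.
      by rewrite !normrM !normfV !normrX (ger0_norm (fp y)) -!exprVn.
    apply: le_trans (ler_normB _ _) _; rewrite lerD//.
      by rewrite !normrM !normfV !normrX -!exprVn.
    by rewrite !normrM !normfV !normrX -!exprVn gtr0_norm.
  have := fa y; have := fb y; have := fp y; have := T2M y; have := T3M y.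
  move: (`|T1 y|^-1) w0 w1 w2 (`|f' y|) (normr_ge0 (f' y)) (f y) (`|T2 y|) (normr_ge0 (T2 y)) => w w0 w1 w2 p p0 F q q0.
  move: (`|T3 y|) (normr_ge0 (T3 y)) (`|f'' y|) (normr_ge0 (f'' y)) => r r0 p2 p20 rM qM F0 p2F pF.
  have wn j : w ^+ (j + 2) <= w ^+ 2.
    by rewrite exprD ler_piMl ?sqr_ge0// exprn_ile1// ltW.
  have w20 := sqr_ge0 w.
  have key (X Y : R) j : 0 <= X -> X <= Y -> X * w ^+ (j + 2) <= Y * w ^+ 2.
    by move=> X0 XY; apply: ler_pM; [|rewrite exprn_ge0// ltW| |exact: wn].
  have h1 : p2 * w ^+ 3 <= b * F * w ^+ 2 by apply: (key _ _ 1%N).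
  have h2 : 3 * p * q * w ^+ 4 <= 3 * (a * F) * M2 * w ^+ 2.
    apply: (key _ _ 2%N); first by rewrite mulr_ge0 ?mulr_ge0.
    by apply: ler_pM; rewrite ?mulr_ge0//; rewrite ler_pM2l.
  have h3 : F * r * w ^+ 4 <= F * M3 * w ^+ 2.
    by apply: (key _ _ 2%N); [exact: mulr_ge0|rewrite ler_wpM2l].
  have h4 : 3 * F * q ^+ 2 * w ^+ 5 <= 3 * F * M2 ^+ 2 * w ^+ 2.
    apply: (key _ _ 3%N); first by rewrite mulr_ge0 ?mulr_ge0 ?sqr_ge0.
    apply: ler_wpM2l; first by rewrite mulr_ge0.
    by rewrite !expr2 ler_pM.
  have -> : b * (F * w) = b * F * w by ring.
  have h5 : (b + (3 * a * M2 + M3 + 3 * M2 ^+ 2)) * F * w ^+ 2 <= b * F * w.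
    rewrite -bE; have -> : (b + b * (lam - 1)) * F * w ^+ 2 = b * F * w * (lam * w) by ring.
    by apply: ler_piMr; [apply: mulr_ge0; [exact: mulr_ge0|exact: ltW]|exact: w1].
  by apply: le_trans h5; lra.
Qed.

Definition smooth_bound : R := log_curv * cone_max lam D.

Lemma iter_smooth_cone N : smooth_cone (iter N L (fun=> 1)).
Proof.
elim: N => [|N IH].
  exists (fun=> 0), (fun=> 0); split => [x|x|x|x]; rewrite ?normr0 ?mulr1//=.
    exact: (@is_derive_cst _ _ _ (1 : R) x 1).
  exact: (@is_derive_cst _ _ _ (0 : R) x 1).
rewrite iterS; apply: smooth_cone_transfer => // x.
have [c1 i1] := cone_one lam1 D0.
by have [[_ h _] _] := cone_iter_in lam1 D0 HT N c1 i1; exact: ltW.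
Qed.

(** The functions L ^ N 1 form a Cauchy sequence at rate q ^ N and their
    derivatives are uniformly Lipschitz, so by landau_ineq with step r ^ N,
    r = sqrt q, the derivatives converge at rate r ^ N.  Passing to the limit
    in Taylor's inequality shows that their limit is the derivative of f0. *)
Lemma acip_C11 : exists f' : R -> R, [/\ forall x : R, is_derive x 1 f0 (f' x),
  lip smooth_bound f' & periodic f' 1].
Proof.
have [c1 i1] := cone_one lam1 D0.
have slope0 : 0 <= cone_slope lam D.
  by rewrite /cone_slope divr_ge0 ?mulr_ge0 ?ltW.
have [F' HF'] := choice (fun N => iter_smooth_cone N).
have dF N (x : R) : is_derive x 1 (iter N L (fun=> 1)) (F' N x).
  by have [f'' [h _ _ _]] := HF' N; exact: h.
have lF N : lip smooth_bound (F' N).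
  have [f'' [_ h _ h']] := HF' N; apply: (is_derive_lip h) => x.
  apply: le_trans (h' x) _; rewrite ler_wpM2l//.
  have [c i] := cone_iter_in lam1 D0 HT N c1 i1.
  by have /andP[] := cone_bounds slope0 c i x.
have B0 : 0 <= smooth_bound := lip_ge0 (lF 0%N).
have /andP[q0 q1] := decay_rate01 lam1 D0; set q := decay_rate lam D in q0 q1.
pose r := Num.sqrt q; have r0 : 0 <= r by exact: sqrtr_ge0.
have rq : r ^+ 2 = q by rewrite sqr_sqrtr.
have r1 : r < 1 by rewrite -sqrtr1 ltr_sqrt.
have r01 : 0 <= r < 1 by rewrite r0 r1.
pose C := 2 * cone_max lam D + 2 * smooth_bound.
have m0 : 0 <= cone_max lam D by exact: expR_ge0.
have qr N : q ^+ N = r ^+ N * r ^+ N by rewrite -exprMn -expr2 rq.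
have rgt0 : 0 < r by rewrite sqrtr_gt0; exact: decay_rate_gt0.
have cauchy x N k : `|F' (N + k)%N x - F' N x| <= C * r ^+ N.
  have rN : 0 < r ^+ N by rewrite exprn_gt0.
  pose u y := iter (N + k) L (fun=> 1) y - iter N L (fun=> 1) y.
  pose u' y := F' (N + k)%N y - F' N y.
  have du (y : R) : is_derive y 1 u (u' y) by exact: is_deriveB1.
  have lu : lip (2 * smooth_bound) u'.
    move=> y z; have -> : u' y - u' z = (F' (N + k)%N y - F' (N + k)%N z) - (F' N y - F' N z).
      by rewrite /u'; ring.
    apply: le_trans (ler_normB _ _) _.
    by have := lF (N + k)%N y z; have := lF N y z; lra.
  have := landau_ineq x du lu (iter_one_cauchy lam1 D0 HT N k) rN.
  rewrite -/q qr => H; rewrite -(ler_pM2r rN); apply: le_trans H _.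
  by rewrite le_eqVlt; apply/orP; left; apply/eqP; rewrite /C expr2; ring.
have lim_ex x : exists l : R, (F' N x @[N --> \oo] --> l) /\ forall N, `|F' N x - l| <= C * r ^+ N.
  by have [l h1 h2] := geometric_cvg r01 (cauchy x); exists l.
have [f' Hf'] := choice lim_ex.
have lf' : lip smooth_bound f'.
  move=> x y; rewrite -subr_le0; apply: (geometric_le0 (C := 2 * C) r01) => N.
  have [_ hx] := Hf' x; have [_ hy] := Hf' y.
  have -> : f' x - f' y = (F' N x - F' N y) - (F' N x - f' x) + (F' N y - f' y) by ring.
  have := hx N; have := hy N; have := lF N x y.
  move=> h1 h2 h3; apply: le_trans (lerB (le_trans (ler_normD _ _) (lerD (ler_normB _ _) (lexx _))) (lexx _)) _.
  lra.
have df (x : R) : is_derive x 1 f0 (f' x).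
  apply: (is_derive_quadratic (B := smooth_bound)) => y.
  rewrite -subr_le0; apply: (geometric_le0 (C := 2 * cone_max lam D + C * `|y - x|) r01) => N.
  have h1 := taylor1 x y (dF N) (lF N).
  have hx := acip_approx lam1 D0 HT N x; have hy := acip_approx lam1 D0 HT N y.
  have [_ /(_ N) h2] := Hf' x.
  have qrN : cone_max lam D * q ^+ N <= cone_max lam D * r ^+ N.
    by rewrite ler_wpM2l// qr ler_piMl// ?exprn_ge0// exprn_ile1// ltW.
  set fx := iter N L (fun=> 1) x in h1 hx *; set fy := iter N L (fun=> 1) y in h1 hy *.
  have -> : f0 y - f0 x - f' x * (y - x) = (fy - fx - F' N x * (y - x)) - (fy - f0 y) + (fx - f0 x)
     + (F' N x - f' x) * (y - x) by ring.
  have h4 : `|(F' N x - f' x) * (y - x)| <= C * r ^+ N * `|y - x| by rewrite normrM ler_wpM2r.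
  have t1 := ler_normD (fy - fx - F' N x * (y - x) - (fy - f0 y) + (fx - f0 x)) ((F' N x - f' x) * (y - x)).
  have t2 := ler_normD (fy - fx - F' N x * (y - x) - (fy - f0 y)) (fx - f0 x).
  have t3 := ler_normB (fy - fx - F' N x * (y - x)) (fy - f0 y).
  rewrite -/q in hx hy; lra.
exists f'; split => //.
by apply: derive_periodic df _; have [] := acip_cone lam1 D0 HT.
Qed.

End acip_regularity.

(** * Lifts of expanding maps and the resolvent *)

Section lift_construction.
Context {R : realType}.
Implicit Types (f g : R -> R).

(** T is injective by the mean value theorem, and onto by the intermediate
    value theorem since T (x + k s) = T x + k n is unbounded in both
    directions. *)
Lemma lift_exists n s (T T1 : R -> R) lam : (forall x : R, is_derive x 1 T (T1 x)) ->
  continuous T1 -> 0 < lam -> (forall x, lam <= `|T1 x|) ->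
  (forall x, T (x + s) = T x + n%:R) -> s = 1 \/ s = -1 -> periodic T1 1 -> (0 < n)%N ->
  exists V, circle_lift n s T T1 V.
Proof.
move=> dT cT1 lam0 lamT Ts s1 pT1 n0.
have T1n x : T1 x != 0.
  by apply/eqP => h; have := lamT x; rewrite h normr0 leNgt lam0.
have cT := is_derive_continuous dT.
have injT : injective T.
  move=> x y xy; have [c E] := mean_value y x dT.
  move/eqP: E; rewrite xy subrr eq_sym mulf_eq0 (negPf (T1n c)) subr_eq0 /=.
  by move/eqP.
have Tk (k : nat) x : T (x + k%:R * s) = T x + k%:R * n%:R.
  elim: k => [|k IH]; first by rewrite !mul0r !addr0.
  by rewrite -natr1 !mulrDl !mul1r !addrA Ts IH.
have Tk' (k : nat) x : T (x - k%:R * s) = T x - k%:R * n%:R.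
  by have := Tk k (x - k%:R * s); rewrite subrK => ->; rewrite addrK.
have surT y : exists x, T x = y.
  have [k hk] : exists k : nat, `|y - T 0| <= k%:R.
    by exists (Num.truncn `|y - T 0|).+1; exact: ltW (truncnS_gt _).
  have kn : k%:R <= k%:R * n%:R :> R by rewrite ler_peMr// ler1n.
  have h1 : T (0 - k%:R * s) <= y.
    by rewrite Tk'; move: hk; rewrite ler_norml => /andP[]; lra.
  have h2 : y <= T (0 + k%:R * s).
    by rewrite Tk; move: hk; rewrite ler_norml => /andP[]; lra.
  have cw u v : {within `[u, v], continuous T} by exact: continuous_subspaceT.
  case/orP: (le_total (0 - k%:R * s) (0 + k%:R * s)) => h.
    have [|c _ E] := IVT h (cw _ _) (v := y); last by exists c.
    by rewrite ge_min le_max h1 h2 orbT.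
  have [|c _ E] := IVT h (cw _ _) (v := y); last by exists c.
  by rewrite ge_min le_max h1 h2 orbT.
have [V HV] := choice surT.
by exists V; split => // x; apply: injT; rewrite HV.
Qed.

(** The degree is not 0, as a periodic T would have a critical point. *)
Lemma lift_degree (T T1 : R -> R) lam (d : int) : (forall x : R, is_derive x 1 T (T1 x)) ->
  0 < lam -> (forall x, lam <= `|T1 x|) -> (forall x, T (x + 1) = T x + d%:~R) ->
  exists n s, [/\ (0 < n)%N, s = 1 \/ s = -1 :> R, forall x, T (x + s) = T x + n%:R &
   d%:~R = s * n%:R].
Proof.
move=> dT lam0 lamT Td.
have d0 : d != 0.
  apply/eqP => d0; have [c E] := mean_value 0 1 dT.
  have := lamT c; have := Td 0; rewrite add0r => E2; move: E.
  rewrite E2 d0 addr0 subrr subr0 mulr1 => <-.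
  by rewrite normr0 leNgt lam0.
case: d Td d0 => k Td k0.
  exists k, 1; split; [by rewrite lt0n|by left|by move=> x; rewrite Td -pmulrn|by rewrite mul1r -pmulrn].
exists k.+1, (-1); split => //; first by right.
  by move=> x; have := Td (x - 1); rewrite subrK => ->; rewrite NegzE mulrNz -pmulrn subrK.
by rewrite NegzE mulrNz -pmulrn mulN1r.
Qed.

(** Since |T1| >= 1, an increment of |T1| is also a bound for its relative
    increment. *)
Lemma distortion_bound (T1 T2 : R -> R) lam M : (forall x : R, is_derive x 1 T1 (T2 x)) ->
  1 < lam -> (forall x, lam <= `|T1 x|) -> (forall x, `|T2 x| <= M) ->
  forall x y, `|T1 y| <= expR (M * `|x - y|) * `|T1 x|.
Proof.
move=> dT1 lam1 lamT T2M x y.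
have lT1 := is_derive_lip dT1 T2M.
have M0 := lip_ge0 lT1.
have h1 : `|T1 y| <= `|T1 x| + M * `|x - y|.
  have -> : T1 y = T1 x - (T1 x - T1 y) by ring.
  by apply: le_trans (ler_normB _ _) _; rewrite lerD2l.
have h2 := expR_ge1Dx (M * `|x - y|).
have h3 : (1 + M * `|x - y|) * `|T1 x| <= expR (M * `|x - y|) * `|T1 x| by rewrite ler_wpM2r.
apply: le_trans h3; apply: le_trans h1 _; rewrite mulrDl mul1r lerD2l.
rewrite ler_peMr ?mulr_ge0//; apply: le_trans (lamT x); exact: ltW.
Qed.

End lift_construction.

Section lip_bounded.
Context {R : realType}.
Implicit Types (f g u v : R -> R).

(** Bounded Lipschitz functions form an algebra, closed under the inverse of
    functions bounded below by 1.  They serve as coefficients of asymptotic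
    expansions, where constants need not be tracked. *)
Definition LB f := exists C, (forall x, `|f x| <= C) /\ lip C f.

Lemma LB_intro A B f : (forall x, `|f x| <= A) -> lip B f -> LB f.
Proof.
move=> fA fB; exists (Num.max A B); split => [x|x y].
  by rewrite le_max fA.
by apply: le_trans (fB x y) _; rewrite ler_wpM2r// le_max lexx orbT.
Qed.

Lemma LB_bound f : LB f -> exists2 C, 0 <= C & forall x, `|f x| <= C.
Proof. by move=> [C [h1 h2]]; exists C => //; exact: lip_ge0 h2. Qed.

Lemma LB_lip f : LB f -> exists2 C, 0 <= C & lip C f.
Proof. by move=> [C [h1 h2]]; exists C => //; exact: lip_ge0 h2. Qed.

Lemma LB_cst c : LB (fun=> c).
Proof.
by apply: (@LB_intro `|c| 0) => // x y; rewrite subrr normr0 mul0r.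
Qed.

Lemma LBD f g : LB f -> LB g -> LB (fun x => f x + g x).
Proof.
move=> [A [fA fA']] [B [gB gB']]; exists (A + B); split => [x|x y].
  by apply: le_trans (ler_normD _ _) _; exact: lerD.
have -> : f x + g x - (f y + g y) = (f x - f y) + (g x - g y) by ring.
by apply: le_trans (ler_normD _ _) _; rewrite mulrDl lerD.
Qed.

Lemma lipM A B K K' f g : (forall x, `|f x| <= A) -> (forall x, `|g x| <= B) ->
  lip K f -> lip K' g -> lip (A * K' + K * B) (fun x => f x * g x).
Proof.
move=> fA gB fK gK x y.
have -> : f x * g x - f y * g y = f x * (g x - g y) + (f x - f y) * g y by ring.
apply: le_trans (ler_normD _ _) _; rewrite !normrM mulrDl; apply: lerD.
  by rewrite -mulrA; apply: ler_pM.
by rewrite mulrAC; apply: ler_pM.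
Qed.

Lemma LBM f g : LB f -> LB g -> LB (fun x => f x * g x).
Proof.
move=> [A [fA fA']] [B [gB gB']].
apply: (@LB_intro (A * B) (A * B + A * B)) => [x|].
  by rewrite normrM ler_pM.
exact: lipM.
Qed.

Lemma LBZ c f : LB f -> LB (fun x => c * f x).
Proof. by move=> hf; apply: LBM => //; exact: LB_cst. Qed.

Lemma LBB f g : LB f -> LB g -> LB (fun x => f x - g x).
Proof.
move=> hf /(LBZ (-1)) hg; have := LBD hf hg.
by congr LB; apply/funext => x; rewrite mulN1r.
Qed.

Lemma LBV f : (forall x, 1 <= `|f x|) -> LB f -> LB (fun x => (f x)^-1).
Proof.
move=> f1 [A [fA fA']]; apply: (@LB_intro 1 A) => [x|x y].
  by rewrite normfV invf_le1// (lt_le_trans ltr01).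
have fn z : f z != 0 by rewrite -normr_gt0 (lt_le_trans ltr01).
have -> : (f x)^-1 - (f y)^-1 = - ((f x - f y) * ((f x)^-1 * (f y)^-1)).
  by field; rewrite !fn.
rewrite normrN !normrM; apply: le_trans _ (fA' x y).
rewrite ler_piMr// mulr_ile1// normfV invf_le1// (lt_le_trans ltr01)//.
Qed.

Lemma LB_derive f (f' : R -> R) : (forall x : R, is_derive x 1 f (f' x)) ->
  continuous f' -> periodic f 1 -> LB f.
Proof.
move=> df cf' pf.
have [A _ fA] := continuous_periodic_bounded (is_derive_continuous df) pf.
have [B _ fB] := continuous_periodic_bounded cf' (derive_periodic df pf).
exact: LB_intro fA (is_derive_lip df fB).
Qed.

End lip_bounded.

Section resolvent.
Context {R : realType}.
Implicit Types (f g w z e : R -> R).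

Lemma geometric_series (u : nat -> R) A q : 0 <= q < 1 -> (forall j, `|u j| <= A * q ^+ j) ->
  exists2 l, \sum_(j < N) u j @[N --> \oo] --> l &
    forall N, `|\sum_(j < N) u j - l| <= A / (1 - q) * q ^+ N.
Proof.
move=> q01 uA; have /andP[q0 q1] := q01; have q1' : 0 < 1 - q by rewrite subr_gt0.
have A0 : 0 <= A by have := le_trans (normr_ge0 _) (uA 0%N); rewrite expr0 mulr1.
apply: geometric_cvg => // N k.
suff H : `|\sum_(j < N + k) u j - \sum_(j < N) u j| <= A / (1 - q) * q ^+ N * (1 - q ^+ k).
  apply: le_trans H _; rewrite ler_piMr//; last by rewrite gerBl exprn_ge0.
  by rewrite mulr_ge0 ?exprn_ge0// divr_ge0// ltW.
elim: k => [|k IH]; first by rewrite addn0 subrr normr0 expr0 subrr mulr0.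
rewrite addnS big_ord_recr /= addrAC.
apply: le_trans (ler_normD _ _) _; apply: le_trans (lerD IH (uA _)) _.
rewrite le_eqVlt; apply/orP; left; apply/eqP; rewrite exprD exprS; field.
by rewrite gt_eqF.
Qed.

Variables (lam D : R).
Hypotheses (lam1 : 1 < lam) (D0 : 0 < D).
Variables (n : nat) (s : R) (T T1 V : R -> R).
Hypothesis HT : expanding_lift lam D n s T T1 V.
Local Notation L := (transfer n T1 V).
Local Notation q := (decay_rate lam D).
Local Notation C := (decay_cst lam D).

(** The Neumann series of (I - L)^-1, convergent on zero-mean Lipschitz
    functions. *)
Definition resolvent w x : R := lim (\sum_(j < N) iter j L w x @[N --> \oo]).

Definition resolvent_cst : R := C / (1 - q).

Let q1' : 0 < 1 - q. Proof. by rewrite subr_gt0; case/andP: (decay_rate01 lam1 D0). Qed.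

Lemma resolvent_cst_ge0 : 0 <= resolvent_cst.
Proof. by rewrite /resolvent_cst divr_ge0 ?ltW// (decay_cst_gt0 lam1 D0). Qed.

Section one_function.
Variables (w : R -> R) (M : R).
Hypotheses (M0 : 0 < M) (pw : periodic w 1) (wM : lip M w) (w0 : circle_int w = 0).

Let wd j x : `|iter j L w x| <= C * M * q ^+ j.
Proof. by have [h _] := transfer_decay lam1 D0 HT j M0 pw wM w0; exact: h. Qed.

Lemma resolvent_cvg x : \sum_(j < N) iter j L w x @[N --> \oo] --> resolvent w x.
Proof.
have [l + _] := geometric_series (decay_rate01 lam1 D0) (fun j => wd j x).
by move=> cl; rewrite /resolvent (cvg_lim _ cl).
Qed.

Lemma resolvent_approx N x :
  `|\sum_(j < N) iter j L w x - resolvent w x| <= resolvent_cst * M * q ^+ N.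
Proof.
have [l cl +] := geometric_series (decay_rate01 lam1 D0) (fun j => wd j x).
move=> /(_ N); rewrite /resolvent (cvg_lim _ cl)//.
by have -> : resolvent_cst * M = C * M / (1 - q) by rewrite /resolvent_cst mulrAC.
Qed.

Lemma resolvent_bound x : `|resolvent w x| <= resolvent_cst * M.
Proof. by have := resolvent_approx 0 x; rewrite big_ord0 sub0r normrN expr0 mulr1. Qed.

Lemma geometric_sum_le N : \sum_(j < N) C * M * q ^+ j <= resolvent_cst * M.
Proof.
have /andP[q0 _] := decay_rate01 lam1 D0.
suff -> : \sum_(j < N) C * M * q ^+ j = resolvent_cst * M * (1 - q ^+ N).
  rewrite ler_piMr ?gerBl ?exprn_ge0// mulr_ge0 ?resolvent_cst_ge0// ltW//.
elim: N => [|N IH]; first by rewrite big_ord0 expr0 subrr mulr0.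
rewrite big_ord_recr /= IH /resolvent_cst exprS; field.
by rewrite gt_eqF.
Qed.

(** The decay of the Lipschitz constants of L ^ j w is summable too, so the
    resolvent does not lose regularity. *)
Lemma resolvent_lip : lip (resolvent_cst * M) (resolvent w).
Proof.
have lN N : lip (resolvent_cst * M) (fun x => \sum_(j < N) iter j L w x).
  move=> x y; rewrite -sumrB.
  apply: le_trans (ler_norm_sum _ _ _) _.
  apply: (@le_trans _ _ (\sum_(j < N) C * M * q ^+ j * `|x - y|)).
    apply: ler_sum => j _.
    by have [_ h] := transfer_decay lam1 D0 HT j M0 pw wM w0; exact: h.
  by rewrite -mulr_suml ler_wpM2r// geometric_sum_le.
move=> x y; rewrite -subr_le0.
apply: (geometric_le0 (C := 2 * (resolvent_cst * M)) (decay_rate01 lam1 D0)) => N.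
have h1 := resolvent_approx N x; have h2 := resolvent_approx N y; have h3 := lN N x y.
set a := \sum_(j < N) iter j L w x in h1 h3; set b := \sum_(j < N) iter j L w y in h2 h3.
have -> : resolvent w x - resolvent w y = (a - b) - (a - resolvent w x) + (b - resolvent w y) by ring.
have t1 := ler_normD ((a - b) - (a - resolvent w x)) (b - resolvent w y).
have t2 := ler_normB (a - b) (a - resolvent w x).
lra.
Qed.

Lemma resolvent_periodic : periodic (resolvent w) 1.
Proof.
move=> x; rewrite /resolvent.
have -> // : (fun N => \sum_(j < N) iter j L w (x + 1)) = fun N => \sum_(j < N) iter j L w x.
apply/funext => N; apply: eq_bigr => j _.
exact: (iter_transfer_periodic HT).
Qed.

Lemma partial_continuous N : continuous (fun x => \sum_(j < N) iter j L w x).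
Proof.
apply: (cont_sum (F := fun (j : 'I_N) x => iter j L w x)) => j.
by apply: (iter_transfer_continuous HT); exact: lip_continuous wM.
Qed.

Lemma partial_int N : circle_int (fun x => \sum_(j < N) iter j L w x) = 0.
Proof.
have cw := lip_continuous wM.
elim: N => [|N IH].
  rewrite (_ : (fun x => _) = fun=> 0); first exact: circle_int_cst.
  by apply/funext => x; rewrite big_ord0.
rewrite (_ : (fun x => _) = fun x => \sum_(j < N) iter j L w x + iter N L w x); last first.
  by apply/funext => x; rewrite big_ord_recr.
rewrite circle_intD//; [|exact: partial_continuous|exact: iter_transfer_continuous HT _ _ cw].
rewrite IH add0r; elim: {IH}N => [//|N IH]; rewrite iterS (circle_int_transfer HT)//.
  exact: iter_transfer_continuous HT _ _ cw.
exact: iter_transfer_periodic HT _ _ pw.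
Qed.

Lemma resolvent_int : circle_int (resolvent w) = 0.
Proof.
have cr := lip_continuous resolvent_lip.
apply/eqP; rewrite -normr_le0.
apply: (geometric_le0 (C := resolvent_cst * M) (decay_rate01 lam1 D0)) => N.
rewrite -[circle_int _]subr0 -(partial_int N) -circle_intB//; last exact: partial_continuous.
apply: circle_int_norm => [x|x].
  by apply: cvgB; [exact: cr|exact: partial_continuous].
by rewrite distrC; exact: resolvent_approx.
Qed.

Lemma transfer_sum N (F : 'I_N -> R -> R) x :
  L (fun x => \sum_(j < N) F j x) x = \sum_(j < N) L (F j) x.
Proof.
by rewrite /transfer exchange_big /=; apply: eq_bigr => k _; rewrite mulr_suml.
Qed.

Lemma resolvent_eq x : resolvent w x = w x + L (resolvent w) x.
Proof.
apply/eqP; rewrite -subr_eq0 -normr_le0.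
apply: (geometric_le0 (C := (1 + cone_max lam D) * (resolvent_cst * M)) (decay_rate01 lam1 D0)) => N.
have /andP[q0 q1] := decay_rate01 lam1 D0.
have h1 := resolvent_approx N.+1 x.
have h2 : `|L (fun x => \sum_(j < N) iter j L w x - resolvent w x) x| <=
    cone_max lam D * (resolvent_cst * M * q ^+ N).
  exact: (iter_transfer_bound lam1 D0 HT 1 (resolvent_approx N)).
rewrite transferB transfer_sum in h2.
have E : \sum_(j < N.+1) iter j L w x = w x + \sum_(j < N) L (iter j L w) x.
  by rewrite big_ord_recl.
rewrite E in h1; set a := \sum_(j < N) _ in h1 h2.
have h3 : resolvent_cst * M * q ^+ N.+1 <= resolvent_cst * M * q ^+ N.
  apply: ler_wpM2l; first by rewrite mulr_ge0 ?resolvent_cst_ge0// ltW.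
  by rewrite exprS ler_piMl ?exprn_ge0// ltW.
have -> : resolvent w x - (w x + L (resolvent w) x) =
  (a - L (resolvent w) x) - (w x + a - resolvent w x) by ring.
apply: le_trans (ler_normB _ _) _; lra.
Qed.

End one_function.

Lemma resolvent_linear a b w1 w2 M1 M2 : 0 < M1 -> periodic w1 1 -> lip M1 w1 -> circle_int w1 = 0 ->
  0 < M2 -> periodic w2 1 -> lip M2 w2 -> circle_int w2 = 0 ->
  forall x, resolvent (fun x => a * w1 x + b * w2 x) x = a * resolvent w1 x + b * resolvent w2 x.
Proof.
move=> M10 p1 l1 i1 M20 p2 l2 i2 x.
apply: cvg_lim => //.
have c1 : \sum_(j < N) iter j L w1 x @[N --> \oo] --> resolvent w1 x.
  by apply: (resolvent_cvg M10 p1 l1 i1).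
have c2 : \sum_(j < N) iter j L w2 x @[N --> \oo] --> resolvent w2 x.
  by apply: (resolvent_cvg M20 p2 l2 i2).
rewrite (_ : (fun N => _) = fun N => a * \sum_(j < N) iter j L w1 x + b * \sum_(j < N) iter j L w2 x).
  by apply: cvgD; apply: cvgM => //; exact: cvg_cst.
apply/funext => N; rewrite !mulr_sumr -big_split; apply: eq_bigr => j _ /=.
have iterD f g t : iter j L (fun x => f x + g x) t = iter j L f t + iter j L g t.
  elim: (nat_of_ord j) t => [//|k IH] t; rewrite !iterS -transferD; congr (L _ t); exact/funext.
by rewrite (iterD (fun x => a * w1 x)) !iter_transferZ.
Qed.

(** z is the resolvent of e, but resolvent_bound only sees the Lipschitz
    constant of e.  Cutting the series at m makes use of a small sup norm: the
    first m terms are of the order of eta, and the tail is of the order of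
    M q ^ m.  So z is small when e is uniformly small and Lipschitz with a
    fixed constant. *)
Lemma fixed_point_bound z e Z M eta m : 0 < Z -> periodic z 1 -> lip Z z -> circle_int z = 0 ->
  0 < M -> periodic e 1 -> lip M e -> circle_int e = 0 -> (forall x, `|e x| <= eta) ->
  (forall x, z x = L z x + e x) ->
  forall x, `|z x| <= m%:R * (cone_max lam D * eta) + resolvent_cst * M * q ^+ m.
Proof.
move=> Z0 pz lz iz M0 pe le ie eB ze x.
have /andP[q0 q1] := decay_rate01 lam1 D0.
have zN N y : z y = iter N L z y + \sum_(j < N) iter j L e y.
  elim: N y => [|N IH] y; first by rewrite big_ord0 addr0.
  rewrite big_ord_recl /= -(transfer_sum (fun j => iter j L e)).
  rewrite addrCA -transferD addrC [LHS]ze; congr (_ + _).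
  by congr (L _ y); apply/funext => t; exact: IH.
rewrite -subr_le0; apply: (geometric_le0 (C := C * Z) (decay_rate01 lam1 D0)) => N.
have [h1 _] := transfer_decay lam1 D0 HT (m + N) Z0 pz lz iz.
have {}h1 : `|iter (m + N) L z x| <= C * Z * q ^+ N.
  apply: le_trans (h1 x) _.
  apply: ler_wpM2l; first by apply: mulr_ge0; apply: ltW => //; exact: decay_cst_gt0.
  by rewrite exprD ler_piMl ?exprn_ge0// exprn_ile1// ltW.
have h2 : `|\sum_(j < m) iter j L e x| <= m%:R * (cone_max lam D * eta).
  apply: le_trans (ler_norm_sum _ _ _) _.
  apply: (@le_trans _ _ (\sum_(j < m) cone_max lam D * eta)).
    by apply: ler_sum => j _; exact: (iter_transfer_bound lam1 D0 HT j eB).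
  by rewrite sumr_const card_ord mulr_natl.
have h3 : `|\sum_(j < N) iter (m + j) L e x| <= resolvent_cst * M * q ^+ m.
  apply: le_trans (ler_norm_sum _ _ _) _.
  apply: (@le_trans _ _ (\sum_(j < N) C * M * q ^+ j * q ^+ m)).
    apply: ler_sum => j _; have [h _] := transfer_decay lam1 D0 HT (m + j) M0 pe le ie.
    by apply: le_trans (h x) _; rewrite exprD mulrA mulrAC.
  by rewrite -mulr_suml ler_wpM2r ?exprn_ge0//; exact: geometric_sum_le.
rewrite (zN (m + N)%N x) big_split_ord /=.
have t1 := ler_normD (iter (m + N) L z x) (\sum_(j < m) iter j L e x + \sum_(j < N) iter (m + j) L e x).
have t2 := ler_normD (\sum_(j < m) iter j L e x) (\sum_(j < N) iter (m + j) L e x).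
lra.
Qed.

End resolvent.

(** * First-order expansion under a perturbation *)

Section unifO_calculus.
Context {R : realType}.
Variable d1 : R.
Hypothesis d1_le1 : d1 <= 1.
Implicit Types (E F W : R -> R -> R) (f g : R -> R).

Definition unifO k E := exists2 C, 0 <= C & forall d x, 0 < d < d1 -> `|E d x| <= C * d ^+ k.

Lemma unifO_ext k E F : (forall d x, 0 < d < d1 -> E d x = F d x) -> unifO k E -> unifO k F.
Proof. by move=> EF [C C0 H]; exists C => // d x dd; rewrite -EF//; exact: H. Qed.

Lemma unifO_weak k l E : (l <= k)%N -> unifO k E -> unifO l E.
Proof.
move=> lk [C C0 H]; exists C => // d x /[dup] dd /andP[d0 dd1]; apply: le_trans (H _ _ dd) _.
rewrite ler_wpM2l// -(subnKC lk) exprD; apply: ler_piMr; first by rewrite exprn_ge0// ltW.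
by apply: exprn_ile1; [exact: ltW|apply: ltW; exact: lt_le_trans d1_le1].
Qed.

Lemma unifOD k E F : unifO k E -> unifO k F -> unifO k (fun d x => E d x + F d x).
Proof.
move=> [A A0 HA] [B B0 HB]; exists (A + B); first exact: addr_ge0.
by move=> d x dd; apply: le_trans (ler_normD _ _) _; rewrite mulrDl lerD ?HA ?HB.
Qed.

Lemma unifON k E : unifO k E -> unifO k (fun d x => - E d x).
Proof. by move=> [A A0 HA]; exists A => // d x dd; rewrite normrN HA. Qed.

Lemma unifOB k E F : unifO k E -> unifO k F -> unifO k (fun d x => E d x - F d x).
Proof. by move=> hE hF; apply: unifOD => //; exact: unifON. Qed.

Lemma unifOM k l E F : unifO k E -> unifO l F -> unifO (k + l) (fun d x => E d x * F d x).
Proof.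
move=> [A A0 HA] [B B0 HB]; exists (A * B); first exact: mulr_ge0.
move=> d x /[dup] dd /andP[d0 _]; rewrite normrM exprD mulrACA.
by apply: ler_pM => //; [exact: HA|exact: HB].
Qed.

Lemma unifO_comp k E W : unifO k E -> unifO k (fun d x => E d (W d x)).
Proof. by move=> [A A0 HA]; exists A => // d x dd; exact: HA. Qed.

Lemma unifO_LB f W : LB f -> unifO 0 (fun d x => f (W d x)).
Proof.
by move=> /LB_bound[C C0 H]; exists C => // d x _; rewrite expr0 mulr1.
Qed.

Lemma unifO_bounded f C : (forall x, `|f x| <= C) -> unifO 0 (fun _ x => f x).
Proof.
move=> H; exists C => [|d x _]; first by apply: le_trans (H 0).
by rewrite expr0 mulr1.
Qed.

Lemma unifO_d : unifO 1 (fun d _ => d).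
Proof. by exists 1 => // d x /andP[d0 _]; rewrite expr1 mul1r gtr0_norm. Qed.

Lemma unifO_lip k f E F : LB f -> unifO k (fun d x => E d x - F d x) ->
  unifO k (fun d x => f (E d x) - f (F d x)).
Proof.
move=> /LB_lip[K K0 lf] [C C0 H]; exists (K * C); first exact: mulr_ge0.
by move=> d x dd; apply: le_trans (lf _ _) _; rewrite -mulrA ler_wpM2l// H.
Qed.

End unifO_calculus.

Arguments unifO_LB {R d1 f} W _.
Arguments unifO_comp {R d1 k E} W _.
Arguments unifO_bounded {R d1 f C} _.
Arguments unifO_d {R} d1.
Arguments unifO_weak {R d1} d1_le1 {k l E} _ _.

Section transfer_lipschitz.
Context {R : realType}.
Variables (lam D : R) (n : nat) (s : R) (T T1 T2 V : R -> R) (M2 : R).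
Hypotheses (lam1 : 1 < lam) (HT : expanding_lift lam D n s T T1 V).
Hypotheses (dT1 : forall x : R, is_derive x 1 T1 (T2 x)) (T2M : forall x, `|T2 x| <= M2).

Lemma lift_ge1 x : 1 <= `|T1 x|.
Proof. by apply: le_trans (el_expand HT x); exact: ltW. Qed.

Lemma inv_lip1 x y : `|V x - V y| <= `|x - y|.
Proof.
apply: le_trans (inv_contraction lam1 HT x y) _.
by rewrite ler_piMr// invf_le1 ?ltW// (lt_trans ltr01).
Qed.

Lemma transfer_lip w M B : lip M w -> (forall x, `|w x| <= B) ->
  lip (n%:R * (M + B * M2)) (transfer n T1 V w).
Proof.
move=> lw wB x y; rewrite /transfer -sumrB.
apply: le_trans (ler_norm_sum _ _ _) _.
apply: (@le_trans _ _ (\sum_(k < n) (M + B * M2) * `|x - y|)); last first.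
  by rewrite sumr_const card_ord -mulrA mulr_natl.
apply: ler_sum => k _.
set u := V (x + k%:R); set v := V (y + k%:R).
have uv : `|u - v| <= `|x - y|.
  by apply: le_trans (inv_lip1 _ _) _; rewrite opprD addrACA subrr addr0.
have B0 : 0 <= B by apply: le_trans (wB 0).
have M0 := lip_ge0 lw.
have M20 : 0 <= M2 by apply: le_trans (T2M 0).
apply: (@le_trans _ _ ((M + B * M2) * `|u - v|)); last first.
  by rewrite ler_wpM2l// addr_ge0// mulr_ge0.
have lT1 : lip M2 T1 := is_derive_lip dT1 T2M.
have Tu : 0 < `|T1 u| by rewrite (lt_le_trans ltr01)// lift_ge1.
have Tv : 0 < `|T1 v| by rewrite (lt_le_trans ltr01)// lift_ge1.
have -> : w u / `|T1 u| - w v / `|T1 v| =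
   (w u - w v) / `|T1 u| + w v * (`|T1 v| - `|T1 u|) / (`|T1 u| * `|T1 v|).
  by field; rewrite !gt_eqF.
apply: le_trans (ler_normD _ _) _; rewrite [leRHS]mulrDl; apply: lerD.
  rewrite normrM normfV normr_id ler_pdivrMr//; apply: le_trans (lw u v) _.
  by rewrite ler_peMr ?lift_ge1// mulr_ge0.
rewrite !normrM normfV normrM !normr_id ler_pdivrMr ?mulr_gt0// -!mulrA.
apply: ler_pM => //.
have h1 : `| `|T1 v| - `|T1 u| | <= M2 * `|u - v|.
  by apply: le_trans (ler_dist_dist _ _) _; rewrite [`|u - v|]distrC; exact: lT1.
apply: le_trans h1 _; rewrite mulrA ler_peMr ?mulr_ge0//.
by rewrite mulr_ege1// lift_ge1.
Qed.

End transfer_lipschitz.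

Section perturbation.
Context {R : realType}.
Implicit Types (f g w : R -> R).
Variables (lam D : R).
Hypotheses (lam1 : 1 < lam) (D0 : 0 < D).
Variables (n : nat) (s : R) (T T1 T2 T3 V : R -> R) (M2 M3 : R).
Hypothesis HT : expanding_lift lam D n s T T1 V.
Hypotheses (dT1 : forall x : R, is_derive x 1 T1 (T2 x)) (dT2 : forall x : R, is_derive x 1 T2 (T3 x)).
Hypotheses (T2M : forall x, `|T2 x| <= M2) (T3M : forall x, `|T3 x| <= M3).
Variable f1 : R -> R.
Local Notation f0 := (acip n T1 V).
Hypotheses (df0 : forall x : R, is_derive x 1 f0 (f1 x)) (Lf1 : LB f1).

Variables (P P1 P2 : R -> R).
Hypothesis dP : forall x : R, is_derive x 1 P (P1 x).
Hypotheses (LP : LB P) (LP1 : LB P1).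
Variable (MP : R).
Hypothesis P2M : forall x, `|P2 x| <= MP.

Variable d1 : R.
Hypothesis d1_le1 : d1 <= 1.
(** U d is the perturbed map and W d its inverse; the names with 1 and 2 are
    first and second derivatives.  All U d have the expansion and distortion
    constants of T, hence the same decay constants. *)
Variables (F F1 F2 U U1 U2 W : R -> R -> R).
Hypotheses (HU : forall d, 0 < d < d1 -> expanding_lift lam D n s (U d) (U1 d) (W d)).
Hypothesis dU1 : forall d, 0 < d < d1 -> forall x : R, is_derive x 1 (U1 d) (U2 d x).
Hypotheses (UE : forall d x, 0 < d < d1 -> U d x = T x + d * P x + F d x).
Hypotheses (U1E : forall d x, 0 < d < d1 -> U1 d x = T1 x + d * P1 x + F1 d x).
Hypotheses (U2E : forall d x, 0 < d < d1 -> U2 d x = T2 x + d * P2 x + F2 d x).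
Hypotheses (FO : unifO d1 2 F) (F1O : unifO d1 2 F1) (F2O : unifO d1 2 F2).

Local Notation O := (unifO d1).
Local Notation L := (transfer n T1 V).

Let LT1 : LB T1.
Proof.
have [A _ T1A] := continuous_periodic_bounded (cl_continuous HT) (cl_periodic HT).
exact: LB_intro T1A (is_derive_lip dT1 T2M).
Qed.
Let LT2 : LB T2. Proof. exact: LB_intro T2M (is_derive_lip dT2 T3M). Qed.
Let Lf0 : LB f0.
Proof.
apply: (LB_intro (A := cone_max lam D) _ (acip_lip lam1 D0 HT)) => x.
have [_ fp _] := acip_cone lam1 D0 HT.
by have /andP[_] := acip_bounds lam1 D0 HT x; rewrite gtr0_norm.
Qed.
Let LTV : LB (fun x => (T1 x)^-1). Proof. exact: LBV (lift_ge1 lam1 HT) LT1. Qed.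
Let T1n x : T1 x != 0 := cl_neq0 HT x.
Let U1n d x : 0 < d < d1 -> U1 d x != 0. Proof. by move=> /HU h; exact: (cl_neq0 h). Qed.

Let OP : O 1 (fun d x => d * P x).
Proof. by apply: (unifOM (k := 1) (l := 0) (unifO_d d1)); exact: (unifO_LB (fun _ x => x) LP). Qed.
Let OP1 : O 1 (fun d x => d * P1 x).
Proof. by apply: (unifOM (k := 1) (l := 0) (unifO_d d1)); exact: (unifO_LB (fun _ x => x) LP1). Qed.
Let OP2 : O 1 (fun d x => d * P2 x).
Proof. by apply: (unifOM (k := 1) (l := 0) (unifO_d d1)); exact: (unifO_bounded P2M). Qed.

Lemma O_U1 : O 1 (fun d x => U1 d x - T1 x).
Proof.
apply: (@unifO_ext _ _ _ (fun d x => d * P1 x + F1 d x)).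
  by move=> d x dd; rewrite U1E//; ring.
by apply: unifOD => //; exact: (unifO_weak d1_le1 (leqnSn 1) F1O).
Qed.

Lemma O_U2 : O 1 (fun d x => U2 d x - T2 x).
Proof.
apply: (@unifO_ext _ _ _ (fun d x => d * P2 x + F2 d x)).
  by move=> d x dd; rewrite U2E//; ring.
by apply: unifOD => //; exact: (unifO_weak d1_le1 (leqnSn 1) F2O).
Qed.

Lemma O_iU : O 0 (fun d x => (U1 d x)^-1).
Proof.
exists 1 => // d x dd; rewrite expr0 mulr1 normfV invf_le1 ?(lift_ge1 lam1 (HU dd))//.
by rewrite (lt_le_trans ltr01)// (lift_ge1 lam1 (HU dd)).
Qed.

Lemma O_iT W' : O 0 (fun d x => (T1 (W' d x))^-1).
Proof. exact: (unifO_LB W' LTV). Qed.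

Lemma O_iUT : O 1 (fun d x => (U1 d x)^-1 - (T1 x)^-1).
Proof.
apply: (@unifO_ext _ _ _ (fun d x => - ((U1 d x - T1 x) * ((U1 d x)^-1 * (T1 x)^-1)))).
  by move=> d x dd; field; rewrite T1n U1n.
apply: unifON; apply: (unifOM (k := 1) (l := 0) O_U1).
by apply: (unifOM (k := 0) (l := 0) O_iU); exact: (O_iT (fun _ x => x)).
Qed.

(** T (W d x) - x = - (d P + F d) (W d x), and T expands distances. *)
Lemma O_W : O 1 (fun d x => W d x - V x).
Proof.
have [C C0 H] := unifOD OP (unifO_weak d1_le1 (leqnSn 1) FO).
exists C => // d x dd; have HUd := HU dd.
have [c E] := mean_value (V x) (W d x) (cl_derive HT).
have h : T (W d x) - T (V x) = - (d * P (W d x) + F d (W d x)).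
  rewrite (cl_VK HT) -{2}(cl_VK HUd x) UE//; ring.
rewrite h in E; have := H d (W d x) dd; rewrite -normrN E normrM => h2.
by apply: le_trans h2; rewrite ler_peMl// (lift_ge1 lam1 HT).
Qed.

(** Taylor's formula for T at V x, applied to T (W d x) = x - d P (W d x) +
    O(d ^ 2). *)
Lemma O_W2 : O 2 (fun d x => W d x - V x + d * (P (V x) / T1 (V x))).
Proof.
have lT1 := is_derive_lip dT1 T2M.
have M20 := lip_ge0 lT1.
have hq : O 2 (fun d x => T (W d x) - T (V x) - T1 (V x) * (W d x - V x)).
  have [C C0 H] := O_W; exists (M2 * C ^+ 2); first by rewrite mulr_ge0// sqr_ge0.
  move=> d x dd; apply: le_trans (taylor1 (V x) (W d x) (cl_derive HT) lT1) _.
  have hd0 : 0 <= C * d by rewrite mulr_ge0//; case/andP: dd => /ltW.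
  rewrite -mulrA ler_wpM2l// -exprMn -real_normK ?num_real// ler_pXn2r// ?nnegrE//.
  by have := H d x dd; rewrite expr1.
have hP : O 2 (fun d x => d * (P (W d x) - P (V x))).
  by apply: (unifOM (k := 1) (l := 1) (unifO_d d1)); apply: unifO_lip O_W.
apply: (@unifO_ext _ _ _ (fun d x => (T1 (V x))^-1 *
   (- d * (P (W d x) - P (V x)) - F d (W d x) - (T (W d x) - T (V x) - T1 (V x) * (W d x - V x))))).
  move=> d x dd; have HUd := HU dd.
  have -> : T (W d x) = x - d * P (W d x) - F d (W d x).
    by have := cl_VK HUd x; rewrite UE//; lra.
  by rewrite (cl_VK HT); field.
apply: (unifOM (k := 0) (l := 2)); first exact: (O_iT (fun _ => V)).
apply: unifOB => //; apply: unifOB; last exact: unifO_comp.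
by apply: unifO_ext (unifON hP) => d x _; rewrite mulNr.
Qed.

Let g y := f0 y / T1 y.
Let g1 y := f1 y / T1 y - f0 y * T2 y / T1 y ^+ 2.
Let m y := f0 y * P1 y / T1 y ^+ 2.

Let dg (y : R) : is_derive y 1 g (g1 y).
Proof.
apply: is_derive_eq (is_deriveM1 (df0 y) (is_deriveV1 (T1n y) (dT1 y))) _.
by rewrite /g1; field.
Qed.
Let Lg1 : LB g1.
Proof.
have h1 := LBM Lf1 LTV; have h2 := LBM (LBM Lf0 LT2) (LBM LTV LTV).
apply: (eq_ind _ LB (LBB h1 h2)); apply/funext => y; rewrite /g1; field; exact: T1n.
Qed.
Let Lm : LB m.
Proof.
have h := LBM (LBM Lf0 LP1) (LBM LTV LTV).
apply: (eq_ind _ LB h); apply/funext => y; rewrite /m; field; exact: T1n.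
Qed.
Let Lg : LB g. Proof. exact: LBM Lf0 LTV. Qed.

(** A branch of L_d f0 varies for two reasons: the preimage moves, which gives
    g1 P / T1 by O_W2, and the derivative of the map changes, which gives m. *)
Lemma O_branch : O 2 (fun d x => f0 (W d x) / U1 d (W d x) - f0 (V x) / T1 (V x)
   + d * (m (V x) + g1 (V x) * P (V x) / T1 (V x))).
Proof.
have [K K0 lg1] := LB_lip Lg1.
have hq : O 2 (fun d x => g (W d x) - g (V x) - g1 (V x) * (W d x - V x)).
  have [C C0 H] := O_W; exists (K * C ^+ 2); first by rewrite mulr_ge0// sqr_ge0.
  move=> d x dd; apply: le_trans (taylor1 (V x) (W d x) dg lg1) _.
  have hd0 : 0 <= C * d by rewrite mulr_ge0//; case/andP: dd => /ltW.
  rewrite -mulrA ler_wpM2l// -exprMn -real_normK ?num_real// ler_pXn2r// ?nnegrE//.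
  by have := H d x dd; rewrite expr1.
have hW : O 2 (fun d x => g1 (V x) * (W d x - V x + d * (P (V x) / T1 (V x)))).
  by apply: (unifOM (k := 0) (l := 2) _ O_W2); exact: (unifO_LB (fun _ => V) Lg1).
have hm : O 2 (fun d x => d * (m (W d x) - m (V x))).
  by apply: (unifOM (k := 1) (l := 1) (unifO_d d1)); apply: unifO_lip O_W.
have hF : O 2 (fun d x => f0 (W d x) * F1 d (W d x) / (U1 d (W d x) * T1 (W d x))).
  apply: (@unifO_ext _ _ _ (fun d x => f0 (W d x) * (F1 d (W d x) * ((U1 d (W d x))^-1 * (T1 (W d x))^-1)))).
    by move=> d x dd; field; rewrite T1n U1n.
  apply: (unifOM (k := 0) (l := 2) (unifO_LB W Lf0)).
  apply: (unifOM (k := 2) (l := 0)); first exact: unifO_comp.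
  by apply: (unifOM (k := 0) (l := 0)); [exact: (unifO_comp W O_iU)|exact: O_iT].
have hPU : O 2 (fun d x => d * (f0 (W d x) * P1 (W d x) / T1 (W d x) *
     ((U1 d (W d x))^-1 - (T1 (W d x))^-1))).
  apply: (unifOM (k := 1) (l := 1) (unifO_d d1)); apply: (unifOM (k := 0) (l := 1)).
    by apply: (unifO_LB W (f := fun y => f0 y * P1 y / T1 y)); apply: LBM LTV; exact: LBM.
  exact: (unifO_comp W O_iUT).
apply: (@unifO_ext _ _ _ (fun d x =>
   ((g (W d x) - g (V x) - g1 (V x) * (W d x - V x)) +
   g1 (V x) * (W d x - V x + d * (P (V x) / T1 (V x)))) -
   (d * (m (W d x) - m (V x)) + f0 (W d x) * F1 d (W d x) / (U1 d (W d x) * T1 (W d x)) +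
    d * (f0 (W d x) * P1 (W d x) / T1 (W d x) * ((U1 d (W d x))^-1 - (T1 (W d x))^-1))))).
  move=> d x dd; have E := U1E (W d x) dd.
  have -> : F1 d (W d x) = U1 d (W d x) - T1 (W d x) - d * P1 (W d x) by rewrite E; ring.
  by rewrite /g /m; field; rewrite !T1n U1n.
by apply: unifOB; [exact: unifOD|apply: unifOD => //; exact: unifOD].
Qed.

Let K0 y := g1 y / T1 y.
Let K d y := (f1 y / U1 d y - f0 y * U2 d y / U1 d y ^+ 2) / U1 d y.

(** K d and K0 are the derivatives of a branch at the preimage; a first-order
    comparison suffices to bound the Lipschitz constant of (L_d f0 - f0) / d. *)
Lemma O_branch_derive : O 1 (fun d x => K d (W d x) - K0 (V x)).
Proof.
have LK0 : LB K0 by exact: LBM Lg1 LTV.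
have h1 : O 1 (fun d x => K0 (W d x) - K0 (V x)) by apply: unifO_lip O_W.
have h2 : O 1 (fun d y => K d y - K0 y).
  have OiT := O_iT (fun _ x => x).
  have Of1 := @unifO_LB _ d1 _ (fun _ x => x) Lf1.
  have Of0 := @unifO_LB _ d1 _ (fun _ x => x) Lf0.
  have OT2 := @unifO_LB _ d1 _ (fun _ x => x) LT2.
  have i2 : O 1 (fun d y => (U1 d y)^-1 * (U1 d y)^-1 - (T1 y)^-1 * (T1 y)^-1).
    apply: (@unifO_ext _ _ _ (fun d y => ((U1 d y)^-1 - (T1 y)^-1) * ((U1 d y)^-1 + (T1 y)^-1))).
      by move=> d x dd; ring.
    by apply: (unifOM (k := 1) (l := 0) O_iUT); apply: unifOD => //; exact: O_iU.
  have i3 : O 1 (fun d y => (U1 d y)^-1 * (U1 d y)^-1 * (U1 d y)^-1 - (T1 y)^-1 * (T1 y)^-1 * (T1 y)^-1).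
    apply: (@unifO_ext _ _ _ (fun d y => ((U1 d y)^-1 * (U1 d y)^-1 - (T1 y)^-1 * (T1 y)^-1) * (U1 d y)^-1
       + (T1 y)^-1 * (T1 y)^-1 * ((U1 d y)^-1 - (T1 y)^-1))).
      by move=> d x dd; ring.
    apply: unifOD; first by apply: (unifOM (k := 1) (l := 0) i2); exact: O_iU.
    by apply: (unifOM (k := 0) (l := 1) _ O_iUT); exact: (unifOM (k := 0) (l := 0)).
  apply: (@unifO_ext _ _ _ (fun d y => f1 y * ((U1 d y)^-1 * (U1 d y)^-1 - (T1 y)^-1 * (T1 y)^-1)
     - (f0 y * ((U2 d y - T2 y) * ((U1 d y)^-1 * ((U1 d y)^-1 * (U1 d y)^-1))) +
       f0 y * (T2 y * ((U1 d y)^-1 * (U1 d y)^-1 * (U1 d y)^-1 - (T1 y)^-1 * (T1 y)^-1 * (T1 y)^-1))))).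
    by move=> d x dd; rewrite /K /K0 /g1; field; rewrite T1n U1n.
  apply: unifOB; first exact: (unifOM (k := 0) (l := 1)).
  apply: unifOD; apply: (unifOM (k := 0) (l := 1)) => //.
    apply: (unifOM (k := 1) (l := 0) O_U2); apply: (unifOM (k := 0) (l := 0) O_iU).
    exact: (unifOM (k := 0) (l := 0) O_iU O_iU).
  exact: (unifOM (k := 0) (l := 1)).
apply: (@unifO_ext _ _ _ (fun d x => (K d (W d x) - K0 (W d x)) + (K0 (W d x) - K0 (V x)))).
  by move=> d x _; ring.
by apply: unifOD => //; exact: (unifO_comp W h2).
Qed.

Lemma O_transfer w : LB w -> O 1 (fun d x => transfer n (U1 d) (W d) w x - L w x).
Proof.
move=> Lw.
have h : O 1 (fun d x => s * (w (W d x) / U1 d (W d x) - w (V x) / T1 (V x))).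
  apply: (unifOM (k := 0) (l := 1)).
    by apply: (unifO_bounded (C := `|s|)).
  apply: (@unifO_ext _ _ _ (fun d x => w (W d x) * ((U1 d (W d x))^-1 - (T1 (W d x))^-1) +
     (w (W d x) * (T1 (W d x))^-1 - w (V x) * (T1 (V x))^-1))).
    by move=> d x dd; ring.
  apply: unifOD.
    by apply: (unifOM (k := 0) (l := 1)); [exact: unifO_LB|exact: (unifO_comp W O_iUT)].
  by apply: (unifO_lip (f := fun y => w y * (T1 y)^-1)); [exact: LBM|exact: O_W].
have [C C0 H] := h; exists (n%:R * C); first exact: mulr_ge0.
move=> d x dd; rewrite /transfer -sumrB.
apply: le_trans (ler_norm_sum _ _ _) _.
apply: (@le_trans _ _ (\sum_(k < n) C * d ^+ 1)).
  apply: ler_sum => k _; have := H d (x + k%:R) dd.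
  by rewrite (lift_sign (HU dd)) (lift_sign HT); congr (`|_| <= _); ring.
by rewrite sumr_const card_ord -mulrA mulr_natl.
Qed.

(** The function - (f0 P / T1)', which satisfies kappa / T1 = -
    (m + g1 P / T1); its transfer is therefore the first-order term of L_d f0. *)
Definition response_source y : R := - (g1 y * P y + g y * P1 y).
Local Notation kappa := response_source.

Hypothesis pP : periodic P 1.

Lemma response_source_LB : LB kappa.
Proof.
have h := LBZ (-1) (LBD (LBM Lg1 LP) (LBM Lg LP1)).
by apply: (eq_ind _ LB h); apply/funext => y; rewrite /response_source mulN1r.
Qed.

Lemma O_source : O 1 (fun d x => (transfer n (U1 d) (W d) f0 x - f0 x) / d - L kappa x).
Proof.
have [C C0 H] := O_branch; exists (n%:R * C); first exact: mulr_ge0.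
move=> d x dd; have d0 : 0 < d by case/andP: dd.
have -> : (transfer n (U1 d) (W d) f0 x - f0 x) / d - L kappa x =
   \sum_(k < n) s * (f0 (W d (x + k%:R)) / U1 d (W d (x + k%:R)) - f0 (V (x + k%:R)) / T1 (V (x + k%:R))
   + d * (m (V (x + k%:R)) + g1 (V (x + k%:R)) * P (V (x + k%:R)) / T1 (V (x + k%:R)))) / d.
  have Ex := acip_invariant lam1 D0 HT x.
  rewrite -[X in (_ - X) / d]Ex /transfer -sumrB mulr_suml -sumrB.
  apply: eq_bigr => k _; rewrite (lift_sign (HU dd)) (lift_sign HT) /response_source /g /m.
  by field; rewrite T1n U1n// gt_eqF.
apply: le_trans (ler_norm_sum _ _ _) _.
apply: (@le_trans _ _ (\sum_(k < n) C * d ^+ 1)).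
  apply: ler_sum => k _; have := H d (x + k%:R) dd.
  have s1 : `|s| = 1 by case: (cl_s HT) => ->; rewrite ?normrN1 ?normr1.
  move=> h; rewrite [leLHS]normrM [X in X * _]normrM s1 mul1r normfV (gtr0_norm d0).
  by rewrite ler_pdivrMr// [leRHS](_ : _ = C * d ^+ 2)// expr1 -mulrA expr2.
by rewrite sumr_const card_ord -mulrA mulr_natl.
Qed.

Lemma lip_source : exists2 C, 0 <= C & forall d, 0 < d < d1 ->
  lip C (fun x => (transfer n (U1 d) (W d) f0 x - f0 x) / d).
Proof.
have [C C0 H] := O_branch_derive; exists (n%:R * C); first exact: mulr_ge0.
move=> d dd; have d0 : 0 < d by case/andP: dd.
have HUd := HU dd.
have dgU (y : R) : is_derive y 1 (fun y => s * f0 y / U1 d y) (s * K d y * U1 d y).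
  apply: is_derive_eq (is_deriveM1 (is_deriveZ1 s (df0 y)) (is_deriveV1 (U1n y dd) (dU1 dd y))) _.
  by rewrite /K; field; rewrite U1n.
have dgT (y : R) : is_derive y 1 (fun y => s * f0 y / T1 y) (s * g1 y).
  apply: is_derive_eq (is_deriveM1 (is_deriveZ1 s (df0 y)) (is_deriveV1 (T1n y) (dT1 y))) _.
  by rewrite /g1; field.
have EU : transfer n (U1 d) (W d) f0 = branch_sum n (W d) (fun y => s * f0 y / U1 d y).
  by apply/funext => x; exact: transfer_branch_sum (lift_sign HUd).
have ET : L f0 = branch_sum n V (fun y => s * f0 y / T1 y).
  by apply/funext => x; exact: transfer_branch_sum (lift_sign HT).
have Ef : f0 = L f0 by apply/funext => x; rewrite (acip_invariant lam1 D0 HT).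
have dd' (x : R) : is_derive x 1 (fun x => d^-1 * (transfer n (U1 d) (W d) f0 x - L f0 x))
   (d^-1 * (branch_sum n (W d) (fun y => s * K d y * U1 d y / U1 d y) x - branch_sum n V (fun y => s * g1 y / T1 y) x)).
  apply: is_deriveZ1; apply: is_deriveB1.
    by rewrite EU; exact: (is_derive_branch_sum HUd).
  by rewrite ET; exact: (is_derive_branch_sum HT).
have -> : (fun x => (transfer n (U1 d) (W d) f0 x - f0 x) / d) =
   (fun x => d^-1 * (transfer n (U1 d) (W d) f0 x - L f0 x)).
  by apply/funext => x; rewrite (acip_invariant lam1 D0 HT) mulrC.
apply: (is_derive_lip dd') => x.
rewrite normrM normfV (gtr0_norm d0) mulrC ler_pdivrMr// /branch_sum -sumrB.
apply: le_trans (ler_norm_sum _ _ _) _.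
apply: (@le_trans _ _ (\sum_(k < n) C * d ^+ 1)); last first.
  by rewrite sumr_const card_ord -mulrA mulr_natl expr1.
apply: ler_sum => k _; have := H d (x + k%:R) dd.
have s1 : `|s| = 1 by case: (cl_s HT) => ->; rewrite ?normrN1 ?normr1.
rewrite mulfK ?U1n//.
have -> : s * K d (W d (x + k%:R)) - s * g1 (V (x + k%:R)) / T1 (V (x + k%:R)) =
   s * (K d (W d (x + k%:R)) - K0 (V (x + k%:R))) by rewrite /K0; ring.
by rewrite normrM s1 mul1r.
Qed.

(** kappa is the derivative of a periodic function. *)
Lemma source_int : circle_int kappa = 0.
Proof.
have d (y : R) : is_derive y 1 (fun y => - (g y * P y)) (kappa y).
  apply: is_derive_eq (is_deriveN (is_deriveM1 (dg y) (dP y))) _.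
  by [].
have ck : continuous kappa.
  by have [C _ h] := LB_lip response_source_LB; exact: lip_continuous h.
rewrite /circle_int Rintegral_cotocc// (Rintegral_FTC2 _ ck d)//.
have [pf _ _] := acip_cone lam1 D0 HT.
have := pP 0; have := pf 0; have := cl_periodic HT 0; rewrite !add0r /g => -> -> ->.
by rewrite subrr.
Qed.

Definition response x : R := resolvent n T1 V (L kappa) x.

Lemma source_data : exists M, [/\ 0 < M, periodic (L kappa) 1, lip M (L kappa) & circle_int (L kappa) = 0].
Proof.
have [C [kC lk]] := response_source_LB.
have ck := lip_continuous lk.
have pk : periodic kappa 1.
  move=> y; have [pf _ _] := acip_cone lam1 D0 HT.
  have pf1 := derive_periodic df0 pf; have pP1 := derive_periodic dP pP.
  have pT := cl_periodic HT; have pT2 := derive_periodic dT1 pT.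
  by rewrite /response_source /g /g1 pf pf1 pP pP1 pT pT2.
have hl := transfer_lip lam1 HT dT1 T2M lk kC.
exists (n%:R * (C + C * M2) + 1); split.
- by rewrite ltr_wpDl// (lip_ge0 hl).
- exact: (transfer_periodic HT).
- by move=> x y; apply: le_trans (hl x y) _; rewrite ler_wpM2r// lerDl.
- by rewrite (circle_int_transfer HT) ?source_int.
Qed.

(** Since f_d = L_d f_d and r = response satisfies r = L kappa + L r, the
    error z = (f_d - f0) / d - r solves z = L_d z + e_d with e_d = ((L_d f0 -
    f0) / d - L kappa) + (L_d r - L r).  By O_source and O_transfer e_d is
    O(d), by lip_source and transfer_lip it has a Lipschitz constant Me
    independent of d, and it has zero mean, so fixed_point_bound applies to
    L_d. *)
Lemma response_uniform e : 0 < e -> exists2 d0, 0 < d0 & forall d x, 0 < d < d1 -> d < d0 ->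
  `|(acip n (U1 d) (W d) x - f0 x) / d - response x| <= e.
Proof.
move=> e0; have [M [M0 ph lh ih]] := source_data.
have lr := resolvent_lip lam1 D0 HT M0 ph lh ih.
have rB := resolvent_bound lam1 D0 HT M0 ph lh ih.
have pr := resolvent_periodic HT ph.
have ir := resolvent_int lam1 D0 HT M0 ph lh ih.
have Lr : LB response by exact: LB_intro rB lr.
have [A A0 HA] := O_source; have [B B0 HB] := O_transfer Lr.
have [S S0 HS] := lip_source; have [C2 C20 HU2] := O_U2.
set Kr := resolvent_cst lam D * M in lr rB.
have Kr0 : 0 <= Kr := lip_ge0 lr.
have M20 : 0 <= M2 by apply: le_trans (T2M 0).
pose MU := M2 + C2.
have U2M d x : 0 < d < d1 -> `|U2 d x| <= MU.
  move=> dd; have -> : U2 d x = T2 x + (U2 d x - T2 x) by ring.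
  apply: le_trans (ler_normD _ _) _; apply: lerD => //; apply: le_trans (HU2 d x dd) _.
  by rewrite expr1 ler_piMr//; apply: ltW; apply: lt_le_trans d1_le1; case/andP: dd.
pose Me := S + M + (n%:R * (Kr + Kr * MU) + n%:R * (Kr + Kr * M2)).
have Me0 : 0 < Me.
  by rewrite /Me /MU ltr_wpDr ?ltr_wpDl// addr_ge0// mulr_ge0// addr_ge0// mulr_ge0// addr_ge0.
have q01 := decay_rate01 lam1 D0.
have e20 : 0 < e / 2 by rewrite divr_gt0.
have [m0 /ltW Hm] := geometric_small (resolvent_cst lam D * Me) q01 e20.
pose Q := m0%:R * (cone_max lam D * (A + B)).
have Q0 : 0 <= Q by rewrite /Q mulr_ge0// mulr_ge0 ?expR_ge0// addr_ge0.
exists (e / 2 / (Q + 1)); first by rewrite divr_gt0// ltr_wpDl.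
move=> d x dd dlt; have d0 : 0 < d by case/andP: dd.
have HUd := HU dd.
set fd := acip n (U1 d) (W d); set Ld := transfer n (U1 d) (W d).
pose z x := (fd x - f0 x) / d - response x.
pose ed x := ((Ld f0 x - f0 x) / d - L kappa x) + (Ld response x - L response x).
have cz : lip ((2 * cone_lip_cst lam D) / d + Kr + 1) z.
  move=> u v; have -> : z u - z v = ((fd u - fd v) - (f0 u - f0 v)) / d - (response u - response v).
    by rewrite /z; field; rewrite gt_eqF.
  have h1 := acip_lip lam1 D0 HUd u v; have h2 := acip_lip lam1 D0 HT u v.
  have h3 : `|((fd u - fd v) - (f0 u - f0 v)) / d| <= 2 * cone_lip_cst lam D / d * `|u - v|.
    rewrite normrM normfV (gtr0_norm d0) mulrAC ler_pM2r ?invr_gt0//.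
    by apply: le_trans (ler_normB _ _) _; rewrite -/fd in h1; lra.
  apply: le_trans (ler_normB _ _) _; have := lr u v; have := normr_ge0 (u - v).
  rewrite -[resolvent n T1 V (L kappa)]/response; lra.
have Z0 : 0 < (2 * cone_lip_cst lam D) / d + Kr + 1.
  have := cone_lip_cst_ge lam1 D0; have : 0 < cone_max lam D by exact: expR_gt0.
  move=> h1 h2; have : 0 <= 2 * cone_lip_cst lam D / d.
    by rewrite divr_ge0 ?(ltW d0)// mulr_ge0// (le_trans (ltW h1)).
  lra.
have [pfd _ _] := acip_cone lam1 D0 HUd; have [pf _ _] := acip_cone lam1 D0 HT.
have pz : periodic z 1.
  by move=> y; rewrite /z /response pr [f0 (y + 1)]pf [fd (y + 1)]pfd.
have cfd := acip_continuous lam1 D0 HUd; have cf := acip_continuous lam1 D0 HT.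
have cr := lip_continuous lr.
have iz : circle_int z = 0.
  rewrite (_ : z = fun x => d^-1 * (fd x - f0 x) - response x); last first.
    by apply/funext => y; rewrite /z mulrC.
  rewrite circle_intB//; last first.
    by move=> y; apply: cvgM; [exact: cvg_cst|apply: cvgB; [exact: cfd|exact: cf]].
  rewrite circle_intZ; last by move=> y; apply: cvgB; [exact: cfd|exact: cf].
  rewrite circle_intB// (acip_int lam1 D0 HUd) (acip_int lam1 D0 HT) subrr mulr0 sub0r.
  by rewrite /response ir oppr0.
have ze y : z y = Ld z y + ed y.
  have E1 : Ld z y = d^-1 * (fd y - Ld f0 y) - Ld response y.
    rewrite /Ld (_ : z = fun x => d^-1 * (fd x - f0 x) - response x); last first.
      by apply/funext => t; rewrite /z mulrC.
    by rewrite transferB transferZ transferB (acip_invariant lam1 D0 HUd).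
  have E2 : response y = L kappa y + L response y.
    exact: (resolvent_eq lam1 D0 HT M0 ph lh ih).
  by rewrite E1 /ed /z E2; field; rewrite gt_eqF.
have cLz : continuous (Ld z) by apply: (transfer_continuous HUd); exact: lip_continuous cz.
have edE : ed = fun y => z y - Ld z y by apply/funext => y; rewrite ze; ring.
have pe : periodic ed 1.
  by move=> y; rewrite edE pz [Ld z (y + 1)](transfer_periodic HUd pz).
have ie : circle_int ed = 0.
  rewrite edE circle_intB//; last exact: lip_continuous cz.
  rewrite (circle_int_transfer HUd) ?subrr//; exact: lip_continuous cz.
have le : lip Me ed.
  move=> u v; have -> : ed u - ed v = (((Ld f0 u - f0 u) / d - (Ld f0 v - f0 v) / d) - (L kappa u - L kappa v))
    + ((Ld response u - Ld response v) - (L response u - L response v)) by rewrite /ed; ring.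
  have h1 := HS d dd u v; have h2 := lh u v.
  have h3 := transfer_lip lam1 HUd (dU1 dd) (fun x => U2M d x dd) lr rB u v.
  have h4 := transfer_lip lam1 HT dT1 T2M lr rB u v.
  apply: le_trans (ler_normD _ _) _.
  apply: le_trans (lerD (ler_normB _ _) (ler_normB _ _)) _.
  rewrite -/Ld -[resolvent n T1 V (L kappa)]/response in h1 h3 h4 *.
  rewrite /Me; lra.
have eB y : `|ed y| <= (A + B) * d.
  apply: le_trans (ler_normD _ _) _; have hA := HA d y dd; have hB := HB d y dd.
  by rewrite !expr1 in hA hB; rewrite [leRHS]mulrDl; apply: lerD.
have := fixed_point_bound lam1 D0 HUd m0 Z0 pz cz iz Me0 pe le ie eB ze x.
rewrite -/(z x) => H; apply: le_trans H _.
rewrite [leRHS]splitr; apply: lerD => //.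
have -> : m0%:R * (cone_max lam D * ((A + B) * d)) = Q * d by rewrite /Q; ring.
move: dlt; rewrite ltr_pdivlMr ?ltr_wpDl// => /ltW; apply: le_trans.
by rewrite mulrC ler_wpM2l ?lerDl// ltW.
Qed.

End perturbation.

(** * Linear response of admissible families *)

Section smooth_functions.
Context {R : realType}.
Implicit Types (f g T : R -> R).

Lemma classC_derive k f i (x : R) : classC k f -> (i < k)%N ->
  is_derive x 1 (derive1n i f) (derive1n i.+1 f x).
Proof. by move=> [df _] ik; rewrite derive1nS derive1E; exact/derivableP/df. Qed.

Lemma classC_cont k f i : classC k f -> (i <= k)%N -> continuous (derive1n i f).
Proof.
move=> fk; rewrite leq_eqVlt => /predU1P[->|ik]; first by case: fk.
by apply: (is_derive_continuous (f' := derive1n i.+1 f)) => x; exact: classC_derive ik.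
Qed.

Lemma classC_periodic k f i : circle_classC k f -> (i <= k)%N -> periodic (derive1n i f) 1.
Proof.
move=> [pf fk]; elim: i => [//|i IH] ik.
by apply: (derive_periodic (f := derive1n i f)) (IH (ltnW ik)) => x; exact: classC_derive ik.
Qed.

Lemma classC_LB k f i : circle_classC k f -> (i < k)%N -> LB (derive1n i f).
Proof.
move=> cf ik; have [pf fk] := cf.
apply: (LB_derive (f' := derive1n i.+1 f)); last exact: classC_periodic (ltnW ik).
  by move=> x; exact: classC_derive ik.
exact: classC_cont ik.
Qed.

Lemma classC_bounded k f i : circle_classC k f -> (i <= k)%N ->
  exists2 M, 0 <= M & forall x, `|derive1n i f x| <= M.
Proof.
move=> cf ik; have [pf fk] := cf.
by apply: continuous_periodic_bounded; [exact: classC_cont ik|exact: classC_periodic ik].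
Qed.

Lemma derive1n_val f (a x : R) : is_derive x 1 f a -> derive1 f x = a.
Proof. by move=> df; rewrite derive1E; apply: derive_val. Qed.

Lemma derive1nE (F : nat -> R -> R) n : (forall i (x : R), (i < n)%N -> is_derive x 1 (F i) (F i.+1 x)) ->
  forall i, (i <= n)%N -> derive1n i (F 0%N) = F i.
Proof.
move=> dF; elim => [//|i IH] ik; rewrite derive1nS IH ?(ltnW ik)//.
by apply/funext => x; apply: derive1n_val; exact: dF.
Qed.

Lemma classC_intro (F : nat -> R -> R) n : (forall i (x : R), (i < n)%N -> is_derive x 1 (F i) (F i.+1 x)) ->
  continuous (F n) -> classC n (F 0%N).
Proof.
move=> dF cF; split=> [i x ik|]; last by rewrite (derive1nE dF).
by rewrite (derive1nE dF) ?(ltnW ik)//; have [] := dF i x ik.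
Qed.

Lemma derive_shift f (f' : R -> R) c : (forall x : R, is_derive x 1 f (f' x)) ->
  (forall x, f (x + 1) = f x + c) -> periodic f' 1.
Proof.
move=> df pf x; apply: (is_derive_unique (is_derive_shift1 x 1 df)).
apply: (@is_derive_ext _ (fun y => f y + c)) => [y|]; first by rewrite pf.
by apply: is_derive_eq (is_deriveD1 (df x) (is_derive_cst c x 1)) _; rewrite addr0.
Qed.

Lemma circle_map_C k T : circle_map k.+1 T -> circle_classC k (derive1 T).
Proof.
move=> [kT [d pT]]; split.
  by apply: derive_shift pT => x; exact: (classC_derive (i := 0) x kT).
apply: (@classC_intro (fun i => derive1n i.+1 T)) => [i x ik|]; last by case: kT.
exact: classC_derive kT _.
Qed.

Lemma normC_bound k (f : R -> R) i x : (i <= k)%N -> (`|derive1n i f x|%:E <= normC k f)%E.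
Proof.
move=> ik; have pos j : (0 <= ereal_sup [set `|derive1n j f x|%:E | x in [set: R]])%E.
  by apply: le_trans (ereal_sup_ubound _); last (by exists 0); rewrite lee_fin.
rewrite /normC (bigD1 (Ordinal (ik : (i < k.+1)%N)))//=.
apply: le_trans (leeDl _ _); last by rewrite sume_ge0.
by apply: ereal_sup_ubound; exists x.
Qed.

Lemma family_remainder (F : R -> R -> R) (dbar : R) : 0 < dbar ->
  (ereal_sup [set (normC 3 (F d) * (d ^- 2)%:E)%E | d in `]0%R, dbar[] < +oo)%E ->
  forall i, (i <= 3)%N -> unifO dbar 2 (fun d => derive1n i (F d)).
Proof.
move=> db0; set M := ereal_sup _ => Moo i i3.
have H d x : 0 < d < dbar -> ((`|derive1n i (F d) x| * d ^- 2)%:E <= M)%E.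
  move=> dd; apply: (@le_trans _ _ (normC 3 (F d) * (d ^- 2)%:E)%E).
    rewrite EFinM lee_wpmul2r//; last exact: normC_bound.
    by rewrite lee_fin invr_ge0 sqr_ge0.
  by apply: ereal_sup_ubound; exists d => //=; rewrite in_itv.
have dh : 0 < dbar / 2 < dbar by rewrite divr_gt0//= ltr_pdivrMr// ltr_pMr// ltr1n.
have M0 : (0 <= M)%E by apply: le_trans (H _ 0 dh); rewrite lee_fin mulr_ge0// invr_ge0 sqr_ge0.
have Mf : M \is a fin_num by rewrite ge0_fin_numE.
exists (fine M); first exact: fine_ge0.
move=> d x dd; have := H d x dd; rewrite -[X in (_ <= X)%E](fineK Mf) lee_fin.
by rewrite ler_pdivrMr// exprn_gt0//; case/andP: dd.
Qed.

End smooth_functions.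

Section L1_estimates.
Context {R : realType}.
Implicit Types (f g P S r : R -> R).
Local Notation mu := (@lebesgue_measure R).

Lemma int_norm_bound f e : continuous f -> (forall x, `|f x| <= e) ->
  (\int[mu]_(x in `[0%R, 1%R[) `|(f x)%:E| <= e%:E)%E.
Proof.
move=> cf fe; apply: (@le_trans _ _ (\int[mu]_(x in `[0%R, 1%R[) (cst e%:E) x)%E).
  apply: ge0_le_integral => //.
  - apply/measurableT_comp => //; apply/measurable_EFinP.
    exact: measurable_funTS (continuous_measurable_fun cf).
  - by move=> x _; rewrite /= lee_fin.
by rewrite integral_cst//= lebesgue_measure_itv/= lte_fin ltr01 -EFinD subr0 mule1.
Qed.

Lemma cvg_at_right_e (F : R -> \bar R) : (forall d, 0%E <= F d)%E ->
  (forall e, 0 < e -> \forall d \near 0^'+, (F d <= e%:E)%E) -> F d @[d --> 0^'+] --> 0%E.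
Proof.
move=> F0 H; apply/fine_cvgP; split.
  apply: filterS (H 1 ltr01) => d h; rewrite ge0_fin_numE//.
  by apply: le_lt_trans h _; rewrite ltry.
apply/cvgr0Pnorm_le => e e0; apply: filterS (H e e0) => d h.
rewrite /= ger0_norm ?fine_ge0// -lee_fin fineK// ge0_fin_numE//.
by apply: le_lt_trans h _; rewrite ltry.
Qed.

End L1_estimates.

Section response_of_families.
Context {R : realType}.

Lemma norm_add3_ge (t p q a b c : R) : a <= `|t| -> `|p| <= b -> `|q| <= c ->
  a - b - c <= `|t + p + q|.
Proof.
move=> h1 h2 h3; have h5 := ler_normB (t + p + q) (p + q); have h6 := ler_normD p q.
by rewrite (_ : t + p + q - (p + q) = t) in h5; [lra|ring].
Qed.

Lemma norm_add3_le (t p q a b c : R) : `|t| <= a -> `|p| <= b -> `|q| <= c ->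
  `|t + p + q| <= a + b + c.
Proof. by move=> h1 h2 h3; have h5 := ler_normD (t + p) q; have h6 := ler_normD t p; lra. Qed.
Implicit Types (f g P S r : R -> R).
Local Notation mu := (@lebesgue_measure R).

(** Everything attached to an expanding map.  T expands by beta, but only
    lam < beta is used as expansion constant, and M2 + 1 instead of M2 as
    distortion constant: this is the room that lets small perturbations have
    the same constants.  f1 is the derivative of the invariant density. *)
Record expanding_data (T : R -> R) (lam beta : R) n (s : R) (V : R -> R) (M2 M3 : R) (f1 : R -> R) : Prop := ExpandingData {
  ed_map : circle_map 4 T;
  ed_lam : 1 < lam;
  ed_beta : lam < beta;
  ed_expand : forall x, beta <= `|derive1 T x|;
  ed_M2 : forall x, `|derive1n 2 T x| <= M2;
  ed_M3 : forall x, `|derive1n 3 T x| <= M3;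
  ed_lift : expanding_lift lam (M2 + 1) n s T (derive1 T) V;
  ed_density : forall x : R, is_derive x 1 (acip n (derive1 T) V) (f1 x);
  ed_LB : LB f1 }.

Lemma expanding_data_exists T : circle_map 4 T -> expanding T ->
  exists lam beta n s V M2 M3 f1, expanding_data T lam beta n s V M2 M3 f1.
Proof.
move=> cT [alpha /andP[a0 a1] aT]; have cT1 := circle_map_C cT.
have [kT [d pT]] := cT.
have ia : 1 < alpha^-1 by rewrite invf_gt1.
have dT i (x : R) : (i < 4)%N -> is_derive x 1 (derive1n i T) (derive1n i.+1 T x).
  by move=> i4; exact: classC_derive kT i4.
have [M2 M20 T2M] := classC_bounded cT1 (isT : (1 <= 3)%N).
have [M3 M30 T3M] := classC_bounded cT1 (isT : (2 <= 3)%N).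
pose lam := (1 + alpha^-1) / 2.
have lam1 : 1 < lam by rewrite /lam; lra.
have lama : lam < alpha^-1 by rewrite /lam; lra.
have lamT x : lam <= `|derive1 T x| by apply: le_trans (aT x); exact: ltW.
have lam0 : 0 < lam by lra.
have D0 : 0 < M2 + 1 by lra.
have dT0 (x : R) : is_derive x 1 T (derive1 T x) by exact: (dT 0%N).
have [n [s [n0 s1 Ts _]]] := lift_degree dT0 lam0 lamT pT.
have cT1c : continuous (derive1 T) by exact: (classC_cont (i := 0) cT1.2).
have [V HV] := lift_exists dT0 cT1c lam0 lamT Ts s1 cT1.1 n0.
have HT : expanding_lift lam (M2 + 1) n s T (derive1 T) V.
  split; [exact: HV|exact: lamT|].
  apply: (@distortion_bound _ _ (derive1n 2 T) lam); [|exact: lam1|exact: lamT|].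
    by move=> x; exact: (dT 1%N).
  by move=> x; apply: le_trans (T2M x) _; rewrite lerDl.
have [f1 [df1 lf1 pf1]] := acip_C11 lam1 D0 HT (fun x => dT 1%N x isT) (fun x => dT 2%N x isT) T2M T3M.
exists lam, alpha^-1, n, s, V, M2, M3, f1.
split; [exact: cT|exact: lam1|exact: lama|exact: aT|exact: T2M|exact: T3M|exact: HT|exact: df1|].
have [B _ f1B] := continuous_periodic_bounded (lip_continuous lf1) pf1.
exact: LB_intro f1B lf1.
Qed.

Variables (T : R -> R) (lam beta : R) (n : nat) (s : R) (V : R -> R) (M2 M3 : R) (f1 : R -> R).
Hypothesis HT : expanding_data T lam beta n s V M2 M3 f1.
Local Notation T1 := (derive1 T).
Local Notation T2 := (derive1n 2 T).
Local Notation T3 := (derive1n 3 T).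
Local Notation f0 := (acip n T1 V).

Let lam1 := ed_lam HT.
Let M20 : 0 <= M2. Proof. by apply: le_trans (ed_M2 HT 0). Qed.
Let D0 : 0 < M2 + 1. Proof. by have h := M20; lra. Qed.
Let dT i (x : R) : (i < 4)%N -> is_derive x 1 (derive1n i T) (derive1n i.+1 T x).
Proof. by move=> i4; have [kT _] := ed_map HT; exact: classC_derive kT i4. Qed.
Let dT1 (x : R) : is_derive x 1 T1 (T2 x). Proof. exact: (dT (i := 1)). Qed.
Let dT2 (x : R) : is_derive x 1 T2 (T3 x). Proof. exact: (dT (i := 2)). Qed.

Definition density_response P := response n T1 T2 V f1 P (derive1 P).

(** For small d the perturbed map has the degree and orientation of T, it
    expands by lam and its second derivative is at most M2 + 1. *)
Lemma family_lifts P (F : R -> R -> R) (dbar : R) : circle_classC 3 P -> 0 < dbar ->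
  (forall d, 0 < d < dbar -> circle_classC 3 (F d)) ->
  (forall i, (i <= 3)%N -> unifO dbar 2 (fun d => derive1n i (F d))) ->
  exists d1 W, [/\ 0 < d1, d1 <= 1, d1 <= dbar &
    forall d, 0 < d < d1 -> expanding_lift lam (M2 + 1) n s
      (fun x => T x + d * P x + F d x) (fun x => T1 x + d * derive1 P x + derive1 (F d) x) (W d)].
Proof.
move=> cP db0 cF FO.
have [A1 A10 P1A] := classC_bounded cP (isT : (1 <= 3)%N).
have [A2 A20 P2A] := classC_bounded cP (isT : (2 <= 3)%N).
have [C1 C10 F1C] := FO 1%N isT; have [C2 C20 F2C] := FO 2%N isT.
have lb := ed_beta HT; have bl : 0 < beta - lam by rewrite subr_gt0.
(* Q d bounds the change of the first two derivatives when d <= 1 *)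
pose Q := A1 + C1 + A2 + C2 + 1.
have Q0 : 0 < Q by rewrite /Q; lra.
pose d1 := Num.min (Num.min 1 dbar) (Num.min ((beta - lam) / Q) Q^-1).
have d10 : 0 < d1 by rewrite !lt_min ltr01 db0 divr_gt0// invr_gt0.
have small (d : R) : 0 < d < d1 -> [/\ 0 < d, d < 1, 0 < d < dbar, d * Q <= beta - lam & d * Q <= 1].
  rewrite !lt_min => /andP[d0 /andP[/andP[h1 h2] /andP[h3 h4]]].
  split => //; first by rewrite d0.
    by rewrite -ler_pdivlMr// ltW.
  by rewrite -ler_pdivlMr// div1r ltW.
have sq (d : R) : 0 < d -> d < 1 -> d ^+ 2 <= d.
  by move=> d0 d1'; rewrite expr2 ler_piMr// ltW.
have HW (d : R) : exists Wd, 0 < d < d1 -> expanding_lift lam (M2 + 1) n s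
    (fun x => T x + d * P x + F d x) (fun x => T1 x + d * derive1 P x + derive1 (F d) x) Wd.
  have [dd|nd] := pselect (0 < d < d1); last by exists id => /nd.
  have [d0 dlt1 ddb dQ1 dQ2] := small d dd; have cFd := cF d ddb.
  have s2 := sq d d0 dlt1.
  have dU i (x : R) : (i < 2)%N -> is_derive x 1 (fun x => derive1n i T x + d * derive1n i P x + derive1n i (F d) x)
     (derive1n i.+1 T x + d * derive1n i.+1 P x + derive1n i.+1 (F d) x).
    move=> i2; apply: is_deriveD1; last exact: classC_derive cFd.2 (ltn_trans i2 _).
    apply: is_deriveD1; first exact: dT (ltn_trans i2 _).
    by apply: is_deriveZ1; exact: classC_derive cP.2 (ltn_trans i2 _).
  have ar1 : lam <= beta - d * A1 - C1 * d.
    have h4 : d * (A1 + C1) <= d * Q by rewrite ler_wpM2l ?ltW// /Q; lra.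
    by lra.
  have ar2 : M2 + d * A2 + C2 * d <= M2 + 1.
    have h4 : d * (A2 + C2) <= d * Q by rewrite ler_wpM2l ?ltW// /Q; lra.
    by lra.
  have PB (A : R) p : `|p| <= A -> `|d * p| <= d * A.
    by move=> h; rewrite normrM gtr0_norm// ler_wpM2l// ltW.
  have FB (C : R) q : 0 <= C -> `|q| <= C * d ^+ 2 -> `|q| <= C * d.
    by move=> C0 h; apply: le_trans h _; rewrite ler_wpM2l.
  have expand x : lam <= `|T1 x + d * derive1 P x + derive1 (F d) x|.
    apply: le_trans ar1 _; apply: norm_add3_ge (ed_expand HT x) (PB _ _ (P1A x)) _.
    exact: FB (F1C d x ddb).
  have U2M x : `|T2 x + d * derive1n 2 P x + derive1n 2 (F d) x| <= M2 + 1.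
    apply: le_trans ar2; apply: norm_add3_le (ed_M2 HT x) (PB _ _ (P2A x)) _.
    exact: FB (F2C d x ddb).
  have HTl := el_lift (ed_lift HT).
  have pshift f : periodic f 1 -> forall x, f (x + s) = f x.
    move=> pf x; case: (cl_s HTl) => ->; first exact: pf.
    exact: (periodic1_int (-1)).
  have [||||Wd HWd] := @lift_exists _ n s (fun x => T x + d * P x + F d x)
     (fun x => T1 x + d * derive1 P x + derive1 (F d) x) lam (fun x => dU 0%N x isT) _ _ expand _ (cl_s HTl) _ (cl_n HTl).
  - by apply: (is_derive_continuous (f' := fun x => T2 x + d * derive1n 2 P x + derive1n 2 (F d) x)) => x; exact: (dU 1%N).
  - by apply: lt_trans lam1; exact: ltr01.
  - by move=> x; rewrite (cl_period HTl) (pshift P cP.1) (pshift _ cFd.1); ring.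
  - have p1 : periodic (derive1 P) 1 := classC_periodic (i := 1) cP isT.
    have p2 : periodic (derive1 (F d)) 1 := classC_periodic (i := 1) cFd isT.
    by move=> x; rewrite (cl_periodic HTl) p1 p2.
  exists Wd => _; split; [exact: HWd|exact: expand|].
  have dU1 (x : R) : is_derive x 1 (fun x => T1 x + d * derive1 P x + derive1 (F d) x)
     (T2 x + d * derive1n 2 P x + derive1n 2 (F d) x) by exact: (dU 1%N).
  exact: (distortion_bound dU1 lam1 expand U2M).
have [W HW'] := choice HW.
exists d1, W; split => //; first by rewrite !ge_min lexx.
by rewrite !ge_min lexx !orbT.
Qed.

(** Sets of the circle are invariant under integer translations, so lifts that
    agree modulo 1 have the same invariant densities. *)
Lemma invariant_density_mod (T' U : R -> R) g : (forall x, exists m : int, T' x = U x + m%:~R) ->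
  invariant_density U g -> invariant_density T' g.
Proof.
move=> TU [Lg g0 g1 gU]; split => // A cA.
rewrite -(gU A cA); congr (\int[mu]_(x in _ `&` _) g x).
apply/funext => x; apply/propext; rewrite /preimage/=; have [m ->] := TU x.
exact: circle_set_int.
Qed.

Section one_perturbation.
Variable P : R -> R.
Hypothesis cP : circle_classC 3 P.

Let dP (x : R) : is_derive x 1 P (derive1 P x). Proof. exact: (classC_derive (i := 0) x cP.2). Qed.
Let LP : LB P. Proof. exact: (classC_LB (i := 0) cP). Qed.
Let LP1 : LB (derive1 P). Proof. exact: (classC_LB (i := 1) cP). Qed.

Lemma density_response_continuous : continuous (density_response P) /\ periodic (density_response P) 1.
Proof.
have [M [M0 ph lh ih]] := source_data lam1 D0 (ed_lift HT) dT1 dT2 (ed_M2 HT) (ed_M3 HT) (ed_density HT) (ed_LB HT)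
  dP LP LP1 cP.1.
split; first exact: lip_continuous (resolvent_lip lam1 D0 (ed_lift HT) M0 ph lh ih).
exact: (resolvent_periodic (ed_lift HT) ph).
Qed.

(** Dropping the integers from the lifts of the family, one gets the maps of
    family_lifts; for them response_uniform gives uniform convergence, hence
    convergence in L^1. *)
Lemma density_response_linear_response : is_linear_response T P (density_response P).
Proof.
have [cr pr] := density_response_continuous.
split; first exact: circle_L1_continuous.
move=> dbar TT _ _ [db0 TT0 _ _ [F [cF TF FO']]].
have FO := family_remainder db0 FO'.
have [d1 [W [d10 d1le1 d1b HU]]] := family_lifts cP db0 cF FO.
have ddb d : 0 < d < d1 -> 0 < d < dbar by move=> /andP[-> h]; exact: lt_le_trans h d1b.
have FO1 i : (i <= 3)%N -> unifO d1 2 (fun d => derive1n i (F d)).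
  by move=> i3; have [C C0 H] := FO i i3; exists C => // d x dd; apply: H; exact: ddb.
pose U d x := T x + d * P x + F d x.
pose U1 d x := T1 x + d * derive1 P x + derive1 (F d) x.
pose U2 d x := T2 x + d * derive1n 2 P x + derive1n 2 (F d) x.
have dU1 d : 0 < d < d1 -> forall x : R, is_derive x 1 (U1 d) (U2 d x).
  move=> dd x; apply: is_deriveD1; last exact: (classC_derive (i := 1) x (cF d (ddb d dd)).2).
  by apply: is_deriveD1; [exact: dT1|apply: is_deriveZ1; exact: (classC_derive (i := 1) x cP.2)].
have [B _ P2B] := classC_bounded cP (isT : (2 <= 3)%N).
pose fd d := if d == 0 then f0 else acip n (U1 d) (W d).
exists fd.
have fd0 : fd 0 = f0 by rewrite /fd eqxx.
have near_d1 : \forall d \near 0^'+, 0 < d < d1.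
  near=> d; apply/andP; split; first by near: d; exact: nbhs_right_gt.
  by near: d; exact: nbhs_right_lt.
split.
- rewrite fd0; split; first exact: (acip_invariant_density lam1 D0 (ed_lift HT)).
  by move=> g; exact: (acip_unique lam1 D0 (ed_lift HT)).
- apply: filterS near_d1 => d dd; have /andP[d0 _] := dd.
  rewrite /fd gt_eqF//.
  have TU x : exists m : int, TT d x = U d x + m%:~R.
    by have [m ->] := TF d x (ddb d dd); exists m.
  have UT x : exists m : int, U d x = TT d x + m%:~R.
    by have [m ->] := TU x; exists (- m); rewrite intrN addrK.
  split.
    exact: invariant_density_mod TU (acip_invariant_density lam1 D0 (HU d dd)).
  move=> g ig; apply: (acip_unique lam1 D0 (HU d dd)).
  exact: invariant_density_mod UT ig.
- apply: cvg_at_right_e => [d|e e0]; first by apply: integral_ge0 => x _; rewrite lee_fin.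
  have H := @response_uniform R lam (M2 + 1) lam1 D0 n s T T1 T2 T3 V M2 M3 (ed_lift HT) dT1 dT2 (ed_M2 HT)
    (ed_M3 HT) f1 (ed_density HT) (ed_LB HT) P (derive1 P) (derive1n 2 P) dP LP LP1 B P2B d1 d1le1
    F (fun d => derive1 (F d)) (fun d => derive1n 2 (F d)) U U1 U2 W HU dU1 (fun _ _ _ => erefl)
    (fun _ _ _ => erefl) (fun _ _ _ => erefl) (FO1 0%N isT) (FO1 1%N isT) (FO1 2%N isT) cP.1 e e0.
  have [d0 d00 Hd] := H.
  near=> d.
  have dd : 0 < d < d1 by near: d.
  have /andP[dpos _] := dd.
  have dd0 : d < d0 by near: d; exact: nbhs_right_lt.
  rewrite fd0 /fd gt_eqF//; apply: int_norm_bound => [x|x]; last exact: Hd.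
  apply: cvgB; last exact: cr.
  apply: cvgM; last exact: cvg_cst.
  apply: cvgB; first exact: (acip_continuous lam1 D0 (HU d dd)).
  exact: (acip_continuous lam1 D0 (ed_lift HT)).
Unshelve. all: by end_near.
Qed.

End one_perturbation.

End response_of_families.

(** * The response functional *)

Section response_estimates.
Context {R : realType}.
Implicit Types (f g P S r : R -> R).
Local Notation mu := (@lebesgue_measure R).

Variables (T : R -> R) (lam beta : R) (n : nat) (s : R) (V : R -> R) (M2 M3 : R) (f1 : R -> R).
Hypothesis HT : expanding_data T lam beta n s V M2 M3 f1.
Local Notation T1 := (derive1 T).
Local Notation T2 := (derive1n 2 T).
Local Notation T3 := (derive1n 3 T).
Local Notation f0 := (acip n T1 V).
Local Notation dr := (density_response T n V f1).

Let lam1 := ed_lam HT.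
Let M20 : 0 <= M2. Proof. by apply: le_trans (ed_M2 HT 0). Qed.
Let D0 : 0 < M2 + 1. Proof. by have h := M20; lra. Qed.
Let dT i (x : R) : (i < 4)%N -> is_derive x 1 (derive1n i T) (derive1n i.+1 T x).
Proof. by move=> i4; have [kT _] := ed_map HT; exact: classC_derive kT i4. Qed.
Let dT1 (x : R) : is_derive x 1 T1 (T2 x). Proof. exact: (dT (i := 1)). Qed.
Let dT2 (x : R) : is_derive x 1 T2 (T3 x). Proof. exact: (dT (i := 2)). Qed.

Let source_facts P : circle_classC 3 P -> exists M, [/\ 0 < M,
  periodic (transfer n T1 V (response_source n T1 T2 V f1 P (derive1 P))) 1,
  lip M (transfer n T1 V (response_source n T1 T2 V f1 P (derive1 P))) &
  circle_int (transfer n T1 V (response_source n T1 T2 V f1 P (derive1 P))) = 0].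
Proof.
move=> cP; apply: (source_data lam1 D0 (ed_lift HT) dT1 dT2 (ed_M2 HT) (ed_M3 HT) (ed_density HT) (ed_LB HT)
  _ (classC_LB (i := 0) cP isT) (classC_LB (i := 1) cP isT) cP.1).
by move=> x; exact: (classC_derive (i := 0) x cP.2).
Qed.

Lemma density_response_linear a b P S : circle_classC 3 P -> circle_classC 3 S ->
  forall x, dr (fun y => a * P y + b * S y) x = a * dr P x + b * dr S x.
Proof.
move=> cP cS x; have [MP [MP0 pP lP iP]] := source_facts cP; have [MS [MS0 pS lS iS]] := source_facts cS.
rewrite /density_response /response -(resolvent_linear lam1 D0 (ed_lift HT) a b MP0 pP lP iP MS0 pS lS iS).
congr (resolvent _ _ _ _ x); apply/funext => y.
rewrite -!transferZ -transferD; congr (transfer _ _ _ _ y); apply/funext => z.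
have d : is_derive z 1 (fun y => a * P y + b * S y) (a * derive1 P z + b * derive1 S z).
  by apply: is_deriveD1; apply: is_deriveZ1; [exact: (classC_derive (i := 0) z cP.2)|exact: (classC_derive (i := 0) z cS.2)].
by rewrite /response_source (derive1n_val d); ring.
Qed.

(** The source kappa involves only P and P', so derivatives of P up to order 2
    control its Lipschitz constant, hence the resolvent of L kappa. *)
Lemma density_response_bound : exists2 C, 0 <= C & forall P N, circle_classC 3 P -> 0 < N ->
  (forall i x, (i <= 2)%N -> `|derive1n i P x| <= N) -> forall x, `|dr P x| <= C * N.
Proof.
have Lf0 : LB f0.
  apply: (LB_intro (A := cone_max lam (M2 + 1)) _ (acip_lip lam1 D0 (ed_lift HT))) => x.
  have [_ fp _] := acip_cone lam1 D0 (ed_lift HT).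
  by have /andP[_] := acip_bounds lam1 D0 (ed_lift HT) x; rewrite gtr0_norm.
have cT1 := circle_map_C (ed_map HT).
have LT1 : LB T1 := classC_LB (i := 0) cT1 isT.
have LT2 : LB T2 := classC_LB (i := 1) cT1 isT.
have LTV : LB (fun x => (T1 x)^-1) := LBV (lift_ge1 lam1 (ed_lift HT)) LT1.
pose g y := f0 y / T1 y.
pose g1 y := f1 y / T1 y - f0 y * T2 y / T1 y ^+ 2.
have [G [gG lg]] : LB g := LBM Lf0 LTV.
have [G' [g1G lg1]] : LB g1.
  have h := LBB (LBM (ed_LB HT) LTV) (LBM (LBM Lf0 LT2) (LBM LTV LTV)).
  apply: (eq_ind _ LB h); apply/funext => y; rewrite /g1; field.
  exact: (cl_neq0 (ed_lift HT)).
have G0 := lip_ge0 lg; have G'0 := lip_ge0 lg1.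
pose K := n%:R * ((G * 1 + G * 1 + (G' * 1 + G' * 1)) + (G' + G) * M2) + 1.
exists (resolvent_cst lam (M2 + 1) * K).
  rewrite mulr_ge0 ?(resolvent_cst_ge0 lam1 D0)// /K addr_ge0// mulr_ge0// !addr_ge0 ?mulr1 ?mulr_ge0//.
  exact: addr_ge0.
move=> P N cP N0 PN x; rewrite -mulrA.
have [M [M0 ph lh ih]] := source_facts cP.
have dP0 (y : R) : is_derive y 1 P (derive1 P y) by exact: (classC_derive (i := 0) y cP.2).
have dP1 (y : R) : is_derive y 1 (derive1 P) (derive1n 2 P y) by exact: (classC_derive (i := 1) y cP.2).
have PN0 y : `|P y| <= N by exact: (PN 0%N).
have PN1 y : `|derive1 P y| <= N by exact: (PN 1%N).
have lP : lip N P := is_derive_lip dP0 PN1.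
have lP1 : lip N (derive1 P) := is_derive_lip dP1 (fun y => PN 2%N y isT).
have kE : response_source n T1 T2 V f1 P (derive1 P) = fun y => - (g1 y * P y + g y * derive1 P y) by [].
have lk : lip ((G * 1 + G * 1 + (G' * 1 + G' * 1)) * N) (response_source n T1 T2 V f1 P (derive1 P)).
  move=> u v; rewrite kE.
  have h1 := lipM g1G PN0 lg1 lP u v.
  have h2 := lipM gG PN1 lg lP1 u v.
  have -> : - (g1 u * P u + g u * derive1 P u) - - (g1 v * P v + g v * derive1 P v) =
    - ((g1 u * P u - g1 v * P v) + (g u * derive1 P u - g v * derive1 P v)) by ring.
  rewrite normrN; apply: le_trans (ler_normD _ _) _.
  apply: le_trans (lerD h1 h2) _; rewrite le_eqVlt; apply/orP; left; apply/eqP; ring.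
have kB y : `|response_source n T1 T2 V f1 P (derive1 P) y| <= (G' + G) * N.
  rewrite kE normrN; apply: le_trans (ler_normD _ _) _; rewrite [leRHS]mulrDl.
  by apply: lerD; rewrite normrM; exact: ler_pM.
have hl := transfer_lip lam1 (ed_lift HT) dT1 (ed_M2 HT) lk kB.
have KN : n%:R * ((G * 1 + G * 1 + (G' * 1 + G' * 1)) * N + (G' + G) * N * M2) <= K * N.
  rewrite (_ : n%:R * _ = (K - 1) * N); last by rewrite /K; ring.
  by rewrite ler_wpM2r ?(ltW N0)// gerDl oppr_le0 ler01.
have K0 : 0 < K * N.
  rewrite mulr_gt0// /K ltr_wpDl// mulr_ge0// !addr_ge0 ?mulr1 ?mulr_ge0//.
  exact: addr_ge0.
have hl' : lip (K * N) (transfer n T1 V (response_source n T1 T2 V f1 P (derive1 P))).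
  by move=> u v; apply: le_trans (hl u v) _; rewrite ler_wpM2r.
exact: (resolvent_bound lam1 D0 (ed_lift HT) K0 ph hl' ih).
Qed.

End response_estimates.

Section ae_integrals.
Context {R : realType}.
Implicit Types (f g c r : R -> R).
Local Notation mu := (@lebesgue_measure R).
Local Notation I01 := ([set` `[(0:R), (1:R)[%R] : set R).

Lemma circle_L_measurable p f : circle_L p f -> measurable_fun I01 f.
Proof.
move=> [_ /sub_Lfun_mfun]; rewrite inE/= => mf.
by apply/(measurable_restrictT f (D := I01)).
Qed.

Lemma circle_Loo_integrable c : circle_L +oo%E c -> mu.-integrable `[0, 1[ (EFin \o c).
Proof.
move=> Lc; have mc := circle_L_measurable Lc; case: Lc => pc.
move=> /sub_Lfun_finLfun; rewrite inE/= /finite_norm unlock ifT; last first.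
  apply: (@lt_le_trans _ _ (mu I01)); last by apply: le_measure; rewrite ?inE//=.
  by rewrite lebesgue_measure_itv/= lte_fin ltr01 -EFinD subr0 lte_fin ltr01.
set K := (X in (X < _)%E) => Koo; have KP : {ae mu, forall x, (`|(c \_ I01) x|%:E <= K)%E}.
  exact: ess_sup_inf.ess_sup_ge.
apply/integrableP; split; first exact/measurable_EFinP.
apply: (@le_lt_trans _ _ (\int[mu]_(x in I01) (cst `|fine K|%:E) x)%E); last first.
  by rewrite integral_cst//= lebesgue_measure_itv/= lte_fin ltr01 -EFinD subr0 mule1 ltry.
apply: ae_ge0_le_integral => //.
- by apply/measurableT_comp => //; exact/measurable_EFinP.
- by move=> x _; rewrite lee_fin.
have Fae := ae_filter_ringOfSetsType mu.
apply: filterS KP => x h xD; move: h; rewrite /patch mem_set//= => h.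
have Kf : K \is a fin_num by rewrite ge0_fin_numE// (le_trans _ h)// lee_fin.
by apply: le_trans h _; rewrite -[leLHS](fineK Kf) lee_fin ler_norm.
Qed.

Lemma circle_ae_int f g : measurable_fun I01 f -> measurable_fun I01 g -> circle_ae_eq f g ->
  circle_int f = circle_int g.
Proof.
move=> mf mg fg; congr fine; apply: ae_eq_integral => //; [exact/measurable_EFinP|exact/measurable_EFinP|].
by apply: filterS fg => x h xD; congr EFin; exact: h.
Qed.

Lemma circle_ae_L1 f g : measurable_fun I01 f -> measurable_fun I01 g ->
  (\int[mu]_(x in `[0%R, 1%R[) `|(f x - g x)%:E| = 0)%E -> circle_ae_eq f g.
Proof.
move=> mf mg /(ae_eq_integral_abs _ _) H.
have {}H : ae_eq mu I01 (fun x => (f x - g x)%:E) (cst 0%E).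
  by apply: H => //; apply/measurable_EFinP; exact: measurable_funB.
have Fae := ae_filter_ringOfSetsType mu.
apply: filterS H => x h xD; have /eqP := h xD.
by rewrite eqe subr_eq0 => /eqP.
Qed.

End ae_integrals.

Section functional.
Context {R : realType}.
Implicit Types (f g c r P S : R -> R).
Local Notation mu := (@lebesgue_measure R).
Local Notation I01 := ([set` `[(0:R), (1:R)[%R] : set R).

Lemma classC_cst n (a : R) : circle_classC n (fun=> a).
Proof.
split=> [//|]; pose F i (x : R) : R := if i is 0%N then a else 0.
have dF i (x : R) : (i < n)%N -> is_derive x 1 (F i) (F i.+1 x).
  by move=> _; case: i => [|i]; exact: is_derive_cst.
by apply: (classC_intro dF) => x; case: n {dF} => [|n]; exact: cvg_cst.
Qed.

Lemma classC_linear n (a b : R) P S : classC n P -> classC n S ->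
  classC n (fun x => a * P x + b * S x).
Proof.
move=> cP cS; apply: (@classC_intro _ (fun i x => a * derive1n i P x + b * derive1n i S x)) => [i x ik|].
  by apply: is_deriveD1; apply: is_deriveZ1; exact: classC_derive ik.
move=> x; apply: cvgD; (apply: cvgM; first exact: cvg_cst); [exact: cP.2|exact: cS.2].
Qed.

Lemma classC_weak m n P : (m <= n)%N -> classC n P -> classC m P.
Proof.
move=> mn cP; split=> [i x im|]; last exact: classC_cont mn.
by have [] := classC_derive x cP (leq_trans im mn).
Qed.

(** An admissible family exists for every P, so that being a linear response
    is never a vacuous condition. *)
Lemma linear_family T0 P : circle_map 4 T0 -> circle_classC 3 P ->
  perturbation_family T0 P 1 (fun d x => T0 x + d * P x).
Proof.
move=> [kT [m pT]] cP; have c0 k := @classC_cst k 0.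
split; [exact: ltr01|by apply/funext => x; rewrite mul0r addr0| |exact: cP|].
- move=> d _; split; last by exists m => x; rewrite pT cP.1; ring.
  have := classC_linear 1 d (classC_weak (isT : (3 <= 4)%N) kT) cP.2.
  by congr classC; apply/funext => x; rewrite mul1r.
- exists (fun _ _ => 0); split => [d _|d x _|]; first exact: c0.
    by exists 0; rewrite !addr0.
  apply: (@le_lt_trans _ _ 0%E); last by rewrite ltry.
  apply: ge_ereal_sup => _ /= [d _ <-].
  rewrite /normC big1 ?mul0e// => i _.
  have -> : derive1n i (fun=> 0 : R) = fun=> 0.
    apply: (@derive1nE _ (fun _ _ => 0) i) => // j x _; exact: is_derive_cst.
  apply/eqP; rewrite eq_le; apply/andP; split.
    by apply: ge_ereal_sup => _ /= [x _ <-]; rewrite normr0.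
  by apply: ereal_sup_ubound; exists 0 => //; rewrite normr0.
Qed.

Lemma circle_L1_integrable f : circle_L 1 f -> mu.-integrable I01 (EFin \o f).
Proof. by move=> Lf; have [pf _] := Lf; exact: (circle_L1P pf).1. Qed.

(** On the family T0 + d P both functions are L^1 limits of difference
    quotients of invariant densities, and these densities agree almost
    everywhere. *)
Lemma linear_response_unique T0 P r r' : circle_map 4 T0 -> expanding T0 -> circle_classC 3 P ->
  is_linear_response T0 P r -> is_linear_response T0 P r' -> circle_ae_eq r r'.
Proof.
move=> cT eT cP [Lr Hr] [Lr' Hr'].
have fam := linear_family cT cP; pose TT d x := T0 x + d * P x.
have TT0 : (fun x => T0 x + 0 * P x) = T0 by apply/funext => x; rewrite mul0r addr0.
have [||f [[i0 u0] fd fr]] := Hr _ _ _ _ fam; rewrite ?TT0//.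
have [||f' [[i0' u0'] fd' fr']] := Hr' _ _ _ _ fam; rewrite ?TT0//.
apply: circle_ae_L1; [exact: circle_L_measurable Lr|exact: circle_L_measurable Lr'|].
have H : \forall d \near 0^'+, (\int[mu]_(x in I01) `|(r x - r' x)%:E| <=
   \int[mu]_(x in I01) `|(f d x - f 0 x) / d - r x|%:E +
   \int[mu]_(x in I01) `|(f' d x - f' 0 x) / d - r' x|%:E)%E.
  apply: filterS2 fd fd' => d [[Lfd _ _ _] ufd] fd'; have [[Lfd' _ _ _] _] := fd'.
  have [Lf0 _ _ _] := i0; have [Lf0' _ _ _] := i0'.
  have e0 := u0 _ i0'; have ed := ufd _ fd'.1.
  have m1 : measurable_fun I01 (fun x => (f d x - f 0 x) / d - r x).
    apply: measurable_funB; last exact: circle_L_measurable Lr.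
    by apply: measurable_funM => //; apply: measurable_funB; apply: circle_L_measurable; eassumption.
  have m2 : measurable_fun I01 (fun x => (f' d x - f' 0 x) / d - r' x).
    apply: measurable_funB; last exact: circle_L_measurable Lr'.
    by apply: measurable_funM => //; apply: measurable_funB; apply: circle_L_measurable; eassumption.
  have n1 : measurable_fun I01 (fun x => `|(f d x - f 0 x) / d - r x|%:E).
    by apply/measurable_EFinP; exact: measurableT_comp.
  have n2 : measurable_fun I01 (fun x => `|(f' d x - f' 0 x) / d - r' x|%:E).
    by apply/measurable_EFinP; exact: measurableT_comp.
  rewrite -ge0_integralD//.
  apply: ae_ge0_le_integral => //.
  - apply: measurableT_comp => //; apply/measurable_EFinP; apply: measurable_funB; [exact: circle_L_measurable Lr|exact: circle_L_measurable Lr'].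
  - by move=> x _; rewrite adde_ge0.
  - exact: emeasurable_funD.
  have Fae := ae_filter_ringOfSetsType mu.
  apply: filterS2 e0 ed => x h1 h2 xD; rewrite /= -EFinD lee_fin h1// h2//.
  set z := (f' d x - f' 0 x) / d.
  have -> : r x - r' x = (z - r' x) - (z - r x) by ring.
  by have := ler_normB (z - r' x) (z - r x); lra.
have h := cvgeD (isT : (0%E +? 0%E)%E) fr fr'; rewrite adde0 in h.
have {}h := h ltac:(typeclasses eauto).
apply/eqP; rewrite eq_le integral_ge0 ?andbT//.
rewrite -(cvg_lim _ h)//; apply: lime_ge; first exact: cvgP h.
exact: H.
Qed.

Lemma circle_integrableM c f B : mu.-integrable I01 (EFin \o c) -> measurable_fun I01 f ->
  (forall x, `|f x| <= B) -> mu.-integrable I01 (EFin \o (fun x => c x * f x)).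
Proof.
move=> ic mf fB; have mc : measurable_fun I01 c by apply/measurable_EFinP; case/integrableP: ic.
apply: (@le_integrable _ _ _ mu _ _ _ (fun x => (B%:E * (c x)%:E)%E)) => //.
- by apply/measurable_EFinP; exact: measurable_funM.
- move=> x _; rewrite /= lee_fin mulrC !normrM ler_wpM2r//; apply: le_trans (fB x) _; exact: ler_norm.
- exact: integrableZl.
Qed.

Lemma circle_int_mul_bound c f B : mu.-integrable I01 (EFin \o c) -> measurable_fun I01 f ->
  (forall x, `|f x| <= B) -> `|circle_int (fun x => c x * f x)| <= circle_int (fun x => `|c x|) * B.
Proof.
move=> ic mf fB; have icf := circle_integrableM ic mf fB.
have iac : mu.-integrable I01 (EFin \o (fun x => `|c x|)) by exact: integrable_norm.
apply: le_trans (le_normr_Rintegral _ icf) _ => //.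
rewrite /circle_int -RintegralZr//; apply: le_Rintegral => //.
- exact: integrable_norm.
- apply: (@eq_integrable _ _ _ mu _ _ (fun x => (`|c x|%:E * B%:E)%E)) => //; exact: integrableZr.
- by move=> x _; rewrite normrM ler_wpM2l.
Qed.

Variables (T0 c : R -> R).
Hypotheses (cT : circle_map 4 T0) (eT : expanding T0) (Lc : circle_L +oo%E c).

(** The linear response is determined up to a null set, so it may be replaced
    by the explicit density_response inside the integral. *)
Lemma responseJ_eq lam beta n s V M2 M3 f1 P : expanding_data T0 lam beta n s V M2 M3 f1 ->
  circle_classC 3 P -> responseJ c T0 P = - circle_int (fun x => c x * density_response T0 n V f1 P x).
Proof.
move=> HT cP; have H := density_response_linear_response HT cP.
have [cr pr] := density_response_continuous HT cP.
have Hx : is_linear_response T0 P (linear_response T0 P).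
  by rewrite /linear_response; apply: (xgetPex (cst 0) (P := [set r | is_linear_response T0 P r])); exists (density_response T0 n V f1 P).
have ae := linear_response_unique cT eT cP Hx H.
congr (- _); have mc := circle_L_measurable Lc.
apply: circle_ae_int.
- by apply: measurable_funM => //; exact: circle_L_measurable Hx.1.
- by apply: measurable_funM => //; exact: circle_L_measurable H.1.
- have Fae := ae_filter_ringOfSetsType mu.
  by apply: filterS ae => x h xD; rewrite h.
Qed.

Lemma responseJ_linear a b P S : circle_classC 3 P -> circle_classC 3 S ->
  responseJ c T0 (fun x => a * P x + b * S x) = a * responseJ c T0 P + b * responseJ c T0 S.
Proof.
move=> cP cS; have [lam [beta [n [s [V [M2 [M3 [f1 HT]]]]]]]] := expanding_data_exists cT eT.
have distr3 (u p q : R) : u * (a * p + b * q) = a * (u * p) + b * (u * q) by ring.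
have opp_comb (p q x y : R) : x = - p -> y = - q -> - (a * p + b * q) = a * x + b * y by move=> -> ->; ring.
have cPS : circle_classC 3 (fun x => a * P x + b * S x).
  by split; [move=> x; rewrite cP.1 cS.1|exact: classC_linear cP.2 cS.2].
have ic := circle_Loo_integrable Lc.
have int Q : circle_classC 3 Q -> mu.-integrable I01 (EFin \o (fun x => c x * density_response T0 n V f1 Q x)).
  move=> cQ; have [cr pr] := density_response_continuous HT cQ.
  have [B _ rB] := continuous_periodic_bounded cr pr.
  apply: circle_integrableM ic _ rB; apply: measurable_funTS; exact: continuous_measurable_fun.
set wP := fun x : R => c x * density_response T0 n V f1 P x.
set wS := fun x : R => c x * density_response T0 n V f1 S x.
have E : circle_int (fun x => c x * density_response T0 n V f1 (fun y => a * P y + b * S y) x) =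
    a * circle_int wP + b * circle_int wS.
  rewrite /circle_int -!RintegralZl//; [|exact: int|exact: int].
  rewrite -RintegralD//; last 2 first.
  - apply: (@eq_integrable _ _ _ mu _ _ (fun x => (a%:E * (wP x)%:E)%E)) => //.
    exact: integrableZl (int P cP).
  - apply: (@eq_integrable _ _ _ mu _ _ (fun x => (b%:E * (wS x)%:E)%E)) => //.
    exact: integrableZl (int S cS).
  apply: eq_Rintegral => x _; rewrite (density_response_linear HT a b cP cS).
  exact: distr3.
have EP : responseJ c T0 P = - circle_int wP by exact: (responseJ_eq HT cP).
have ES : responseJ c T0 S = - circle_int wS by exact: (responseJ_eq HT cS).
exact: (etrans (responseJ_eq HT cPS) (etrans (congr1 (fun z : R => - z) E) (opp_comb _ _ _ _ EP ES))).
Qed.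

Lemma responseJ_bound : exists2 C, 0 <= C & forall P N, circle_classC 3 P -> 0 < N ->
  (forall i x, (i <= 2)%N -> `|derive1n i P x| <= N) -> `|responseJ c T0 P| <= C * N.
Proof.
have [lam [beta [n [s [V [M2 [M3 [f1 HT]]]]]]]] := expanding_data_exists cT eT.
have [C C0 H] := density_response_bound HT; have ic := circle_Loo_integrable Lc.
exists (circle_int (fun x => `|c x|) * C).
  by rewrite mulr_ge0//; apply: fine_ge0; apply: integral_ge0 => x _; rewrite lee_fin.
move=> P N cP N0 PN; rewrite (responseJ_eq HT)// normrN -mulrA.
have [cr pr] := density_response_continuous HT cP.
apply: (circle_int_mul_bound ic _ (H P N cP N0 PN)).
apply: measurable_funTS; exact: continuous_measurable_fun.
Qed.

End functional.

(** * The fundamental lemma of the calculus of variations *)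

Section smooth_closure.
Context {R : realType}.
Implicit Types (f g : R -> R).

Lemma classC_succ n f f' : (forall x : R, is_derive x 1 f (f' x)) -> classC n f' -> classC n.+1 f.
Proof.
move=> df cf'; pose F i := if i is j.+1 then derive1n j f' else f.
apply: (@classC_intro _ F); last by case: cf'.
by case=> [x _|i x]; [exact: df|rewrite ltnS => /(classC_derive x cf')].
Qed.

Lemma classC_pred n f : classC n.+1 f -> (forall x : R, is_derive x 1 f (derive1 f x)) /\ classC n (derive1 f).
Proof.
move=> cf; split=> [x|]; first exact: (classC_derive (i := 0) x cf).
apply: (@classC_intro _ (fun i => derive1n i.+1 f)); last by case: cf.
by move=> i x ik; exact: classC_derive x cf _.
Qed.

Lemma classCM n f g : classC n f -> classC n g -> classC n (fun x => f x * g x).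
Proof.
elim: n f g => [|n IH] f g cf cg.
  by split=> // x; apply: cvgM; [exact: cf.2|exact: cg.2].
have [df cf'] := classC_pred cf; have [dg cg'] := classC_pred cg.
have dfg (x : R) : is_derive x 1 (fun x => f x * g x) (derive1 f x * g x + f x * derive1 g x).
  exact: is_deriveM1.
apply: (classC_succ dfg).
have w := leqnSn n; have := classC_linear 1 1 (IH _ _ cf' (classC_weak w cg)) (IH _ _ (classC_weak w cf) cg').
by congr classC; apply/funext => x; rewrite !mul1r.
Qed.

Lemma is_derive_affine (a b x : R) : is_derive x 1 (fun y : R => a * y + b) a.
Proof.
have h := is_deriveD1 (is_deriveZ1 a (is_derive_id x 1)) (is_derive_cst b x 1).
by apply: is_derive_eq h _; rewrite mulr1 addr0.
Qed.

Lemma trig_classC n (a b : R) : classC n (fun x => cos (a * x + b)) /\ classC n (fun x => sin (a * x + b)).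
Proof.
have dc (x : R) : is_derive x 1 (fun x => cos (a * x + b)) (- sin (a * x + b) * a).
  by apply: (is_derive_comp (f := cos) (f' := fun y => - sin y)); exact: is_derive_affine.
have ds (x : R) : is_derive x 1 (fun x => sin (a * x + b)) (cos (a * x + b) * a).
  by apply: (is_derive_comp (f := sin) (f' := cos)); exact: is_derive_affine.
elim: n => [|n [IHc IHs]].
  by split; (split=> [//|]); [exact: is_derive_continuous dc|exact: is_derive_continuous ds].
split.
  apply: (classC_succ dc); have := classC_linear (- a) 0 IHs IHs.
  by congr classC; apply/funext => x; ring.
apply: (classC_succ ds); have := classC_linear a 0 IHc IHc.
by congr classC; apply/funext => x; ring.
Qed.

(** The function p = 1 / (1 + exp (- f)) satisfies p' = f' p (1 - p), so each
    derivative is gained by induction. *)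
Lemma logistic_classC n f : (forall n, classC n f) -> classC n (fun x => (1 + expR (- f x))^-1).
Proof.
move=> cf; have cf' m : classC m (derive1 f) by exact: (classC_pred (cf m.+1)).2.
have e0 x : 1 + expR (- f x) != 0 by rewrite gt_eqF// addr_gt0// expR_gt0.
have df0 (x : R) : is_derive x 1 f (derive1 f x) by exact: (classC_pred (cf 1%N)).1.
pose p x := (1 + expR (- f x))^-1.
have dp (x : R) : is_derive x 1 p (derive1 f x * (p x * (1 - p x))).
  have de : is_derive x 1 (fun x => expR (- f x)) (expR (- f x) * - derive1 f x).
    by apply: (is_derive_comp (f := expR) (f' := expR)); exact: is_deriveN.
  have d1 := is_deriveD1 (is_derive_cst (1 : R) x 1) de.
  have h := is_deriveV1 (f := fun x => 1 + expR (- f x)) (e0 x) d1.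
  by apply: is_derive_eq h _; rewrite /p; field.
elim: n => [|n IH]; first by split=> //; exact: is_derive_continuous dp.
apply: (classC_succ dp); apply: classCM => //; apply: classCM => //.
have := classC_linear 1 (-1) (classC_cst n (1 : R)).2 IH.
by congr classC; apply/funext => x; rewrite mul1r mulN1r.
Qed.

End smooth_closure.

Section fundamental_lemma.
Context {R : realType}.
Implicit Types (f g phi : R -> R).
Local Notation mu := (@lebesgue_measure R).
Local Notation I01 := ([set` `[(0:R), (1:R)[%R] : set R).

Definition test_function phi := forall n, circle_classC n phi.

(** A trigonometric polynomial that is positive on ]0, b[ and negative on ]b,
    1[. *)
Definition bump (b x : R) : R := cos (2 * pi * x - pi * b) - cos (pi * b).

Lemma bump_prod b x : bump b x = 2 * (sin (pi * x) * sin (pi * b - pi * x)).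
Proof.
have cc u v : cos (u - v) - cos (u + v) = 2 * (sin u * sin v) :> R by rewrite cosB cosD; ring.
by rewrite -cc /bump; congr (cos _ - cos _); ring.
Qed.

Lemma bump_gt0 b x : 0 < b < 1 -> 0 < x < b -> 0 < bump b x.
Proof.
move=> /andP[b0 b1] /andP[x0 xb]; rewrite bump_prod; have p0 := pi_gt0 R.
rewrite mulr_gt0// mulr_gt0// sin_gt0_pi//; apply/andP; split.
- by rewrite mulr_gt0.
- by rewrite gtr_pMr// (lt_trans xb).
- by rewrite subr_gt0 ltr_pM2l.
- by rewrite -mulrBr gtr_pMr//; lra.
Qed.

Lemma bump_lt0 b x : 0 < b < 1 -> b < x < 1 -> bump b x < 0.
Proof.
move=> /andP[b0 b1] /andP[x0 xb]; rewrite bump_prod; have p0 := pi_gt0 R.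
have -> : pi * b - pi * x = - (pi * x - pi * b) by ring.
rewrite sinN !mulrN oppr_lt0 mulr_gt0// mulr_gt0// sin_gt0_pi//; apply/andP; split.
- by rewrite mulr_gt0// (lt_trans b0).
- by rewrite gtr_pMr.
- by rewrite subr_gt0 ltr_pM2l.
- by rewrite -mulrBr gtr_pMr//; lra.
Qed.

(** Smooth periodic functions with values in [0, 1] that converge to the
    indicator of ]0, b[ as N grows, except at 0 and b. *)
Definition step (b : R) (N : nat) x : R := (1 + expR (- (N%:R * bump b x)))^-1.

Lemma step_test b N : test_function (step b N).
Proof.
move=> n; split; last first.
  apply: logistic_classC => m.
  have := classC_linear (N%:R) (- (N%:R * cos (pi * b))) (trig_classC m (2 * pi) (- (pi * b))).1 (classC_cst m (1 : R)).2.
  by congr classC; apply/funext => x; rewrite /bump; ring.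
move=> x; rewrite /step /bump; do 4 congr (_ _); congr (_ * (_ - _)).
rewrite -(cosD2pi (2 * pi * x - pi * b)); congr cos.
by rewrite mulrDr mulr1 -mulr_natr; ring.
Qed.

Lemma step_bound b N x : `|step b N x| <= 1.
Proof.
have e0 := expR_gt0 (- (N%:R * bump b x)).
by rewrite /step normfV gtr0_norm ?invf_le1 ?addr_gt0// lerDl ltW.
Qed.

Lemma step_cvg b x : 0 < b < 1 -> 0 <= x < 1 -> x != 0 -> x != b ->
  step b N x @[N --> \oo] --> (if x < b then 1 else 0 : R).
Proof.
move=> b01 /andP[x0 x1] xn0 xb; have xp : 0 < x by rewrite lt_neqAle eq_sym xn0.
have inv0 (t : R) : 0 < t -> (1 + expR (N%:R * t))^-1 @[N --> \oo] --> (0 : R).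
  move=> t0; have ti : 0 < t^-1 by rewrite invr_gt0.
  apply: (@squeeze_cvgr _ _ _ _ (fun=> 0) (fun N => (t^-1 + 1) * N.+1%:R^-1)).
  - apply: nearW => N; have h := expR_ge1Dx (N%:R * t); have e0 := expR_gt0 (N%:R * t).
    rewrite invr_ge0 addr_ge0 ?expR_ge0//= ler_pdivlMr// ler_pdivrMl ?addr_gt0//.
    have h2 : (1 + N%:R * t) * (t^-1 + 1) <= expR (N%:R * t) * (t^-1 + 1).
      by rewrite ler_wpM2r// addr_ge0// ltW.
    have h3 : (1 + N%:R * t) * (t^-1 + 1) = t^-1 + 1 + N%:R + N%:R * t by field; rewrite gt_eqF.
    have h4 : 0 <= N%:R * t by rewrite mulr_ge0// ltW.
    rewrite -natr1 mulrDl; lra.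
  - exact: cvg_cst.
  - have := cvgMr (a := t^-1 + 1) (@cvg_harmonic R); rewrite mulr0; exact.
case: ltP => hx.
  have t0 : 0 < bump b x by apply: bump_gt0; rewrite ?xp.
  have -> : (fun N => step b N x) = fun N : nat => 1 - (1 + expR (N%:R * bump b x))^-1.
    apply/funext => N; rewrite /step expRN; field.
    by rewrite !gt_eqF ?addr_gt0 ?expR_gt0.
  by rewrite -[X in _ --> X]subr0; apply: cvgB; [exact: cvg_cst|exact: inv0].
have t0 : 0 < - bump b x by rewrite oppr_gt0 bump_lt0// x1 andbT lt_neqAle eq_sym xb hx.
have -> : (fun N => step b N x) = fun N : nat => (1 + expR (N%:R * - bump b x))^-1.
  by apply/funext => N; rewrite /step mulrN.
exact: inv0.
Qed.

Definition pairing_zero g := forall phi, test_function phi -> circle_int (fun x => g x * phi x) = 0.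

(** Dominated convergence along the test functions step b N. *)
Lemma pairing_zero_int g b : mu.-integrable I01 (EFin \o g) -> pairing_zero g -> 0 < b < 1 ->
  \int[mu]_(x in `]0, b[) g x = 0.
Proof.
move=> ig Hg b01; have mg : measurable_fun I01 g by apply/measurable_EFinP; case/integrableP: ig.
have mstep N : measurable_fun I01 (step b N).
  apply: measurable_funTS; apply: continuous_measurable_fun.
  exact: (classC_cont (i := 0) (step_test b N 0).2).
pose A := ([set` `]-oo, b[%R] : set R).
have mA : measurable_fun I01 (g \_ A).
  have mA0 : measurable A by exact: measurable_itv.
  apply/measurable_restrict => //.
  apply: (measurable_funS _ _ mg) => //; exact: subIsetl.
have gA x : (g \_ A) x = g x * (if x < b then 1 else 0).
  rewrite /patch; case: ifPn; rewrite /A.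
    by rewrite inE/= in_itv/= => ->; rewrite mulr1.
  by move=> /negP h; case: ltP => //; last (by rewrite mulr0); move=> xb; case: h; rewrite inE/= in_itv.
have Fae := ae_filter_ringOfSetsType mu.
have ae_ne (z : R) : {ae mu, forall x, x != z}.
  exists [set z]; split => //; first exact: lebesgue_measure_set1.
  by move=> x /= /negP; rewrite negbK => /eqP ->.
have [||||||_ _ H] := @dominated_convergence _ _ _ mu I01 _
  (fun N x => (g x * step b N x)%:E) (EFin \o (g \_ A)) (fun x => `|(g x)%:E|%E).
- by [].
- by move=> N; apply/measurable_EFinP; exact: (measurable_funM mg (mstep N)).
- exact/measurable_EFinP.
- apply: filterS2 (ae_ne 0) (ae_ne b) => x x0 xb; rewrite /= in_itv/= => x01.
  apply: cvg_EFin; first by apply: nearW.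
  rewrite /= gA; apply: cvgMr; exact: step_cvg.
- exact: integrable_abse.
- apply: aeW => x N _; rewrite lee_fin normrM ler_piMr//; exact: step_bound.
have E : \int[mu]_(x in I01) (g \_ A) x = 0.
  rewrite /Rintegral -(cvg_lim _ H)//.
  rewrite (_ : (fun n => _) = fun=> 0%E); first by rewrite lim_cst.
  apply/funext => N; have := Hg _ (step_test b N); rewrite /circle_int /Rintegral.
  move=> h; rewrite -[LHS]fineK ?h//.
  apply: integrable_fin_num => //.
  have := circle_integrableM ig (mstep N) (step_bound b N); exact.
have IA : I01 `&` A = [set` `[0, b[].
  apply/seteqP; split => x; rewrite /A/= !in_itv/=; first by move=> [/andP[-> _] ->].
  by move=> /andP[-> xb]; rewrite xb (lt_trans xb)// (andP b01).2.
rewrite Rintegral_itv_obnd_cbnd; last first.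
  by apply: (integrableS _ _ _ ig) => //; move=> x /=; rewrite !in_itv/= => /andP[/ltW -> xb]; rewrite (lt_trans xb)// (andP b01).2.
rewrite -IA -[RHS]E /Rintegral; congr fine.
rewrite integral_mkcondr; apply: eq_integral => x _; by rewrite restrict_EFin.
Qed.

(** All integrals of g over ]0, b[ vanish, and by Lebesgue differentiation g
    is almost everywhere the derivative of b |-> int_0^b g. *)
Lemma pairing_zero_ae g : circle_L 1 g -> pairing_zero g -> circle_ae_eq g (cst 0).
Proof.
move=> Lg Hg; have ig := circle_L1_integrable Lg; have Fae := ae_filter_ringOfSetsType mu.
pose g' := g \_ I01.
have ig' : mu.-integrable setT (EFin \o g').
  exact: (Lfun1_integrable _ _).1 Lg.2.
have ig'S D : measurable D -> mu.-integrable D (EFin \o g').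
  by move=> mD; apply: (integrableS measurableT).
have H := FTC1 (a := BLeft 0) (fun y => ig'S _ (measurable_itv _)) (integrable_locally _ ig).
have {H} := H (measurable_itv _).
set F := (fun y => _) => H.
have F0 x : 0 < x < 1 -> F x = 0.
  move=> x01; have /andP[x0 x1] := x01.
  rewrite -(pairing_zero_int ig Hg x01) /F -Rintegral_itv_bndo_bndc; last exact: ig'S.
  rewrite -Rintegral_itv_obnd_cbnd; last by apply: ig'S.
  apply: eq_Rintegral => y; rewrite inE/= in_itv/= => /andP[y0 yx].
  by rewrite /g' patchT// inE/= in_itv/= ltW//= (lt_trans yx).
have ne0 : {ae mu, forall x : R, x != 0}.
  exists [set 0]; split => //; first exact: lebesgue_measure_set1.
  by move=> x /= /negP; rewrite negbK => /eqP ->.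
apply: filterS2 ne0 H => x xn H; rewrite /= in_itv/= => /andP[x0 x1].
have xp : 0 < x by rewrite lt_neqAle eq_sym xn.
have [|_] := H; first by rewrite /= lte_fin.
rewrite /g' patchT ?inE/= ?in_itv/= ?x0 ?x1// => <-.
have nF : {near x, F =1 (cst 0 : R -> R)}.
  have : \forall y \near x, y \in `]0, 1[ by apply: near_in_itvoo; rewrite in_itv/= xp.
  by apply: filterS => y; rewrite in_itv/= => /F0.
by rewrite derive1E (near_eq_derive _ nF)// derive_cst.
Qed.

End fundamental_lemma.

(** * Primitives of integrable functions *)

Section primitives.
Context {R : realType}.
Implicit Types (f g u v p phi : R -> R).
Local Notation mu := (@lebesgue_measure R).
Local Notation I01 := ([set` `[(0:R), (1:R)[%R] : set R).

Definition L1norm v : R := circle_int (fun x => `|v x|).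

(** The oriented integral from 0 is, near x, an integral from a point b to the
    left of 0 and x minus a constant. *)
Lemma continuous_primitive p : continuous p -> exists2 P : R -> R, (forall x : R, is_derive x 1 P (p x)) & P 0 = 0.
Proof.
move=> cp.
pose F b x : R := \int[mu]_(t in `[b, x]) p t.
have dF (b x : R) : b < x -> is_derive x 1 (F b) (p x).
  move=> bx; have h1 : x < x + 1 by rewrite ltrDl.
  have h2 : mu.-integrable `[b, x + 1] (EFin \o p) by exact: continuous_integrable.
  have [d1 d2] := continuous_FTC1_closed h1 h2 bx (cp x).
  by apply: DeriveDef; [exact: d1|rewrite -derive1E; exact: d2].
pose P x : R := if 0 <= x then \int[mu]_(t in `]0, x]) p t else - \int[mu]_(t in `]x, 0]) p t.
have PF b x : b < 0 -> b < x -> P x = F b x - F b 0.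
  move=> b0 bx; have ii (y z : R) : mu.-integrable `[y, z] (EFin \o p) by exact: continuous_integrable.
  rewrite /P /F; case: ifPn => [x0|].
    by rewrite Rintegral_itvB// bnd_simp// ltW.
  by rewrite -ltNge => x0; rewrite -opprB Rintegral_itvB// bnd_simp// ltW.
exists P => [x|]; last by rewrite /P lexx set_itv_ge ?Rintegral_set0// bnd_simp ltxx.
pose b : R := - (`|x| + 1).
have b0 : b < 0 by rewrite oppr_lt0 ltr_wpDl.
have bx : b < x by rewrite /b; have := ler_norm (- x); rewrite normrN; lra.
have nP : {near x, P =1 (fun y => F b y - F b 0)}.
  have : \forall y \near x, b < y by exact: lt_nbhsr.
  by apply: filterS => y yb; exact: PF.
have dd : is_derive x 1 (fun y => F b y - F b 0) (p x).
  by apply: is_derive_eq (is_deriveB1 (dF b x bx) (is_derive_cst (F b 0) x 1)) _; rewrite subr0.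
have [d1 d2] := dd; apply: DeriveDef.
  by apply: near_eq_derivable d1; apply: filterS nP => y ->.
by rewrite (near_eq_derive _ nP).
Qed.

Lemma L1norm_ge0 v : 0 <= L1norm v.
Proof. by apply: fine_ge0; apply: integral_ge0 => x _; rewrite lee_fin. Qed.

Lemma circle_int_le_L1 v : mu.-integrable I01 (EFin \o v) -> `|circle_int v| <= L1norm v.
Proof. by move=> iv; exact: le_normr_Rintegral. Qed.

Lemma L1normB u v : mu.-integrable I01 (EFin \o u) -> mu.-integrable I01 (EFin \o v) ->
  L1norm (fun x => u x - v x) <= L1norm u + L1norm v.
Proof.
move=> iu iv; rewrite /L1norm /circle_int -RintegralD//; try exact: integrable_norm.
apply: le_Rintegral => //.
- have h := integrable_norm (integrableB _ iu iv); exact: h.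
- have h := integrableD _ (integrable_norm iu) (integrable_norm iv); exact: h.
- by move=> x _; exact: ler_normB.
Qed.

Lemma geometric_limit_continuous (P : nat -> R -> R) V C q : 0 <= q < 1 -> (forall N, continuous (P N)) ->
  (forall N x, `|P N x - V x| <= C * q ^+ N) -> continuous V.
Proof.
move=> q01 cP PV x; apply/cvgrPdist_lt => e e0.
have [N CN] := geometric_small C q01 (divr_gt0 e0 (ltr0n _ 3)).
have /cvgrPdist_lt/(_ (e / 3)) := cP N x; rewrite divr_gt0// => /(_ isT).
apply: filterS => y h; have h1 := PV N x; have h2 := PV N y.
have -> : V x - V y = (P N x - P N y) - (P N x - V x) + (P N y - V y) by ring.
apply: le_lt_trans (ler_normD _ _) _; have := ler_normB (P N x - P N y) (P N x - V x); lra.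
Qed.

(** Zero mean makes the primitive periodic, so two points may be moved into
    one period, over part of which the increment is an integral of p. *)
Lemma primitive_osc p P : continuous p -> periodic p 1 -> circle_int p = 0 ->
  (forall x : R, is_derive x 1 P (p x)) -> periodic P 1 /\ forall x y, `|P x - P y| <= L1norm p.
Proof.
move=> cp pp p0 dP.
have pP : periodic P 1.
  move=> x; have d0 (y : R) : is_derive y 1 (fun y => P (y + 1) - P y) ((fun=> 0) y).
    by apply: is_derive_eq (is_deriveB1 (is_derive_shift1 y 1 dP) (dP y)) _; rewrite pp subrr.
  have [c] := mean_value 0 x d0; rewrite mul0r => /eqP; rewrite subr_eq0 add0r => /eqP E.
  apply/eqP; rewrite -subr_eq0 E -(Rintegral_FTC2 ler01 cp dP) -Rintegral_cotocc//.
  exact/eqP.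
split => //.
have key x y : 0 <= y -> y <= x -> x < 1 -> `|P x - P y| <= L1norm p.
  move=> y0 yx x1; rewrite -(Rintegral_FTC2 yx cp dP).
  have ip : mu.-integrable `[y, x] (EFin \o p) by exact: continuous_integrable.
  apply: le_trans (le_normr_Rintegral _ ip) _ => //.
  have ip01 : mu.-integrable I01 (EFin \o p) by exact: continuous_integrable.
  rewrite /L1norm /circle_int /Rintegral; apply: fine_le.
  - by apply: integrable_fin_num => //; exact: integrable_norm.
  - by apply: integrable_fin_num => //; exact: integrable_norm.
  apply: ge0_subset_integral => //.
  - by apply/measurable_EFinP; apply: measurableT_comp => //; apply: measurable_funTS; exact: continuous_measurable_fun.
  - by move=> z /=; rewrite !in_itv/= => /andP[/(le_trans y0) -> /le_lt_trans ->].
move=> x y; have [m /andP[x0 x1]] := frac01 x; have [l /andP[y0 y1]] := frac01 y.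
rewrite -(periodic1_int m pP) -(periodic1_int l pP y).
case/orP: (le_total (y + l%:~R) (x + m%:~R)) => h; first exact: key.
by rewrite distrC; exact: key.
Qed.

Lemma smooth_by_parts p P phi phi' : continuous p -> (forall x : R, is_derive x 1 P (p x)) -> periodic P 1 ->
  (forall x : R, is_derive x 1 phi (phi' x)) -> continuous phi' -> periodic phi 1 ->
  circle_int (fun x => P x * phi' x) = - circle_int (fun x => p x * phi x).
Proof.
move=> cp dP pP dphi cphi' pphi.
have cP := is_derive_continuous dP; have cphi := is_derive_continuous dphi.
have c1 : continuous (fun x => p x * phi x) by move=> x; apply: cvgM; [exact: cp|exact: cphi].
have c2 : continuous (fun x => P x * phi' x) by move=> x; apply: cvgM; [exact: cP|exact: cphi'].
apply/eqP; rewrite -subr_eq0 opprK addrC -circle_intD//; apply/eqP.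
have d (x : R) : is_derive x 1 (fun x => P x * phi x) (p x * phi x + P x * phi' x) by exact: is_deriveM1.
have c12 : continuous (fun x => p x * phi x + P x * phi' x) by move=> x; apply: cvgD; [exact: c1|exact: c2].
rewrite /circle_int Rintegral_cotocc// (Rintegral_FTC2 ler01 c12 d).
by have := pP 0; have := pphi 0; rewrite !add0r => -> ->; rewrite subrr.
Qed.

Lemma zero_mean_approx v e : circle_L 1 v -> circle_int v = 0 -> 0 < e -> exists p,
  [/\ continuous p, periodic p 1, circle_int p = 0 & L1norm (fun x => v x - p x) <= e].
Proof.
move=> Lv v0 e0; have iv := circle_L1_integrable Lv.
have [M [p [pp lp H]]] := lip_dense iv (divr_gt0 e0 (ltr0n _ 2)).
have cp := lip_continuous lp.
have ip : mu.-integrable I01 (EFin \o p) by exact: continuous_integrable.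
have ivp : mu.-integrable I01 (EFin \o (fun x => v x - p x)).
  by have h := integrableB _ iv ip; exact: h.
have h1 : L1norm (fun x => v x - p x) <= e / 2.
  by rewrite -lee_fin fineK ?ltW//; apply: integrable_fin_num => //; exact: integrable_norm.
have h2 : `|circle_int p| <= e / 2.
  have -> : circle_int p = - circle_int (fun x => v x - p x).
    by rewrite /circle_int RintegralB//= -/(circle_int v) v0 sub0r opprK.
  by rewrite normrN; apply: le_trans (circle_int_le_L1 ivp) h1.
have cc : continuous (fun _ : R => circle_int p) by move=> x; exact: cvg_cst.
exists (fun x => p x - circle_int p); split.
- by move=> x; apply: cvgB; [exact: cp|exact: cvg_cst].
- by move=> x; rewrite pp.
- by rewrite circle_intB// circle_int_cst subrr.
- have -> : (fun x => v x - (p x - circle_int p)) = fun x => (v x - p x) - - circle_int p.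
    by apply/funext => x; ring.
  have iK : mu.-integrable I01 (EFin \o (fun=> - circle_int p)).
    by apply: continuous_integrable => x; exact: cvg_cst.
  apply: le_trans (L1normB ivp iK) _.
  rewrite [X in _ + X](_ : _ = `|circle_int p|); first by lra.
  by rewrite /L1norm circle_int_cst normrN.
Qed.

(** Approximate v in L^1 by continuous zero-mean functions p N.  By
    primitive_osc, applied to differences, their primitives converge
    uniformly, and all the properties pass to the limit. *)
Lemma L1_primitive v : circle_L 1 v -> circle_int v = 0 -> exists V : R -> R,
  [/\ continuous V, periodic V 1,
   forall phi phi' : R -> R, (forall x : R, is_derive x 1 phi (phi' x)) -> continuous phi' -> periodic phi 1 ->
     circle_int (fun x => V x * phi' x) = - circle_int (fun x => v x * phi x) &
   forall x y, `|V x - V y| <= L1norm v].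
Proof.
move=> Lv v0; have iv := circle_L1_integrable Lv.
have q01 : 0 <= (1/2 : R) < 1 by apply/andP; split; lra.
have eN N : 0 < (1/2 : R) ^+ N by rewrite exprn_gt0//; lra.
have ex N : exists pP : (R -> R) * (R -> R), [/\ continuous pP.1, periodic pP.1 1, circle_int pP.1 = 0 &
   L1norm (fun x => v x - pP.1 x) <= (1/2) ^+ N] /\ ((forall x : R, is_derive x 1 pP.2 (pP.1 x)) /\ pP.2 0 = 0).
  have [p hp] := zero_mean_approx Lv v0 (eN N).
  have [P dP P0] : exists2 P : R -> R, (forall x : R, is_derive x 1 P (p x)) & P 0 = 0.
    by apply: continuous_primitive; case: hp.
  by exists (p, P).
have [pP HpP] := choice ex.
pose p N := (pP N).1; pose P N := (pP N).2.
have cp N : continuous (p N) by have [[]] := HpP N.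
have pp N : periodic (p N) 1 by have [[]] := HpP N.
have p0 N : circle_int (p N) = 0 by have [[]] := HpP N.
have vp N : L1norm (fun x => v x - p N x) <= (1/2) ^+ N by have [[]] := HpP N.
have dP N (x : R) : is_derive x 1 (P N) (p N x) by have [_ []] := HpP N.
have P0 N : P N 0 = 0 by have [_ []] := HpP N.
have ip N : mu.-integrable I01 (EFin \o p N) by exact: continuous_integrable.
have ivp N : mu.-integrable I01 (EFin \o (fun x => v x - p N x)).
  by have h := integrableB _ iv (ip N); exact: h.
have pN x N k : `|P (N + k)%N x - P N x| <= 2 * (1/2) ^+ N.
  have dd (y : R) : is_derive y 1 (fun y => P (N + k)%N y - P N y) (p (N + k)%N y - p N y) by exact: is_deriveB1.
  have cd : continuous (fun y => p (N + k)%N y - p N y) by move=> y; apply: cvgB; exact: cp.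
  have pd : periodic (fun y => p (N + k)%N y - p N y) 1 by move=> y; rewrite !pp.
  have id : circle_int (fun y => p (N + k)%N y - p N y) = 0 by rewrite circle_intB// !p0 subrr.
  have [_ /(_ x 0)] := primitive_osc cd pd id dd.
  rewrite !P0 !subr0 => h; apply: le_trans h _.
  have -> : (fun y => p (N + k)%N y - p N y) = fun y => (v y - p N y) - (v y - p (N + k)%N y).
    by apply/funext => y; ring.
  apply: le_trans (L1normB (ivp _) (ivp _)) _.
  have : (1/2 : R) ^+ (N + k) <= (1/2) ^+ N.
    by rewrite exprD; apply: ler_piMr; [exact: ltW|apply: exprn_ile1; lra].
  by have := vp N; have := vp (N + k)%N; lra.
have HV x : exists l, forall N, `|P N x - l| <= 2 * (1/2) ^+ N.
  by have [l _ h] := geometric_cvg q01 (pN x); exists l.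
have [V PV] := choice HV.
have {}PV N x : `|P N x - V x| <= 2 * (1/2) ^+ N by exact: PV.
have cP N : continuous (P N) := is_derive_continuous (dP N).
have Pp N := primitive_osc (cp N) (pp N) (p0 N) (dP N).
have cV : continuous V := geometric_limit_continuous q01 cP PV.
exists V; split => //.
- move=> x; apply/eqP; rewrite -subr_eq0 -normr_le0.
  apply: (geometric_le0 (C := 4) q01) => N.
  have h1 := PV N x; have h2 := PV N (x + 1); have [pr _] := Pp N.
  rewrite pr in h2; have -> : V (x + 1) - V x = (P N x - V x) - (P N x - V (x + 1)) by ring.
  by apply: le_trans (ler_normB _ _) _; lra.
- move=> phi phi' dphi cphi' pphi.
  have pphi' := derive_periodic dphi pphi.
  have [B B0 phiB] := continuous_periodic_bounded (is_derive_continuous dphi) pphi.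
  have [B' B'0 phiB'] := continuous_periodic_bounded cphi' pphi'.
  apply/eqP; rewrite -subr_eq0 opprK -normr_le0.
  apply: (geometric_le0 (C := 2 * B' + B) q01) => N.
  have E := smooth_by_parts (cp N) (dP N) (Pp N).1 dphi cphi' pphi.
  have mphi : measurable_fun I01 phi.
    by apply: measurable_funTS; apply: continuous_measurable_fun; exact: is_derive_continuous dphi.
  have c1 : continuous (fun x => V x * phi' x) by move=> x; apply: cvgM; [exact: cV|exact: cphi'].
  have c2 : continuous (fun x => P N x * phi' x) by move=> x; apply: cvgM; [exact: cP|exact: cphi'].
  have h1 : `|circle_int (fun x => V x * phi' x) - circle_int (fun x => P N x * phi' x)| <= 2 * (1/2) ^+ N * B'.
    rewrite -circle_intB//; apply: circle_int_norm => x; first by apply: cvgB; [exact: c1|exact: c2].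
    by rewrite -mulrBl normrM ler_pM// distrC.
  have h2 : circle_int (fun x => v x * phi x) - circle_int (fun x => p N x * phi x) =
      circle_int (fun x => (v x - p N x) * phi x).
    have i1 := circle_integrableM iv mphi phiB; have i2 := circle_integrableM (ip N) mphi phiB.
    rewrite /circle_int -RintegralB//; apply: eq_Rintegral => x _; by rewrite mulrBl.
  have h3 := circle_int_mul_bound (ivp N) mphi phiB.
  rewrite -h2 in h3.
  have h4 : `|circle_int (fun x => v x * phi x) - circle_int (fun x => p N x * phi x)| <= (1/2) ^+ N * B.
    by apply: le_trans h3 _; rewrite ler_wpM2r//; exact: vp.
  rewrite E in h1.
  set a := circle_int _ in h1 h4 *; set b := circle_int _ in h1 h4 *.
  set c := circle_int _ in h1 h4 *.
  rewrite opprK in h1; move: h1 h4; clearbody a b c.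
  have -> : (2 * B' + B) * (1/2) ^+ N = 2 * (1/2) ^+ N * B' + (1/2) ^+ N * B by ring.
  move: (2 * (1/2) ^+ N * B') ((1/2) ^+ N * B) => u w.
  rewrite !ler_norml => /andP[h5 h6] /andP[h7 h8]; apply/andP; split; lra.
- move=> x y; rewrite -subr_le0; apply: (geometric_le0 (C := 5) q01) => N.
  have h1 := PV N x; have h2 := PV N y; have [_ /(_ x y) h3] := Pp N.
  have h4 : L1norm (p N) <= L1norm v + (1/2) ^+ N.
    have -> : p N = fun x => v x - (v x - p N x) by apply/funext => z; ring.
    by apply: le_trans (L1normB iv (ivp N)) _; have := vp N; lra.
  have : `|V x - V y| <= `|P N x - P N y| + `|P N x - V x| + `|P N y - V y|.
    have -> : V x - V y = (P N x - P N y) - (P N x - V x) + (P N y - V y) by ring.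
    by apply: le_trans (ler_normD _ _) _; rewrite lerD2r; exact: ler_normB.
  lra.
Qed.

End primitives.

(** * Weak derivatives and the embedding of H^4 into C^3 *)

Section weak_derivatives.
Context {R : realType}.
Implicit Types (f g u v w phi psi : R -> R).
Local Notation mu := (@lebesgue_measure R).
Local Notation I01 := ([set` `[(0:R), (1:R)[%R] : set R).

Lemma circle_L1_intro f : periodic f 1 -> mu.-integrable I01 (EFin \o f) -> circle_L 1 f.
Proof. by move=> pf h; apply/circle_L1P. Qed.

Lemma circle_L1D f g : circle_L 1 f -> circle_L 1 g -> circle_L 1 (fun x => f x + g x).
Proof.
move=> Lf Lg; apply: circle_L1_intro; first by move=> x; rewrite Lf.1 Lg.1.
by have h := integrableD _ (circle_L1_integrable Lf) (circle_L1_integrable Lg); exact: h.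
Qed.

Lemma circle_L1Z a f : circle_L 1 f -> circle_L 1 (fun x => a * f x).
Proof.
move=> Lf; apply: circle_L1_intro; first by move=> x; rewrite Lf.1.
by have h := integrableZl _ a (circle_L1_integrable Lf); exact: h.
Qed.

Lemma circle_L1B f g : circle_L 1 f -> circle_L 1 g -> circle_L 1 (fun x => f x - g x).
Proof.
move=> Lf /(circle_L1Z (-1)) Lg; have := circle_L1D Lf Lg.
by congr (circle_L 1); apply/funext => x; rewrite mulN1r.
Qed.

Lemma circle_intDi f g : mu.-integrable I01 (EFin \o f) -> mu.-integrable I01 (EFin \o g) ->
  circle_int (fun x => f x + g x) = circle_int f + circle_int g.
Proof. by move=> h1 h2; rewrite /circle_int RintegralD. Qed.

Lemma circle_intBi f g : mu.-integrable I01 (EFin \o f) -> mu.-integrable I01 (EFin \o g) ->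
  circle_int (fun x => f x - g x) = circle_int f - circle_int g.
Proof. by move=> h1 h2; rewrite /circle_int RintegralB. Qed.

Lemma circle_intZi a f : mu.-integrable I01 (EFin \o f) ->
  circle_int (fun x => a * f x) = a * circle_int f.
Proof. by move=> h1; rewrite /circle_int RintegralZl. Qed.

Lemma circle_int_ext f g : (forall x, f x = g x) -> circle_int f = circle_int g.
Proof. by move=> fg; congr circle_int; apply/funext. Qed.

Lemma circle_L1M f phi : circle_L 1 f -> continuous phi -> periodic phi 1 ->
  mu.-integrable I01 (EFin \o (fun x => f x * phi x)).
Proof.
move=> Lf cphi pphi; have [B _ phiB] := continuous_periodic_bounded cphi pphi.
apply: circle_integrableM (circle_L1_integrable Lf) _ phiB.
by apply: measurable_funTS; exact: continuous_measurable_fun.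
Qed.

Lemma test_continuous phi : test_function phi -> continuous phi.
Proof. by move=> tp; exact: (classC_cont (i := 0) (tp 0%N).2). Qed.

Lemma test_periodic phi : test_function phi -> periodic phi 1.
Proof. by move=> tp; exact: (tp 0%N).1. Qed.

Lemma test_derive phi : test_function phi ->
  test_function (derive1 phi) /\ forall x : R, is_derive x 1 phi (derive1 phi x).
Proof.
move=> tp; split=> [n|x]; last exact: (classC_derive (i := 0) x (tp 1%N).2).
by split; [exact: (classC_periodic (i := 1) (tp 1%N))|exact: (classC_pred (tp n.+1).2).2].
Qed.

Lemma test_derive1n k phi : test_function phi -> test_function (derive1n k phi).
Proof. by move=> tp; elim: k => [//|k IH]; rewrite derive1nS; exact: (test_derive IH).1. Qed.

Lemma test_cst (a : R) : test_function (fun=> a).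
Proof. by move=> n; exact: classC_cst. Qed.

Lemma circle_ae_eqC f g : circle_ae_eq f g -> circle_ae_eq g f.
Proof. by apply: filterS => x h xD; rewrite h. Qed.

Lemma circle_ae_eq_trans f g w : circle_ae_eq f g -> circle_ae_eq g w -> circle_ae_eq f w.
Proof.
have Fae := ae_filter_ringOfSetsType mu.
by apply: filterS2 => x h1 h2 xD; rewrite h1// h2.
Qed.

Lemma circle_ae_intM f g phi : circle_L 1 f -> circle_L 1 g -> continuous phi -> circle_ae_eq f g ->
  circle_int (fun x => f x * phi x) = circle_int (fun x => g x * phi x).
Proof.
move=> Lf Lg cphi fg.
have mphi : measurable_fun I01 phi by apply: measurable_funTS; exact: continuous_measurable_fun.
apply: circle_ae_int.
- by apply: measurable_funM => //; exact: circle_L_measurable Lf.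
- by apply: measurable_funM => //; exact: circle_L_measurable Lg.
- have Fae := ae_filter_ringOfSetsType mu.
  by apply: filterS fg => x h xD; rewrite h.
Qed.

(** By primitive_osc a primitive of |f - g| is constant, hence its derivative
    |f - g| vanishes. *)
Lemma ae_eq_continuous f g : continuous f -> periodic f 1 -> continuous g -> periodic g 1 ->
  circle_ae_eq f g -> f = g.
Proof.
move=> cf pf cg pg fg; pose h x := `|f x - g x|.
have ch : continuous h.
  by move=> x; apply: (@cvg_comp _ _ _ _ _ _ (nbhs (f x - g x))); [apply: cvgB; [exact: cf|exact: cg]|exact: norm_continuous].
have ph : periodic h 1 by move=> x; rewrite /h pf pg.
have h0 : circle_int h = 0.
  rewrite -(circle_int_cst (0 : R)); apply: circle_ae_int.
  - by apply: measurable_funTS; exact: continuous_measurable_fun.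
  - exact: measurable_cst.
  - have Fae := ae_filter_ringOfSetsType mu.
    by apply: filterS fg => x e xD; rewrite /h e// subrr normr0.
have [D dD _] := continuous_primitive ch.
have [_ H] := primitive_osc ch ph h0 dD.
have L0 : L1norm h = 0.
  by rewrite /L1norm -[RHS]h0; apply: circle_int_ext => x; rewrite /h normr_id.
have DE : D = cst (D 0).
  by apply/funext => x; apply/eqP; rewrite -subr_eq0 -normr_le0; have := H x 0; rewrite L0.
apply/funext => x; apply/eqP; rewrite -subr_eq0 -normr_eq0; apply/eqP.
apply: (is_derive_unique (dD x)); rewrite DE; exact: is_derive_cst.
Qed.

(** For a test function psi, psi minus its mean is the derivative of a test
    function.  So w - int w pairs to 0 with psi. *)
Lemma derivative_pairing_cst w : circle_L 1 w ->
  (forall phi, test_function phi -> circle_int (fun x => w x * derive1 phi x) = 0) ->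
  circle_ae_eq w (cst (circle_int w)).
Proof.
move=> Lw H; set c := circle_int w; have iw := circle_L1_integrable Lw.
have Lc : circle_L 1 (fun=> c) by apply: circle_L1_continuous => // x; exact: cvg_cst.
have : circle_ae_eq (fun x => w x - c) (cst 0).
  apply: pairing_zero_ae; first exact: circle_L1B.
  move=> psi tpsi; have cpsi := test_continuous tpsi; have ppsi := test_periodic tpsi.
  pose a := circle_int psi.
  have cpa : continuous (fun x => psi x - a) by move=> x; apply: cvgB; [exact: cpsi|exact: cvg_cst].
  have [phi dphi _] := continuous_primitive cpa.
  have ppa : periodic (fun x => psi x - a) 1 by move=> x; rewrite ppsi.
  have ipa : circle_int (fun x => psi x - a) = 0.
    by rewrite circle_intB// ?circle_int_cst ?subrr// => x; exact: cvg_cst.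
  have [pphi _] := primitive_osc cpa ppa ipa dphi.
  have tphi : test_function phi.
    move=> n; split => //; apply: (@classC_weak _ n n.+1) => //; apply: (classC_succ dphi).
    have := classC_linear 1 (-1) (tpsi n).2 (classC_cst n a).2.
    by congr classC; apply/funext => x; rewrite mul1r mulN1r.
  have dE : derive1 phi = fun x => psi x - a by apply/funext => x; exact: derive1n_val.
  have := H phi tphi; rewrite dE => E.
  have iwp := circle_L1M Lw cpsi ppsi.
  have i1 : mu.-integrable I01 (EFin \o (fun x => a * w x)) by exact: circle_L1_integrable (circle_L1Z a Lw).
  have i2 : mu.-integrable I01 (EFin \o psi) by exact: continuous_integrable.
  have i3 : mu.-integrable I01 (EFin \o (fun x => c * psi x)).
    by apply: continuous_integrable => x; apply: cvgM; [exact: cvg_cst|exact: cpsi].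
  rewrite (circle_int_ext (g := fun x => w x * psi x - c * psi x)); last by move=> x; ring.
  rewrite circle_intBi// circle_intZi// -/a.
  move: E; rewrite (circle_int_ext (g := fun x => w x * psi x - a * w x)); last by move=> x; ring.
  rewrite circle_intBi// circle_intZi// -/c => /eqP; rewrite subr_eq0 => /eqP ->.
  by rewrite mulrC subrr.
by apply: filterS => x h xD; apply/eqP; rewrite -subr_eq0; apply/eqP; exact: h.
Qed.

Definition weak1 u v := forall phi, test_function phi ->
  circle_int (fun x => u x * derive1 phi x) = - circle_int (fun x => v x * phi x).

Lemma weak1_mean u v : weak1 u v -> circle_int v = 0.
Proof.
move=> H; have := H _ (test_cst 1).
rewrite (circle_int_ext (f := fun x => u x * _) (g := fun=> 0)); last first.
  by move=> x; rewrite (derive1n_val (is_derive_cst (1 : R) x 1)) mulr0.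
rewrite circle_int_cst (circle_int_ext (g := v)) => [/eqP|x]; last by rewrite mulr1.
by rewrite eq_sym oppr_eq0 => /eqP.
Qed.

(** If V is a primitive of v, then u - V has zero weak derivative and is
    therefore constant.  The bound follows from U = int u + (V - int V). *)
Lemma weak1_primitive u v : circle_L 1 u -> circle_L 1 v -> weak1 u v -> exists U : R -> R,
  [/\ continuous U, periodic U 1, circle_ae_eq u U & forall x, `|U x| <= L1norm u + L1norm v].
Proof.
move=> Lu Lv H; have v0 := weak1_mean H.
have [V [cV pV EV oV]] := L1_primitive Lv v0.
have LV := circle_L1_continuous cV pV.
have LuV := circle_L1B Lu LV.
set c := circle_int (fun x => u x - V x).
have ae : circle_ae_eq (fun x => u x - V x) (cst c).
  apply: derivative_pairing_cst => // phi tphi.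
  have [tphi' dphi] := test_derive tphi.
  have cphi' := test_continuous tphi'; have pphi' := test_periodic tphi'.
  rewrite (circle_int_ext (g := fun x => u x * derive1 phi x - V x * derive1 phi x)); last by move=> x; ring.
  rewrite circle_intBi; [|exact: circle_L1M|exact: circle_L1M].
  by rewrite H// (EV phi)//; [rewrite subrr|exact: test_periodic].
have cU : continuous (fun x => V x + c) by move=> x; apply: cvgD; [exact: cV|exact: cvg_cst].
exists (fun x => V x + c); split => //.
- by move=> x; rewrite pV.
- by apply: filterS ae => x h xD; have /= <- := h xD; rewrite addrC subrK.
move=> x; have iu := circle_L1_integrable Lu.
have cc (a : R) : continuous (fun _ : R => a) by move=> y; exact: cvg_cst.
have iV : mu.-integrable I01 (EFin \o V) by exact: continuous_integrable.
have E : circle_int (fun y => V x - V y) = V x - circle_int V by rewrite circle_intB// circle_int_cst.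
have h1 : `|V x - circle_int V| <= L1norm v.
  by rewrite -E; apply: circle_int_norm => // y; apply: cvgB; [exact: cvg_cst|exact: cV].
have h2 := circle_int_le_L1 iu.
have -> : V x + c = circle_int u + (V x - circle_int V) by rewrite /c circle_intBi//; ring.
by apply: le_trans (ler_normD _ _) _; exact: lerD.
Qed.

(** With W a classical primitive of v, the continuous function u - W has zero
    weak derivative, so it is constant. *)
Lemma weak1_C1 u v : continuous u -> periodic u 1 -> continuous v -> periodic v 1 -> weak1 u v ->
  forall x : R, is_derive x 1 u (v x).
Proof.
move=> cu pu cv pv H; have v0 := weak1_mean H.
have [W dW _] := continuous_primitive cv.
have [pW _] := primitive_osc cv pv v0 dW; have cW := is_derive_continuous dW.
have Lu := circle_L1_continuous cu pu; have LW := circle_L1_continuous cW pW.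
have ae : circle_ae_eq (fun x => u x - W x) (cst (circle_int (fun x => u x - W x))).
  apply: derivative_pairing_cst => [|phi tphi]; first exact: circle_L1B.
  have [tphi' dphi] := test_derive tphi.
  have cphi' := test_continuous tphi'; have pphi' := test_periodic tphi'.
  rewrite (circle_int_ext (g := fun x => u x * derive1 phi x - W x * derive1 phi x)); last by move=> x; ring.
  rewrite circle_intBi; [|exact: circle_L1M|exact: circle_L1M].
  rewrite H// (smooth_by_parts cv dW pW dphi)//; [by rewrite subrr|exact: test_periodic].
have E : (fun x => u x - W x) = cst (circle_int (fun x => u x - W x)).
  apply: ae_eq_continuous ae => //.
  - by move=> x; apply: cvgB; [exact: cu|exact: cW].
  - by move=> x; rewrite pu pW.
  - by move=> x; exact: cvg_cst.
move=> x; apply: (@is_derive_ext _ (fun y => W y + circle_int (fun x => u x - W x))).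
  by move=> y; have := congr1 (fun F : R -> R => F y) E; rewrite /= => <-; rewrite addrC subrK.
by apply: is_derive_eq (is_deriveD1 (dW x) (is_derive_cst _ x 1)) _; rewrite addr0.
Qed.

Lemma weak_derivative_ae k f g g' : is_weak_derivative k f g -> is_weak_derivative k f g' ->
  circle_ae_eq g g'.
Proof.
move=> [Lg Hg] [Lg' Hg'].
have : circle_ae_eq (fun x => g x - g' x) (cst 0).
  apply: pairing_zero_ae => [|phi tphi]; first exact: circle_L1B.
  have cphi := test_continuous tphi; have pphi := test_periodic tphi.
  rewrite (circle_int_ext (g := fun x => g x * phi x - g' x * phi x)); last by move=> x; ring.
  rewrite circle_intBi; [|exact: circle_L1M|exact: circle_L1M].
  have := Hg _ tphi; rewrite (Hg' _ tphi) => /eqP; rewrite eq_sym => /eqP h.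
  by rewrite (mulfI _ h) ?subrr// expf_neq0// oppr_eq0 oner_eq0.
by apply: filterS => x h xD; apply/eqP; rewrite -subr_eq0; apply/eqP; exact: h.
Qed.

Lemma weak_derivativeP k f g : is_weak_derivative k f g -> is_weak_derivative k f (weak_derivative k f).
Proof. by move=> H; apply: (xgetPex (cst 0) (P := [set g | is_weak_derivative k f g])); exists g. Qed.

(** Test the definition of the derivative of order k with phi'. *)
Lemma weak_derivative_step k f g h : is_weak_derivative k f g -> is_weak_derivative k.+1 f h -> weak1 g h.
Proof.
move=> [Lg Hg] [Lh Hh] phi tphi; have [tphi' _] := test_derive tphi.
have := Hh _ tphi; rewrite /derive1n iterSr -/(derive1n k (derive1 phi)) (Hg _ tphi').
rewrite exprS mulN1r mulNr -mulrN; apply: mulfI.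
by rewrite expf_neq0// oppr_eq0 oner_eq0.
Qed.

Lemma weak_derivative0 f : circle_L 1 f -> is_weak_derivative 0 f f.
Proof. by move=> Lf; split => // phi _; rewrite expr0 mul1r. Qed.

(** Square integrability as integrability of u ^ 2, the form in which norms
    are computed; Lsq_circle_L2 identifies it with circle_L. *)
Definition Lsq u := circle_L 1 u /\ mu.-integrable I01 (EFin \o (fun x => u x ^+ 2)).

Lemma Lsq_intro u : periodic u 1 -> measurable_fun I01 u ->
  mu.-integrable I01 (EFin \o (fun x => u x ^+ 2)) -> Lsq u.
Proof.
move=> pu mu_ iu2; split => //; apply: circle_L1_intro => //.
have i1 : mu.-integrable I01 (EFin \o (fun=> 1 : R)) by apply: continuous_integrable => x; exact: cvg_cst.
apply: (@le_integrable _ _ _ mu _ _ _ (fun x => (1 + u x ^+ 2)%:E)) => //.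
- exact/measurable_EFinP.
- move=> x _; rewrite /= lee_fin [leRHS]ger0_norm ?addr_ge0 ?sqr_ge0//.
  have := sqr_ge0 (`|u x| - 1); rewrite sqrrB real_normK ?num_real// mulr1 expr1n.
  by have := normr_ge0 (u x); have := sqr_ge0 (u x); lra.
- by have h := integrableD _ i1 iu2; exact: h.
Qed.

Lemma Lsq_circle_L2 u : circle_L 2%:E u <-> Lsq u.
Proof.
split=> [Lu|[Lu iu2]].
  have [pu /Lfun2_integrable_sqr i2] := Lu.
  apply: Lsq_intro => //; first exact: circle_L_measurable Lu.
  have i3 : mu.-integrable I01 (EFin \o (fun x => (u \_ I01) x ^+ 2)) by apply: (integrableS measurableT _ _ i2).
  by apply: eq_integrable i3 => // x xD /=; rewrite patchT.
have mu_ : measurable_fun I01 u := circle_L_measurable Lu.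
split; first exact: Lu.1.
apply/andP; split; rewrite inE/=; first by apply/(measurable_restrictT _ _).1.
rewrite /finite_norm unlock; apply: poweR_lty.
rewrite (_ : (\int[_]_x _)%E = (\int[mu]_(x in I01) `|(u x ^+ 2)%:E|)%E); first by case/integrableP: iu2.
rewrite [RHS]integral_mkcond; apply: eq_integral => x _.
rewrite /= !patchE; case: ifPn => _ /=; last by rewrite normr0 powR0.
by rewrite powR_mulrn// normrX.
Qed.

Lemma Lsq_congr u v : circle_L 1 u -> circle_ae_eq u v -> Lsq v -> Lsq u.
Proof.
move=> Lu uv [Lv /integrableP[mv iv]]; split => //.
have m2 : measurable_fun I01 (fun x => u x ^+ 2) by apply: measurable_funX; exact: circle_L_measurable Lu.
apply/integrableP; split; first exact/measurable_EFinP.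
apply: le_lt_trans iv; apply: ae_ge0_le_integral => //.
- by apply: measurableT_comp => //; exact/measurable_EFinP.
- exact: measurableT_comp.
- have Fae := ae_filter_ringOfSetsType mu.
  by apply: filterS uv => x h xD; rewrite /= h.
Qed.

Lemma Lsq_int_congr u v : circle_L 1 u -> circle_L 1 v -> circle_ae_eq u v ->
  circle_int (fun x => u x ^+ 2) = circle_int (fun x => v x ^+ 2).
Proof.
move=> Lu Lv uv; apply: circle_ae_int.
- by apply: measurable_funX; exact: circle_L_measurable Lu.
- by apply: measurable_funX; exact: circle_L_measurable Lv.
- have Fae := ae_filter_ringOfSetsType mu.
  by apply: filterS uv => x h xD; rewrite /= h.
Qed.

(** Cauchy-Schwarz on a space of mass 1: integrate (|u| - m) ^ 2 >= 0, where m
    is the L^1 norm of u. *)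
Lemma L1norm_sqr u : Lsq u -> L1norm u ^+ 2 <= circle_int (fun x => u x ^+ 2).
Proof.
move=> [Lu iu2]; have iu := circle_L1_integrable Lu; set m := L1norm u.
have ia : mu.-integrable I01 (EFin \o (fun x => `|u x|)) by exact: integrable_norm.
have iam : mu.-integrable I01 (EFin \o (fun x => 2 * m * `|u x|)) by have h := integrableZl _ (2 * m) ia; exact: h.
have ic : mu.-integrable I01 (EFin \o (fun=> m ^+ 2)) by apply: continuous_integrable => x; exact: cvg_cst.
have i1 : mu.-integrable I01 (EFin \o (fun x => u x ^+ 2 - 2 * m * `|u x|)).
  by have h := integrableB _ iu2 iam; exact: h.
have : 0 <= circle_int (fun x => (u x ^+ 2 - 2 * m * `|u x|) + m ^+ 2).
  apply: fine_ge0; apply: integral_ge0 => x _; rewrite lee_fin.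
  have := sqr_ge0 (`|u x| - m); rewrite sqrrB real_normK ?num_real//; lra.
rewrite circle_intDi// circle_intBi// circle_intZi// circle_int_cst -/(L1norm u) -/m.
by rewrite expr2; lra.
Qed.

Lemma weak1_congr u u' v v' : circle_L 1 u -> circle_L 1 u' -> circle_L 1 v -> circle_L 1 v' ->
  circle_ae_eq u u' -> circle_ae_eq v v' -> weak1 u v -> weak1 u' v'.
Proof.
move=> Lu Lu' Lv Lv' uu' vv' H phi tphi; have [tphi' _] := test_derive tphi.
rewrite -(circle_ae_intM Lu Lu' (test_continuous tphi') uu').
by rewrite -(circle_ae_intM Lv Lv' (test_continuous tphi) vv') H.
Qed.

Local Notation D k f := (weak_derivative k f).

Lemma H4_weak f k : H4 f -> (k <= 4)%N -> is_weak_derivative k f (D k f) /\ Lsq (D k f).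
Proof.
move=> [[Lf Hf] _] k4; have [g wg /Lsq_circle_L2 sg] := Hf k k4.
have wD := weak_derivativeP wg; split => //.
by apply: Lsq_congr sg; [case: wD|exact: weak_derivative_ae wD wg].
Qed.

Lemma H4_circle_L1 f : H4 f -> circle_L 1 f.
Proof. by move=> [[/Lsq_circle_L2[]]]. Qed.

Definition H4sq f := \sum_(k < 5) circle_int (fun x => D k f x ^+ 2).

Lemma H4norm_sqrt f : H4norm f = Num.sqrt (H4sq f). Proof. by []. Qed.

Lemma circle_int_sqr_ge0 u : 0 <= circle_int (fun x => u x ^+ 2).
Proof. by apply: fine_ge0; apply: integral_ge0 => x _; rewrite lee_fin sqr_ge0. Qed.

Lemma H4sq_ge0 f : 0 <= H4sq f.
Proof. by apply: sumr_ge0 => k _; exact: circle_int_sqr_ge0. Qed.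

Lemma H4norm_sqr f : H4norm f ^+ 2 = H4sq f.
Proof. by rewrite H4norm_sqrt sqr_sqrtr// H4sq_ge0. Qed.

Lemma H4_L1norm f k : H4 f -> (k <= 4)%N -> L1norm (D k f) <= H4norm f.
Proof.
move=> Hf k4; have [_ sD] := H4_weak Hf k4.
rewrite -(@ler_pXn2r _ 2)// ?nnegrE ?sqrtr_ge0 ?L1norm_ge0// H4norm_sqr.
apply: le_trans (L1norm_sqr sD) _; rewrite /H4sq (bigD1 (Ordinal (k4 : (k < 5)%N)))//= lerDl.
by apply: sumr_ge0 => j _; exact: circle_int_sqr_ge0.
Qed.

(** The embedding of H^4 into C^3.  For k <= 3 the weak derivative of order k
    has a continuous representative U k by weak1_primitive, U k.+1 is the
    classical derivative of U k by weak1_C1, and U 0 = f since both are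
    continuous.  Two consecutive L^1 norms bound U k, whence the factor 2. *)
Lemma H4_regular f : H4 f -> circle_classC 3 f /\ forall k, (k <= 3)%N ->
  circle_ae_eq (D k f) (derive1n k f) /\ forall x, `|derive1n k f x| <= 2 * H4norm f.
Proof.
move=> Hf; have [[Lf2 _] cf] := Hf; have Lf := H4_circle_L1 Hf.
have exU k : exists U : R -> R, (k <= 3)%N -> [/\ continuous U, periodic U 1, circle_ae_eq (D k f) U &
    forall x, `|U x| <= L1norm (D k f) + L1norm (D k.+1 f)].
  have [k3|nk] := boolP (k <= 3)%N; last by exists f.
  have [w1 [L1 _]] := H4_weak Hf (leqW k3); have [w2 [L2 _]] := H4_weak Hf (k3 : (k.+1 <= 4)%N).
  by have [U HU] := weak1_primitive L1 L2 (weak_derivative_step w1 w2); exists U.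
have [U HU] := choice exU.
have dU i (x : R) : (i < 3)%N -> is_derive x 1 (U i) (U i.+1 x).
  move=> i3; have [c1 p1 a1 _] := HU i (ltnW i3); have [c2 p2 a2 _] := HU i.+1 i3.
  apply: weak1_C1 => //.
  have i4 : (i.+1 <= 4)%N by exact: leqW.
  have [w1 [L1 _]] := H4_weak Hf (ltnW i4); have [w2 [L2 _]] := H4_weak Hf i4.
  apply: weak1_congr a1 a2 (weak_derivative_step w1 w2) => //; exact: circle_L1_continuous.
have U0 : U 0%N = f.
  have [c1 p1 a1 _] := HU 0%N isT; have [w0 _] := H4_weak Hf (isT : (0 <= 4)%N).
  apply: ae_eq_continuous => //; first exact: Lf.1.
  apply: circle_ae_eq_trans (circle_ae_eqC a1) _.
  exact: weak_derivative_ae w0 (weak_derivative0 Lf).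
have dE := derive1nE dU; rewrite U0 in dE.
split.
  split; first exact: Lf.1.
  by rewrite -U0; apply: classC_intro dU _; case: (HU 3%N isT).
move=> k k3; rewrite dE//; have [_ _ aU bU] := HU k k3; split => // x.
apply: le_trans (bU x) _; rewrite mulr2n mulrDl mul1r.
by apply: lerD; apply: H4_L1norm => //; exact: leqW.
Qed.

End weak_derivatives.

(** * H^4 as a Hilbert space *)

Section H4_space.
Context {R : realType}.
Implicit Types (f g u v w phi psi : R -> R).
Local Notation mu := (@lebesgue_measure R).
Local Notation I01 := ([set` `[(0:R), (1:R)[%R] : set R).
Local Notation D k f := (weak_derivative k f).

(** Sums, multiples and differences all have this form, so that one closure
    lemma suffices and the squared norm becomes a quadratic form in (a, b). *)
Definition comb (a b : R) f g := fun x => a * f x + b * g x.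

Lemma circle_L1_comb a b f g : circle_L 1 f -> circle_L 1 g -> circle_L 1 (comb a b f g).
Proof. by move=> Lf Lg; exact: (circle_L1D (circle_L1Z a Lf) (circle_L1Z b Lg)). Qed.

Lemma Lsq_mul u v : Lsq u -> Lsq v -> mu.-integrable I01 (EFin \o (fun x => u x * v x)).
Proof.
move=> [Lu iu] [Lv iv].
apply: (@le_integrable _ _ _ mu _ _ _ (fun x => (u x ^+ 2 + v x ^+ 2)%:E)) => //.
- by apply/measurable_EFinP; apply: measurable_funM; apply: circle_L_measurable; eassumption.
- move=> x _; rewrite /= lee_fin [leRHS]ger0_norm ?addr_ge0 ?sqr_ge0// normrM.
  have := sqr_ge0 (`|u x| - `|v x|); rewrite sqrrB !real_normK ?num_real//.
  by have := mulr_ge0 (normr_ge0 (u x)) (normr_ge0 (v x)); lra.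
- by have h := integrableD _ iu iv; exact: h.
Qed.

Lemma sqr_comb u v a b : Lsq u -> Lsq v ->
  mu.-integrable I01 (EFin \o (fun x => comb a b u v x ^+ 2)) /\
  circle_int (fun x => comb a b u v x ^+ 2) =
  a ^+ 2 * circle_int (fun x => u x ^+ 2) + (2 * a * b * circle_int (fun x => u x * v x) +
    b ^+ 2 * circle_int (fun x => v x ^+ 2)).
Proof.
move=> su sv; have iuv := Lsq_mul su sv; have [_ iu] := su; have [_ iv] := sv.
have i1 : mu.-integrable I01 (EFin \o (fun x => a ^+ 2 * u x ^+ 2)) by have h := integrableZl _ (a ^+ 2) iu; exact: h.
have i2 : mu.-integrable I01 (EFin \o (fun x => 2 * a * b * (u x * v x))) by have h := integrableZl _ (2 * a * b) iuv; exact: h.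
have i3 : mu.-integrable I01 (EFin \o (fun x => b ^+ 2 * v x ^+ 2)) by have h := integrableZl _ (b ^+ 2) iv; exact: h.
have i23 : mu.-integrable I01 (EFin \o (fun x => 2 * a * b * (u x * v x) + b ^+ 2 * v x ^+ 2)).
  by have h := integrableD _ i2 i3; exact: h.
have E : (fun x => comb a b u v x ^+ 2) = fun x => a ^+ 2 * u x ^+ 2 + (2 * a * b * (u x * v x) + b ^+ 2 * v x ^+ 2).
  by apply/funext => x; rewrite /comb; ring.
rewrite E; split; first by have h := integrableD _ i1 i23; exact: h.
by rewrite circle_intDi// circle_intDi// !circle_intZi.
Qed.

Lemma Lsq_comb u v a b : Lsq u -> Lsq v -> Lsq (comb a b u v).
Proof.
move=> su sv; split; first by case: su; case: sv => ? _ ? _; exact: circle_L1_comb.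
exact: (sqr_comb a b su sv).1.
Qed.

Lemma weak_derivative_comb k f g f' g' a b : circle_L 1 f -> circle_L 1 g ->
  is_weak_derivative k f f' -> is_weak_derivative k g g' ->
  is_weak_derivative k (comb a b f g) (comb a b f' g').
Proof.
move=> Lf Lg [Lf' Hf] [Lg' Hg]; split; first exact: circle_L1_comb.
move=> phi tphi.
have cphi := test_continuous tphi; have pphi := test_periodic tphi.
have tk := test_derive1n k tphi; have ck := test_continuous tk; have pk := test_periodic tk.
have cint u v psi : circle_L 1 u -> circle_L 1 v -> continuous psi -> periodic psi 1 ->
   circle_int (fun x => comb a b u v x * psi x) = a * circle_int (fun x => u x * psi x) + b * circle_int (fun x => v x * psi x).
  move=> Lu Lv cpsi ppsi; have iu := circle_L1M Lu cpsi ppsi; have iv := circle_L1M Lv cpsi ppsi.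
  have i1 : mu.-integrable I01 (EFin \o (fun x => a * (u x * psi x))) by have h := integrableZl _ a iu; exact: h.
  have i2 : mu.-integrable I01 (EFin \o (fun x => b * (v x * psi x))) by have h := integrableZl _ b iv; exact: h.
  rewrite -!circle_intZi// -circle_intDi//; apply: circle_int_ext => x; rewrite /comb; ring.
rewrite !cint// Hf// Hg//; ring.
Qed.

Lemma H4_comb a b f g : H4 f -> H4 g -> H4 (comb a b f g).
Proof.
move=> Hf Hg; have Lf := H4_circle_L1 Hf; have Lg := H4_circle_L1 Hg.
have [[/Lsq_circle_L2 sf _] cf] := Hf; have [[/Lsq_circle_L2 sg _] cg] := Hg.
split; last by move=> x; apply: cvgD; (apply: cvgM; first exact: cvg_cst); [exact: cf|exact: cg].
split; first by apply/Lsq_circle_L2; exact: Lsq_comb.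
move=> k k4; have [wf sDf] := H4_weak Hf k4; have [wg sDg] := H4_weak Hg k4.
exists (comb a b (D k f) (D k g)); first exact: weak_derivative_comb.
by apply/Lsq_circle_L2; exact: Lsq_comb.
Qed.

(** The norm may be computed from any weak derivatives, as they are unique up
    to null sets. *)
Lemma H4_intro f (g : nat -> R -> R) : continuous f -> periodic f 1 ->
  (forall k, (k <= 4)%N -> is_weak_derivative k f (g k) /\ Lsq (g k)) ->
  H4 f /\ H4sq f = \sum_(k < 5) circle_int (fun x => g k x ^+ 2).
Proof.
move=> cf pf Hg; have Lf := circle_L1_continuous cf pf.
have Hf : H4 f.
  split => //; split; last first.
    by move=> k k4; have [wg sg] := Hg k k4; exists (g k) => //; exact/Lsq_circle_L2.
  have [w0 s0] := Hg 0%N isT; apply/Lsq_circle_L2.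
  by apply: Lsq_congr s0 => //; exact: weak_derivative_ae (weak_derivative0 Lf) w0.
split => //; apply: eq_bigr => k _; have k4 : (k <= 4)%N by rewrite -ltnS.
have [wg [Lg _]] := Hg k k4; have [wD [LD _]] := H4_weak Hf k4.
by apply: Lsq_int_congr => //; exact: weak_derivative_ae wD wg.
Qed.

(** B is the inner product of f and g. *)
Lemma H4sq_comb f g : H4 f -> H4 g -> exists B, forall a b,
  H4sq (comb a b f g) = a ^+ 2 * H4sq f + 2 * a * b * B + b ^+ 2 * H4sq g.
Proof.
move=> Hf Hg; exists (\sum_(k < 5) circle_int (fun x => D k f x * D k g x)) => a b.
have Hc := H4_comb a b Hf Hg.
have [pc _] := H4_circle_L1 Hc.
have hk k : (k <= 4)%N -> is_weak_derivative k (comb a b f g) (comb a b (D k f) (D k g)) /\ Lsq (comb a b (D k f) (D k g)).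
  move=> k4; have [wf sf] := H4_weak Hf k4; have [wg sg] := H4_weak Hg k4; split.
    by apply: weak_derivative_comb => //; exact: H4_circle_L1.
  exact: Lsq_comb.
have [_ ->] := H4_intro Hc.2 pc hk.
rewrite /H4sq !mulr_sumr -!big_split/=; apply: eq_bigr => k _; have k4 : (k <= 4)%N by rewrite -ltnS.
have [wf sf] := H4_weak Hf k4; have [wg sg] := H4_weak Hg k4.
by rewrite (sqr_comb a b sf sg).2 addrA.
Qed.

Lemma limn_einf_le (v : nat -> \bar R) (c : \bar R) : (forall n, v n <= c)%E -> (limn_einf v <= c)%E.
Proof.
move=> vc; rewrite limn_einf_lim; apply: lime_le; first exact: is_cvg_einfs.
apply: nearW => n; apply: le_trans (vc n).
by apply: ereal_inf_lbound; exists n => /=.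
Qed.

Lemma nneseries_le (a : nat -> \bar R) (K : \bar R) : (forall n, 0 <= a n)%E ->
  (forall N, \sum_(0 <= n < N) a n <= K)%E -> (\sum_(0 <= n <oo) a n <= K)%E.
Proof.
move=> a0 aK; apply: lime_le; first by apply: is_cvg_nneseries => n _ _; exact: a0.
by apply: nearW => N; exact: aK.
Qed.

Lemma geometric_half N : \sum_(0 <= n < N) (1/2 : R) ^+ n <= 2.
Proof.
suff -> : \sum_(0 <= n < N) (1/2 : R) ^+ n = 2 - 2 * (1/2) ^+ N.
  have h : 0 <= (1/2 : R) ^+ N by apply: exprn_ge0; lra.
  by lra.
elim: N => [|N IH]; first by rewrite big_geq// expr0; ring.
by rewrite big_nat_recr//= IH exprS; field.
Qed.

(** Weighted by 4 ^ n, the squares of the increments u n - u n.+1 have a sum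
    with finite integral.  Almost everywhere this sum is finite, so the
    increments are O(2 ^ - n) and u n converges; Fatou's lemma passes the
    estimates to the limit. *)
Lemma L2_complete (u : nat -> R -> R) : (forall n, Lsq (u n)) ->
  (forall n l, (n <= l)%N -> circle_int (fun x => (u n x - u l x) ^+ 2) <= 8^-1 ^+ n) ->
  exists2 w, Lsq w & forall n, circle_int (fun x => (u n x - w x) ^+ 2) <= 8^-1 ^+ n.
Proof.
move=> su Hu; have Fae := ae_filter_ringOfSetsType mu.
have mU n : measurable_fun I01 (u n) by case: (su n) => Ln _; exact: circle_L_measurable Ln.
have mD n l : measurable_fun I01 (fun x => (u n x - u l x) ^+ 2).
  by apply: measurable_funX; exact: measurable_funB.
have iD n l : mu.-integrable I01 (EFin \o (fun x => (u n x - u l x) ^+ 2)).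
  have [h _] := sqr_comb 1 (-1) (su n) (su l).
  by apply: eq_integrable h => // x _; rewrite /= /comb mul1r mulN1r.
have ID n l : (\int[mu]_(x in I01) ((u n x - u l x) ^+ 2)%:E = (circle_int (fun x => (u n x - u l x) ^+ 2))%:E)%E.
  by rewrite fineK//; exact: integrable_fin_num (iD n l).
pose h n x : \bar R := ((2 ^+ n) ^+ 2 * (u n x - u n.+1 x) ^+ 2)%:E.
have h0 n x : (0 <= h n x)%E by rewrite lee_fin mulr_ge0// sqr_ge0.
have mh n : measurable_fun I01 (h n) by apply/measurable_EFinP; exact: measurable_funM.
pose H x := (\sum_(0 <= n <oo) h n x)%E.
have mH : measurable_fun I01 H by apply: ge0_emeasurable_sum.
have H0 x : (0 <= H x)%E by apply: nneseries_ge0.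
have iH : mu.-integrable I01 H.
  apply/integrableP; split => //.
  under eq_integral do rewrite gee0_abs//.
  rewrite integral_nneseries//.
  apply: (@le_lt_trans _ _ 2%:E); last by rewrite ltry.
  apply: nneseries_le => [n|N]; first by apply: integral_ge0.
  apply: (@le_trans _ _ (\sum_(0 <= n < N) ((1/2) ^+ n)%:E)%E); last by rewrite sumEFin lee_fin geometric_half.
  apply: lee_sum => n _; rewrite /h; under eq_integral do rewrite EFinM.
  rewrite ge0_integralZl//; last 2 first.
  - by apply/measurable_EFinP; exact: (mD n n.+1).
  - by move=> x _; rewrite lee_fin sqr_ge0.
  rewrite ID -EFinM lee_fin.
  apply: (@le_trans _ _ ((2 ^+ n) ^+ 2 * 8^-1 ^+ n)); first by rewrite ler_wpM2l ?sqr_ge0// Hu.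
  rewrite -exprM mulnC exprM -exprMn lerXn2r// ?nnegrE; lra.
have cv : {ae mu, forall x, I01 x -> exists2 l : R, u n x @[n --> \oo] --> l & True}.
  have Hae := integrable_ae _ iH; have {}Hae := Hae (measurable_itv _).
  apply: filterS Hae => x Hx xD.
  have Hf := Hx xD; pose S := Num.sqrt (fine (H x)).
  have dS n : `|u n x - u n.+1 x| <= S * (1/2) ^+ n.
    have : (h n x <= H x)%E.
      apply: le_trans (nneseries_lim_ge (u_ := h ^~ x) (P := xpredT) n.+1 _) => //.
      by rewrite big_nat_recr//= leeDr// sume_ge0.
    rewrite -(fineK Hf) lee_fin -exprMn -[X in _ <= X]sqr_sqrtr ?fine_ge0//.
    rewrite -/S -real_normK ?num_real// ler_pXn2r ?nnegrE ?sqrtr_ge0// normrM gtr0_norm ?exprn_gt0// => hh.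
    by rewrite div1r exprVn ler_pdivlMr ?exprn_gt0// mulrC.
  have S0 : 0 <= S by exact: sqrtr_ge0.
  have e0 k : 0 <= (1/2 : R) ^+ k by rewrite exprn_ge0//; lra.
  have dk n k : `|u (n + k)%N x - u n x| <= 2 * S * (1/2) ^+ n.
    suff : `|u (n + k)%N x - u n x| <= 2 * S * (1/2) ^+ n - 2 * S * (1/2) ^+ (n + k).
      by move/le_trans; apply; rewrite gerBl// mulr_ge0// mulr_ge0.
    elim: k => [|k IH]; first by rewrite addn0 !subrr normr0.
    rewrite addnS; have -> : u (n + k).+1 x - u n x = (u (n + k)%N x - u n x) - (u (n + k)%N x - u (n + k).+1 x) by ring.
    apply: le_trans (ler_normB _ _) _; have := dS (n + k)%N.
    have -> : 2 * S * (1/2) ^+ (n + k).+1 = S * (1/2) ^+ (n + k) by rewrite exprS; field.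
    lra.
  have q01 : 0 <= (1/2 : R) < 1 by apply/andP; split; lra.
  by have [l cl _] := geometric_cvg q01 dk; exists l.
(* the upper limit is a limit that is defined, measurable and periodic
   everywhere *)
pose w x := fine (limn_esup (fun n => (u n x)%:E)).
have wE x l : u n x @[n --> \oo] --> l -> w x = l.
  move=> cl; have cE : (u n x)%:E @[n --> \oo] --> l%:E by apply: cvg_EFin => //; exact: nearW.
  by rewrite /w; have [_ ->] := cvg_limn_einf_sup cE.
have mw : measurable_fun I01 w.
  apply: measurableT_comp => //; apply: measurable_fun_limn_esup => n; exact/measurable_EFinP.
have pw : periodic w 1.
  move=> x; rewrite /w; congr (fine (limn_esup _)); apply/funext => n.
  by case: (su n) => [[pu _] _]; rewrite pu.
have fat n : (\int[mu]_(x in I01) ((u n x - w x) ^+ 2)%:E <= (8^-1 ^+ n)%:E)%E.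
  pose F l x : \bar R := ((u n x - u (n + l)%N x) ^+ 2)%:E.
  have mF l : measurable_fun I01 (F l) by apply/measurable_EFinP.
  have F0 l x : I01 x -> (0 <= F l x)%E by move=> _; rewrite lee_fin sqr_ge0.
  have Hfat := fatou mu _ mF F0; have {}Hfat := Hfat (measurable_itv _).
  apply: le_trans (le_trans _ Hfat) _; last first.
    apply: limn_einf_le => l; rewrite /F ID lee_fin; apply: Hu; exact: leq_addr.
  apply: ae_ge0_le_integral => //.
  - by move=> x _; rewrite lee_fin sqr_ge0.
  - by apply/measurable_EFinP; apply: measurable_funX; exact: (measurable_funB (mU _) mw).
  - move=> x _; rewrite limn_einf_lim; apply: lime_ge; first exact: is_cvg_einfs.
    by apply: nearW => k; apply: le_ereal_inf_tmp => _ [j _ <-]; rewrite lee_fin sqr_ge0.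
  - rewrite (_ : (fun x => _) = fun x => (- limn_esup (fun k => - F k x))%E); last first.
      apply/funext => x; have := limn_esupN (F ^~ x); rewrite /comp => ->; by rewrite oppeK.
    apply: measurableT_comp => //; apply: measurable_fun_limn_esup => k.
    by apply: (measurableT_comp _ (mF k)).
  apply: filterS cv => x cvx xD; have [l cl _] := cvx xD.
  have cF : F k x @[k --> \oo] --> ((u n x - l) ^+ 2)%:E.
    apply: cvg_EFin; first exact: nearW.
    have cs : u (n + k)%N x @[k --> \oo] --> l.
      rewrite (_ : (fun k => u (n + k)%N x) = fun k => u (k + n)%N x); last by apply/funext => k; rewrite addnC.
      by rewrite (cvg_shiftn n (fun k => u k x)).
    have c1 : u n x - u (n + k)%N x @[k --> \oo] --> u n x - l by apply: cvgB => //; exact: cvg_cst.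
    exact: (cvgM c1 c1).
  by have [-> _] := cvg_limn_einf_sup cF; rewrite (wE x l cl).
have ifat n : mu.-integrable I01 (EFin \o (fun x => (u n x - w x) ^+ 2)).
  apply/integrableP; split.
    by apply/measurable_EFinP; apply: measurable_funX; exact: (measurable_funB (mU _) mw).
  under eq_integral do rewrite gee0_abs ?lee_fin ?sqr_ge0//.
  by apply: le_lt_trans (fat n) _; rewrite ltry.
have sn : Lsq (fun x => u 0%N x - w x).
  apply: Lsq_intro => //; first by move=> x; rewrite pw; case: (su 0%N) => [[-> _] _].
  exact: (measurable_funB (mU _) mw).
have sw : Lsq w.
  have := Lsq_comb 1 (-1) (su 0%N) sn; congr Lsq.
  by apply/funext => x; rewrite /comb; ring.
exists w => // n; rewrite -lee_fin fineK; first exact: fat.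
exact: integrable_fin_num (ifat n).
Qed.

Lemma H4_diff_derivative f g k : H4 f -> H4 g -> (k <= 4)%N ->
  circle_ae_eq (D k (comb 1 (-1) f g)) (fun x => D k f x - D k g x).
Proof.
move=> Hf Hg k4; have [wf [Lf _]] := H4_weak Hf k4; have [wg [Lg _]] := H4_weak Hg k4.
have [wc _] := H4_weak (H4_comb 1 (-1) Hf Hg) k4.
have := weak_derivative_ae wc (weak_derivative_comb 1 (-1) (H4_circle_L1 Hf) (H4_circle_L1 Hg) wf wg).
by congr circle_ae_eq; apply/funext => x; rewrite /comb; ring.
Qed.

Lemma H4_diff_sqr f g k : H4 f -> H4 g -> (k <= 4)%N ->
  circle_int (fun x => (D k f x - D k g x) ^+ 2) <= H4sq (comb 1 (-1) f g).
Proof.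
move=> Hf Hg k4; have ae := H4_diff_derivative Hf Hg k4.
have [wf [Lf _]] := H4_weak Hf k4; have [wg [Lg _]] := H4_weak Hg k4.
have [_ [Lc _]] := H4_weak (H4_comb 1 (-1) Hf Hg) k4.
rewrite -(Lsq_int_congr Lc (circle_L1B Lf Lg) ae) /H4sq (bigD1 (Ordinal (k4 : (k < 5)%N)))//= lerDl.
by apply: sumr_ge0 => j _; exact: circle_int_sqr_ge0.
Qed.

Lemma H4_sup f x : H4 f -> `|f x| <= 2 * H4norm f.
Proof. by move=> Hf; have [_ /(_ 0%N isT)[_]] := H4_regular Hf; apply. Qed.

(** The embedding makes f n converge uniformly, and the weak derivatives
    converge in L^2; integration by parts passes to the limit, so the L^2
    limits are weak derivatives of the uniform limit.  The rate 64 ^ - n for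
    squares is 8 ^ - n for norms. *)
Lemma H4_complete (f : nat -> R -> R) : (forall n, H4 (f n)) ->
  (forall n l, (n <= l)%N -> H4sq (comb 1 (-1) (f n) (f l)) <= 64^-1 ^+ n) ->
  exists2 g, H4 g & forall n, H4sq (comb 1 (-1) (f n) g) <= 5 * 8^-1 ^+ n.
Proof.
move=> Hf Cf.
have Cf8 n l : (n <= l)%N -> H4sq (comb 1 (-1) (f n) (f l)) <= 8^-1 ^+ n.
  by move=> nl; apply: le_trans (Cf n l nl) _; rewrite lerXn2r ?nnegrE//; lra.
have nCf n l : (n <= l)%N -> H4norm (comb 1 (-1) (f n) (f l)) <= 8^-1 ^+ n.
  move=> nl; rewrite -(@ler_pXn2r _ 2)// ?nnegrE ?sqrtr_ge0 ?exprn_ge0//.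
  rewrite H4norm_sqr -exprM mulnC exprM; apply: le_trans (Cf n l nl) _.
  by rewrite lerXn2r ?nnegrE//; lra.
have e0 n : 0 <= (8^-1 : R) ^+ n by rewrite exprn_ge0.
have exw k : exists w : R -> R, (k <= 4)%N -> Lsq w /\
    forall n, circle_int (fun x => (D k (f n) x - w x) ^+ 2) <= 8^-1 ^+ n.
  have [k4|] := boolP (k <= 4)%N; last by exists (cst 0).
  have [n|n l nl|w sw Hw] := @L2_complete (fun n => D k (f n)); last by exists w.
    by have [] := H4_weak (Hf n) k4.
  by apply: le_trans (H4_diff_sqr (Hf n) (Hf l) k4) (Cf8 n l nl).
have [w Hw] := choice exw.
have q01 : 0 <= (8^-1 : R) < 1 by apply/andP; split; lra.
have unif x n k : `|f (n + k)%N x - f n x| <= 2 * 8^-1 ^+ n.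
  have := H4_sup x (H4_comb 1 (-1) (Hf n) (Hf (n + k)%N)).
  rewrite /comb mul1r mulN1r distrC; move/le_trans; apply.
  by rewrite ler_wpM2l// nCf// leq_addr.
have exg x : exists l, forall n, `|f n x - l| <= 2 * 8^-1 ^+ n.
  by have [l _ h] := geometric_cvg q01 (unif x); exists l.
have [g Hg] := choice exg.
have gf n x : `|f n x - g x| <= 2 * 8^-1 ^+ n by exact: Hg.
have cf n : continuous (f n) by case: (Hf n).
have pf n : periodic (f n) 1 by case: (H4_circle_L1 (Hf n)).
have cg : continuous g := geometric_limit_continuous q01 cf gf.
have pg : periodic g 1.
  move=> x; apply/eqP; rewrite -subr_eq0 -normr_le0.
  apply: (geometric_le0 (C := 4) q01) => N.
  have h1 := gf N x; have h2 := gf N (x + 1); rewrite pf in h2.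
  have -> : g (x + 1) - g x = (f N x - g x) - (f N x - g (x + 1)) by ring.
  by apply: le_trans (ler_normB _ _) _; lra.
have wk k : (k <= 4)%N -> is_weak_derivative k g (w k) /\ Lsq (w k).
  move=> k4; have [sw wn] := Hw k k4; split => //; split; first by case: sw.
  move=> phi tphi.
  have cphi := test_continuous tphi; have pphi := test_periodic tphi.
  have tk := test_derive1n k tphi; have ck := test_continuous tk; have pk := test_periodic tk.
  have [B B0 phiB] := continuous_periodic_bounded cphi pphi.
  have [B' B'0 phiB'] := continuous_periodic_bounded ck pk.
  have q01' : 0 <= (1/2 : R) < 1 by apply/andP; split; lra.
  apply/eqP; rewrite -subr_eq0 -normr_le0.
  apply: (geometric_le0 (C := 2 * B' + B) q01') => n.
  have [wD [LD _]] := H4_weak (Hf n) k4; have [_ HD] := wD.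
  have E := HD phi tphi.
  have Lw := proj1 sw.
  have c1 : continuous (fun x => g x * derive1n k phi x) by move=> x; apply: cvgM; [exact: cg|exact: ck].
  have c2 : continuous (fun x => f n x * derive1n k phi x) by move=> x; apply: cvgM; [exact: cf|exact: ck].
  have h1 : `|circle_int (fun x => f n x * derive1n k phi x) - circle_int (fun x => g x * derive1n k phi x)|
      <= 2 * 8^-1 ^+ n * B'.
    rewrite -circle_intB//; apply: circle_int_norm => x; first by apply: cvgB; [exact: c2|exact: c1].
    by rewrite -mulrBl normrM ler_pM.
  have mphi : measurable_fun I01 phi by apply: measurable_funTS; exact: continuous_measurable_fun.
  have sd : Lsq (fun x => D k (f n) x - w k x).
    have := Lsq_comb 1 (-1) (conj LD (proj2 (proj2 (H4_weak (Hf n) k4)))) sw; congr Lsq.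
    by apply/funext => x; rewrite /comb; ring.
  have h2 : circle_int (fun x => D k (f n) x * phi x) - circle_int (fun x => w k x * phi x) =
      circle_int (fun x => (D k (f n) x - w k x) * phi x).
    have i1 := circle_L1M LD cphi pphi; have i2 := circle_L1M Lw cphi pphi.
    by rewrite -circle_intBi//; apply: circle_int_ext => x; rewrite mulrBl.
  have h3 := circle_int_mul_bound (circle_L1_integrable (proj1 sd)) mphi phiB.
  have h4 : L1norm (fun x => D k (f n) x - w k x) <= (1/2) ^+ n.
    have en : 0 <= (1/2 : R) ^+ n by apply: exprn_ge0; lra.
    rewrite -(@ler_pXn2r _ 2)// ?nnegrE ?L1norm_ge0//.
    apply: le_trans (L1norm_sqr sd) _; apply: le_trans (wn n) _.
    by rewrite -exprM mulnC exprM lerXn2r ?nnegrE//; lra.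
  rewrite -h2 in h3.
  have h5 : `|circle_int (fun x => D k (f n) x * phi x) - circle_int (fun x => w k x * phi x)| <= (1/2) ^+ n * B.
    by apply: le_trans h3 _; rewrite ler_wpM2r.
  rewrite E in h1.
  have h6 : 2 * 8^-1 ^+ n * B' <= 2 * B' * (1/2) ^+ n.
    by rewrite mulrAC ler_wpM2l ?mulr_ge0// lerXn2r ?nnegrE//; lra.
  rewrite mulrDl; move: h1 h5 h6; set a := circle_int _; set b := circle_int _.
  set c := circle_int _; clearbody a b c => h1 h5 h6.
  have -> : b - (-1) ^+ k * c = - ((-1) ^+ k * a - b) + (-1) ^+ k * (a - c) by ring.
  apply: le_trans (ler_normD _ _) _; rewrite normrN normrM normrX normrN1 expr1n [1 * `|_|]mul1r.
  apply: lerD; first exact: le_trans h1 h6.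
  by rewrite [leRHS]mulrC.
have [H4g _] := H4_intro cg pg wk.
exists g => // n.
have Hc := H4_comb 1 (-1) (Hf n) H4g; have [pc _] := H4_circle_L1 Hc.
have hk k : (k <= 4)%N -> is_weak_derivative k (comb 1 (-1) (f n) g) (comb 1 (-1) (D k (f n)) (w k)) /\
    Lsq (comb 1 (-1) (D k (f n)) (w k)).
  move=> k4; have [wD sD] := H4_weak (Hf n) k4; have [wg sg] := wk k k4; split.
    by apply: weak_derivative_comb => //; exact: H4_circle_L1.
  exact: Lsq_comb.
have [_ ->] := H4_intro Hc.2 pc hk.
apply: (@le_trans _ _ (\sum_(k < 5) 8^-1 ^+ n)); last by rewrite sumr_const card_ord mulr_natl.
apply: ler_sum => k _; have k4 : (k <= 4)%N by rewrite -ltnS.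
have [_ /(_ n)] := Hw k k4; apply: le_trans; rewrite le_eqVlt; apply/orP; left; apply/eqP.
by apply: circle_int_ext => x; rewrite /comb mul1r mulN1r.
Qed.

End H4_space.

(** * Minimisation on the unit ball *)

Section minimiser.
Context {R : realType}.
Implicit Types (f g S : R -> R).

Lemma midpoint_ge (a p q : R) : a <= - p -> a <= - q -> a <= - (1/2 * p + 1/2 * q).
Proof. by move=> h1 h2; lra. Qed.

Lemma parallelogram_bound (e A B G : R) : (1 - e) ^+ 2 <= (1/2) ^+ 2 * A + 2 * (1/2) * (1/2) * B + (1/2) ^+ 2 * G ->
  A <= 1 -> G <= 1 -> 1 ^+ 2 * A + 2 * 1 * (-1) * B + (-1) ^+ 2 * G <= 8 * e.
Proof. by move=> h hA hG; have := sqr_ge0 e; rewrite !expr2 in h *; lra. Qed.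

(** The Cauchy-Schwarz bound - 2 B <= t A + d / t, from the quadratic form at
    (t, 1). *)
Lemma shifted_square_bound (t A B d : R) : 0 < t -> 0 <= t ^+ 2 * A + 2 * t * 1 * B + 1 ^+ 2 * d ->
  1 ^+ 2 * A + 2 * 1 * (-1) * B + (-1) ^+ 2 * d <= A + t * A + d / t + d.
Proof.
move=> t0 h; have : 0 <= t * A + 2 * B + d / t.
  rewrite -(pmulr_rge0 _ t0); apply: le_trans h _; rewrite le_eqVlt; apply/orP; left; apply/eqP.
  by field; rewrite gt_eqF.
by rewrite !expr2; lra.
Qed.

Lemma sum_bound (a b A d t : R) : a <= 5 * t -> d <= 5 * t -> b <= t -> A <= 1 ->
  A + b + a + d <= 1 + 11 * t.
Proof. by move=> *; lra. Qed.

Lemma limit_value_bound (mm a b p q u : R) : mm - a <= - p -> - b <= p - q -> a <= u ->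
  mm - (- q) <= u + b.
Proof. by move=> *; lra. Qed.

Lemma H4sq_le1 f : H4norm f <= 1 -> H4sq f <= 1.
Proof. by move=> n1; rewrite -H4norm_sqr; apply: exprn_ile1 => //; exact: sqrtr_ge0. Qed.

Variable J : (R -> R) -> R.
Hypothesis J_linear : forall a b f g, H4 f -> H4 g -> J (comb a b f g) = a * J f + b * J g.
Variable C : R.
Hypothesis C0 : 0 <= C.
Hypothesis J_bound : forall f N, H4 f -> 0 < N -> H4norm f <= N -> `|J f| <= C * N.
Hypothesis J_neq0 : exists2 f, H4 f & J f <> 0.

Lemma J_norm_bound f : H4 f -> `|J f| <= C * H4norm f.
Proof.
move=> Hf; have n0 : 0 <= H4norm f by exact: sqrtr_ge0.
apply/ler_addgt0Pr => e e0.
have C1 : 0 < C + 1 by rewrite ltr_wpDl.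
have N0 : 0 < H4norm f + e / (C + 1) by rewrite ltr_wpDl// divr_gt0.
have le : H4norm f <= H4norm f + e / (C + 1) by rewrite lerDl divr_ge0 ?ltW.
apply: le_trans (J_bound Hf N0 le) _; rewrite mulrDr lerD2l mulrCA ger_pMr//.
by rewrite ler_pdivrMr// mul1r lerDl.
Qed.

Definition ball_values : set R := [set - J f | f in [set f | H4 f /\ H4norm f <= 1]].

Lemma H4norm_scale a f : H4 f -> 0 <= a -> H4norm (comb a 0 f f) = a * H4norm f.
Proof.
move=> Hf a0; have [B EB] := H4sq_comb Hf Hf.
rewrite H4norm_sqrt EB !expr0n/= mulr0 mul0r mul0r !addr0 sqrtrM ?sqr_ge0//.
by rewrite sqrtr_sqr ger0_norm.
Qed.

Lemma unit_ball_bounded : has_sup ball_values.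
Proof.
have [f Hf Jf] := J_neq0; split.
  exists (- J (comb 0 0 f f)); exists (comb 0 0 f f) => //=; split; first exact: H4_comb.
  by rewrite H4norm_scale// mul0r.
exists C => _ [g [Hg ng] <-]; apply: le_trans (ler_norm _) _; rewrite normrN.
by apply: le_trans (J_norm_bound Hg) _; rewrite ler_piMr.
Qed.

Local Notation m := (sup ball_values).

Lemma le_m f : H4 f -> H4norm f <= 1 -> - J f <= m.
Proof. by move=> Hf nf; apply: ub_le_sup; [case: unit_ball_bounded|exists f]. Qed.

Lemma J_lower f : H4 f -> - J f <= m * H4norm f.
Proof.
move=> Hf; have [n0|n0] := leP (H4norm f) 0.
  have E : H4norm f = 0 by apply/eqP; rewrite eq_le n0 sqrtr_ge0.
  have := J_norm_bound Hf; rewrite E !mulr0 normr_le0 => /eqP ->.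
  by rewrite oppr0.
have ni : 0 <= (H4norm f)^-1 by rewrite invr_ge0 ltW.
have := @le_m (comb (H4norm f)^-1 0 f f) (H4_comb _ _ Hf Hf).
rewrite H4norm_scale// mulVf ?gt_eqF// lexx => /(_ isT).
by rewrite J_linear// mul0r addr0 mulrC -mulNr ler_pdivrMr.
Qed.

(** One of f and - f makes - J positive. *)
Lemma m_gt0 : 0 < m.
Proof.
have [f Hf Jf] := J_neq0.
have pos g : H4 g -> 0 < - J g -> 0 < m.
  move=> Hg Jg; have h := J_lower Hg; rewrite ltNge; apply/negP => m0.
  have : m * H4norm g <= 0 by rewrite mulr_le0_ge0// sqrtr_ge0.
  by move=> h2; move: Jg; rewrite ltNge (le_trans h h2).
have [Jp|Jn] := ltP (J f) 0; first by apply: (pos f) => //; rewrite oppr_gt0.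
apply: (pos (comb (-1) 0 f f)); first exact: H4_comb.
rewrite J_linear// mul0r addr0 mulN1r opprK lt_neqAle eq_sym Jn andbT.
by apply/negP => /eqP.
Qed.

(** By J_lower the midpoint has norm at least 1 - e, and by the parallelogram
    law the norm of f - g is then small.  For e = 0 this is uniqueness. *)
Lemma almost_minimisers f g e : H4 f -> H4 g -> H4norm f <= 1 -> H4norm g <= 1 -> 0 <= e <= 1 ->
  m * (1 - e) <= - J f -> m * (1 - e) <= - J g -> H4sq (comb 1 (-1) f g) <= 8 * e.
Proof.
move=> Hf Hg nf ng /andP[e0 e1] Jf Jg; have mp := m_gt0.
have Hm := H4_comb (1/2) (1/2) Hf Hg.
have h1 := J_lower Hm; rewrite J_linear// in h1.
have h2 : m * (1 - e) <= m * H4norm (comb (1/2) (1/2) f g) by apply: le_trans h1; exact: midpoint_ge.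
rewrite ler_pM2l// in h2.
have h3 : (1 - e) ^+ 2 <= H4sq (comb (1/2) (1/2) f g).
  by rewrite -H4norm_sqr lerXn2r// ?nnegrE ?subr_ge0// sqrtr_ge0.
have [B EB] := H4sq_comb Hf Hg; rewrite EB in h3; rewrite EB.
have sf : H4sq f <= 1 by exact: H4sq_le1.
have sg : H4sq g <= 1 by exact: H4sq_le1.
exact: parallelogram_bound h3 sf sg.
Qed.

Lemma H4_eq f g : H4 f -> H4 g -> H4sq (comb 1 (-1) f g) <= 0 -> f = g.
Proof.
move=> Hf Hg s0; have Hd := H4_comb 1 (-1) Hf Hg.
have E : H4norm (comb 1 (-1) f g) = 0.
  by rewrite H4norm_sqrt; apply/eqP; rewrite sqrtr_eq0.
apply/funext => x; have := H4_sup x Hd; rewrite E mulr0 normr_le0 /comb mul1r mulN1r subr_eq0.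
by move/eqP.
Qed.

(** Choose f n in the unit ball with - J (f n) >= m (1 - e n).  By
    almost_minimisers and H4_complete the sequence converges, and its limit
    attains the supremum m. *)
Lemma unique_minimiser : exists! f, [/\ H4 f, H4norm f <= 1 &
  forall S, H4 S -> H4norm S <= 1 -> J f <= J S].
Proof.
have mp := m_gt0.
have p64 n : (64^-1 : R) ^+ n <= (1/2) ^+ n by apply: lerXn2r; rewrite ?nnegrE//; lra.
(* 8 e n = 64 ^ - n is the rate asked for by H4_complete *)
pose e n : R := 8^-1 * 64^-1 ^+ n.
have e01 n : 0 < e n <= 1.
  rewrite /e mulr_gt0 ?exprn_gt0//=; apply: mulr_ile1 => //.
    by rewrite invf_le1// ler1n.
  by apply: exprn_ile1 => //; rewrite invf_le1// ler1n.
have ex n : exists f, [/\ H4 f, H4norm f <= 1 & m * (1 - e n) <= - J f].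
  have /andP[en0 _] := e01 n.
  have me : 0 < m * e n by rewrite mulr_gt0.
  have [_ [f [Hf nf] <-] h] := sup_adherent me unit_ball_bounded.
  by exists f; split => //; apply: ltW; rewrite mulrBr mulr1.
have [f Hf] := choice ex.
have Hf4 n : H4 (f n) by case: (Hf n).
have [n l nl|g Hg cg] := H4_complete Hf4.
  have [_ n1 J1] := Hf n; have [_ n2 J2] := Hf l.
  have el : e l <= e n.
    rewrite /e ler_wpM2l// -(subnKC nl) exprD; apply: ler_piMr; first exact: exprn_ge0.
    by apply: exprn_ile1 => //; rewrite invf_le1// ler1n.
  have J2' : m * (1 - e n) <= - J (f l) by apply: le_trans J2; rewrite ler_pM2l// lerD2l lerN2.
  have en01 : 0 <= e n <= 1 by have /andP[/ltW -> ->] := e01 n.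
  apply: le_trans (almost_minimisers (Hf4 n) (Hf4 l) n1 n2 en01 J1 J2') _.
  by rewrite /e mulrA divff// mul1r.
have q01 : 0 <= (1/2 : R) < 1 by apply/andP; split; lra.
have hp n : 0 < (1/2 : R) ^+ n by apply: exprn_gt0; lra.
have eh n : (8^-1 : R) ^+ n <= (1/2) ^+ n * (1/2) ^+ n.
  by rewrite -exprMn; apply: lerXn2r; rewrite ?nnegrE//; lra.
have h1 n : (1/2 : R) ^+ n <= 1 by apply: exprn_ile1; lra.
have dsq n : H4sq (comb 1 (-1) (f n) g) <= 5 * ((1/2) ^+ n * (1/2) ^+ n).
  by apply: le_trans (cg n) _; rewrite ler_wpM2l.
have dn n : H4norm (comb 1 (-1) (f n) g) <= 5 * (1/2) ^+ n.
  have en := hp n.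
  rewrite -(@ler_pXn2r _ 2)// ?nnegrE ?sqrtr_ge0 ?mulr_ge0 ?(ltW en)// H4norm_sqr.
  apply: le_trans (dsq n) _; rewrite expr2 mulrACA ler_wpM2r ?mulr_ge0 ?(ltW en)//; lra.
have ng : H4norm g <= 1.
  rewrite -(@ler_pXn2r _ 2)// ?nnegrE ?sqrtr_ge0// H4norm_sqr expr1n -subr_le0.
  apply: (geometric_le0 (C := 11) q01) => n.
  have Hd := H4_comb 1 (-1) (Hf4 n) Hg; have [B EB] := H4sq_comb (Hf4 n) Hd.
  have E : comb 1 (-1) (f n) (comb 1 (-1) (f n) g) = g by apply/funext => x; rewrite /comb; ring.
  have sq0 := H4sq_ge0 (comb ((1/2) ^+ n) 1 (f n) (comb 1 (-1) (f n) g)).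
  rewrite EB in sq0; have := EB 1 (-1); rewrite E => ->.
  have sf : H4sq (f n) <= 1 by case: (Hf n) => _ n1 _; exact: H4sq_le1.
  rewrite lerBlDl; apply: le_trans (shifted_square_bound (hp n) sq0) _.
  set d := H4sq (comb _ _ _ _); have hd : d <= 5 * ((1/2) ^+ n * (1/2) ^+ n) := dsq n.
  have ht := hp n; have ht1 := h1 n.
  have d1 : d / (1/2) ^+ n <= 5 * (1/2) ^+ n by rewrite ler_pdivrMr// -mulrA.
  have d2 : d <= 5 * (1/2) ^+ n by apply: le_trans hd _; rewrite ler_wpM2l// ger_pMr.
  have d3 : (1/2) ^+ n * H4sq (f n) <= (1/2) ^+ n by rewrite ger_pMr.
  exact: sum_bound d1 d2 d3 sf.
have Jg : - J g = m.
  apply/eqP; rewrite eq_le le_m//= -subr_le0.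
  apply: (geometric_le0 (C := m + C * 5) q01) => n.
  have [_ _ Jn] := Hf n; have Hd := H4_comb 1 (-1) (Hf4 n) Hg.
  have b := J_norm_bound Hd; rewrite J_linear// mul1r mulN1r in b.
  have b2 : `|J (f n) - J g| <= C * (5 * (1/2) ^+ n) by apply: le_trans b _; rewrite ler_wpM2l.
  have b3 : m * e n <= m * (1/2) ^+ n.
    rewrite ler_pM2l// /e -[leRHS]mul1r; apply: ler_pM => //.
    by rewrite invf_le1// ler1n.
  move: b2; rewrite ler_norml => /andP[b2 _].
  rewrite mulrBr mulr1 in Jn; rewrite mulrDl -[_ * 5 * _]mulrA.
  exact: limit_value_bound Jn b2 b3.
exists g; split.
  split => // S HS nS; by have := le_m HS nS; rewrite -Jg lerN2.
move=> f' [Hf' nf' Jf'].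
have J' : m <= - J f' by rewrite -Jg lerN2; exact: Jf'.
have z01 : 0 <= (0 : R) <= 1 by rewrite lexx ler01.
apply: H4_eq => //.
have := almost_minimisers Hg Hf' ng nf' z01; rewrite subr0 mulr1 mulr0; apply => //.
by rewrite Jg.
Qed.

End minimiser.

Theorem proposition7 (R : realType) (T0 c : R -> R)
    (A0 : circle_map 4 T0) (A1 : expanding T0)
    (c_bounded : circle_L +oo%E c)
    (J_nonzero : exists Tdot : R -> R, H4 Tdot /\ responseJ c T0 Tdot <> 0) :
  exists! Tdot : R -> R,
    [/\ H4 Tdot,
        H4norm Tdot <= 1
      & forall S : R -> R, H4 S -> H4norm S <= 1 ->
          responseJ c T0 Tdot <= responseJ c T0 S].
Proof.
have [C C0 HC] := responseJ_bound A0 A1 c_bounded.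
apply: (@unique_minimiser _ _ _ (C * 2)).
- move=> a b f g Hf Hg; have [cf _] := H4_regular Hf; have [cg _] := H4_regular Hg.
  exact: (responseJ_linear A0 A1 c_bounded).
- by rewrite mulr_ge0.
- move=> f N Hf N0 nN; have [cf bf] := H4_regular Hf; rewrite -mulrA.
  apply: HC => //; first by rewrite mulr_gt0.
  move=> i x i2; have [_ /(_ x) h] := bf i (leqW i2); apply: le_trans h _.
  by rewrite ler_wpM2l.
- by have [f [Hf Jf]] := J_nonzero; exists f.
Qed.
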